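(* There exists a polynomial-time algorithm that, given a Euclidean $k$-means instance $(P,\mathbb{R}^r,\operatorname{d})$ with no boundary points, oracle access to same-cluster queries that are consistent with some fixed optimal clustering $\mathcal{O}$, and parameters $(\epsilon,\delta)\in(0,1)^2$, outputs a $k$-clustering $\hat{\mathcal{O}}$ that, with probability at least $1-\delta$, is $(1-\epsilon)$-accurate with respect to $\mathcal{O}$ (i.e. $\operatorname{error}(\hat{\mathcal{O}},\mathcal{O})\le \epsilon |P|$) and simultaneously satisfies $\operatorname{cost}(\hat{\mathcal{O}})\le(1+\epsilon)\,OPT$. The algorithm makes $$O\!\left(\frac{k^4}{\epsilon^2\delta}+\frac{k^{9}}{\epsilon^4}\log\frac1\delta + k\cdot m\!\left(\mathbb{R}^r,\frac{\epsilon^4}{k},\delta\right)\right)$$ same-cluster queries.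
   Context: A Euclidean $k$-means instance $(P,\mathbb{R}^r,\operatorname{d})$ consists of a finite set $P\subset\mathbb{R}^r$ of $n$ points, candidate centers $\mathbb{R}^r$, and Euclidean distance $\operatorname{d}(x,y)=\|x-y\|$. A $k$-clustering $\mathcal{C}$ is given by a labeling $f_{\mathcal{C}}:P\to[k]$ with clusters $C_i=f_{\mathcal{C}}^{-1}(i)$; for $C\subseteq P$ and a point $q$, $\operatorname{cost}(C,q)=\sum_{p\in C}\operatorname{d}(p,q)^2$; the center of $C_i$ is $c_i=\arg\min_q \operatorname{cost}(C_i,q)$ (the centroid), and $\operatorname{cost}(\mathcal{C})=\sum_i\operatorname{cost}(C_i,c_i)$. $OPT$ is the minimum of $\operatorname{cost}(\mathcal{C})$ over all $k$-clusterings, and an optimal clustering is one attaining it. The instance has no boundary points if in every optimal clustering with clusters $O_1,\dots,O_k$ and centers $o_1,\dots,o_k$, every $p\in O_i$ satisfies $\operatorname{d}(p,o_i)<\operatorname{d}(p,o_j)$ for all $j\neq i$. A same-cluster query on $(x,y)$ returns whether $x,y$ lie in the same cluster of the fixed optimal clustering $\mathcal{O}$. $\operatorname{error}(\mathcal{C},\mathcal{O})=\min_\sigma|\{p\in P: f_{\mathcal{O}}(p)\ne\sigma(f_{\mathcal{C}}(p))\}|$, minimum over permutations $\sigma$ of $[k]$; $\mathcal{C}$ is $(1-\alpha)$-accurate if $\operatorname{error}(\mathcal{C},\mathcal{O})\le\alpha n$. Learnability: a family $K$ of $k$-means instances is learnable with sample complexity $m(Q,\epsilon,\delta)$ (a positive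 integer-valued function) if there is an algorithm $\mathcal{A}_L$ such that for all $\epsilon,\delta\in(0,1)$, every $(P,Q,\operatorname{d})\in K$, every fixed optimal clustering $\mathcal{O}$ with labeling $f_{\mathcal{O}}$, and every fixed subset $T\subseteq P$: if $S$ is a multiset of at least $m(Q,\epsilon,\delta)$ independent uniform samples from $T$, then $\mathcal{A}_L$, given $(P,Q,\operatorname{d})$ and the pairs $(s,f_{\mathcal{O}}(s))$, $s\in S$, outputs $h:P\to[k]$ which with probability at least $1-\delta$ over $S$ satisfies $|\{p\in T:h(p)=f_{\mathcal{O}}(p)\}|\ge(1-\epsilon)|T|$. Here $m(\mathbb{R}^r,\epsilon,\delta)$ denotes a sample complexity with which the family of Euclidean $k$-means instances in $\mathbb{R}^r$ with no boundary points is learnable. *)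

(* Defs.v *)
From HB Require Import structures.
From mathcomp Require Import all_boot all_order all_algebra all_fingroup.
From mathcomp Require Import all_classical all_reals all_analysis.
Set Implicit Arguments.
Unset Strict Implicit.
Unset Printing Implicit Defensive.
Import Order.TTheory GRing.Theory Num.Theory.
Local Open Scope ring_scope.

(** * Euclidean k-means *)

(* The library norm on ['rV[R]_r] is the sup norm, hence this definition. *)
Definition eucl_dist (R : realType) (r : nat) (x y : 'rV[R]_r) : R :=
  Num.sqrt (\sum_(j < r) (x 0 j - y 0 j) ^+ 2).

(* The finite point set is given by an enumeration [P : 'I_n -> 'rV[R]_r],
   always assumed injective, so that labelings and clusters live on ['I_n].
   A k-clustering may have empty clusters. *)
Definition kclustering (n k : nat) := {ffun 'I_n -> 'I_k}.

Definition kcluster (n k : nat) (f : kclustering n k) (i : 'I_k) : {set 'I_n} :=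
  [set p | f p == i].

Definition cost_at (R : realType) (r n : nat) (P : 'I_n -> 'rV[R]_r)
    (A : {set 'I_n}) (q : 'rV[R]_r) : R :=
  \sum_(p in A) eucl_dist (P p) q ^+ 2.

(* For [A != finset.set0] this is the unique minimizer of [cost_at P A]: see
   [centroid_min] and [centroid_uniq]. *)
Definition centroid (R : realType) (r n : nat) (P : 'I_n -> 'rV[R]_r)
    (A : {set 'I_n}) : 'rV[R]_r :=
  #|A|%:R^-1 *: \sum_(p in A) P p.

Definition cost (R : realType) (r n k : nat) (P : 'I_n -> 'rV[R]_r)
    (f : kclustering n k) : R :=
  \sum_(i < k) cost_at P (kcluster f i) (centroid P (kcluster f i)).

Definition is_optimal (R : realType) (r n k : nat) (P : 'I_n -> 'rV[R]_r)
    (f : kclustering n k) : Prop :=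
  forall g : kclustering n k, cost P f <= cost P g.

(* An infimum over a finite set, attained as soon as a k-clustering exists:
   see [is_optimal_OPT]. *)
Definition OPT (R : realType) (r n : nat) (P : 'I_n -> 'rV[R]_r) (k : nat) : R :=
  inf (range (fun f : kclustering n k => cost P f)).

(* Empty clusters have no well-defined center and are not compared with; they
   occur in an optimal clustering only when [n < k]. *)
Definition no_boundary (R : realType) (r n : nat) (P : 'I_n -> 'rV[R]_r)
    (k : nat) : Prop :=
  forall f : kclustering n k, is_optimal P f ->
  forall (p : 'I_n) (j : 'I_k), j != f p -> kcluster f j != finset.set0 ->
    eucl_dist (P p) (centroid P (kcluster f (f p))) <
    eucl_dist (P p) (centroid P (kcluster f j)).

(* The default value [n] is an upper bound of all the cardinals involved. *)
Definition error (n k : nat) (g f : kclustering n k) : nat :=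
  \big[minn/n]_(s : 'S_k) #|[set p | f p != s (g p)]|.

Lemma eucl_dist_sqr (R : realType) (r : nat) (x y : 'rV[R]_r) :
  eucl_dist x y ^+ 2 = \sum_(j < r) (x 0 j - y 0 j) ^+ 2.
Proof. by rewrite sqr_sqrtr // sumr_ge0 // => j _; rewrite sqr_ge0. Qed.

Lemma cost_at_centroid (R : realType) (r n : nat) (P : 'I_n -> 'rV[R]_r)
    (A : {set 'I_n}) (q : 'rV[R]_r) :
  cost_at P A q =
  cost_at P A (centroid P A) + #|A|%:R * eucl_dist (centroid P A) q ^+ 2.
Proof.
have [->|A0] := eqVneq A finset.set0.
  by rewrite /cost_at !big_set0 cards0 mul0r addr0.
have cA0 : #|A|%:R != 0 :> R by rewrite pnatr_eq0 cards_eq0.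
set c := centroid P A.
have sumc j : \sum_(p in A) (P p 0 j - c 0 j) = 0.
  rewrite sumrB sumr_const mxE summxE -[X in _ - X]mulr_natr mulrAC.
  by rewrite mulVf // mul1r subrr.
rewrite /cost_at !eucl_dist_sqr.
under eq_bigr do rewrite eucl_dist_sqr.
under [in RHS]eq_bigr do rewrite eucl_dist_sqr.
rewrite exchange_big [in RHS]exchange_big /= mulr_sumr -big_split /=.
apply: eq_bigr => j _.
transitivity (\sum_(p in A) ((P p 0 j - c 0 j) ^+ 2 +
  ((P p 0 j - c 0 j) * ((c 0 j - q 0 j) *+ 2) + (c 0 j - q 0 j) ^+ 2))).
  apply: eq_bigr => p _.
  rewrite -[P p 0 j - q 0 j](subrKA (c 0 j)) sqrrD -addrA.
  by rewrite mulrnAr.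
rewrite !big_split /= -mulr_suml sumc mul0r add0r sumr_const.
by rewrite mulr_natl.
Qed.

Lemma centroid_min (R : realType) (r n : nat) (P : 'I_n -> 'rV[R]_r)
    (A : {set 'I_n}) (q : 'rV[R]_r) :
  cost_at P A (centroid P A) <= cost_at P A q.
Proof.
by rewrite [leRHS]cost_at_centroid lerDl mulr_ge0 // sqr_ge0.
Qed.

Lemma centroid_uniq (R : realType) (r n : nat) (P : 'I_n -> 'rV[R]_r)
    (A : {set 'I_n}) (q : 'rV[R]_r) : A != finset.set0 ->
  cost_at P A q <= cost_at P A (centroid P A) -> q = centroid P A.
Proof.
move=> A0; rewrite cost_at_centroid gerDl pmulr_rle0; last first.
  by rewrite ltr0n card_gt0.
rewrite eucl_dist_sqr => le0.
have /eqP : \sum_(j < r) (centroid P A 0 j - q 0 j) ^+ 2 = 0.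
  by apply/eqP; rewrite eq_le le0 sumr_ge0 // => j _; rewrite sqr_ge0.
rewrite psumr_eq0 => [/allP h|j _]; last by rewrite sqr_ge0.
apply/rowP => j; have := h j (mem_index_enum j).
by rewrite sqrf_eq0 subr_eq0 => /eqP.
Qed.

Lemma is_optimal_OPT (R : realType) (r n k : nat) (P : 'I_n -> 'rV[R]_r)
    (f : kclustering n k) : is_optimal P f -> cost P f = OPT P k.
Proof.
move=> fopt; apply/eqP; rewrite eq_le; apply/andP; split.
  by apply: lb_le_inf => [|_ [g _ <-]]; [exists (cost P f); exists f|exact: fopt].
apply: ge_inf; last by exists f.
by exists (cost P f) => _ [g _ <-]; exact: fopt.
Qed.

(** * Learnability *)

Definition learner (R : realType) (r k : nat) :=
  forall n : nat, ('I_n -> 'rV[R]_r) -> seq ('I_n * 'I_k) -> 'I_n -> 'I_k.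

(* The sample is a sequence of [M] independent uniform draws from [T], so the
   probability of an event is the proportion of the [#|T| ^ M] sequences that
   realize it.  The inequality is stated multiplied by [#|T| ^ M]; it is
   trivial for empty [T]. *)
Definition learns (R : realType) (r k : nat) (AL : learner R r k)
    (m : R -> R -> nat) : Prop :=
  forall eps delta : R, 0 < eps < 1 -> 0 < delta < 1 ->
  (0 < m eps delta)%N /\
  forall (n : nat) (P : 'I_n -> 'rV[R]_r), injective P -> no_boundary P k ->
  forall f : kclustering n k, is_optimal P f ->
  forall (T : {set 'I_n}) (M : nat), (m eps delta <= M)%N ->
  let good (S : M.-tuple 'I_n) :=
    (1 - eps) * #|T|%:R <=
    #|[set p in T | AL n P [seq (s, f s) | s <- S] p == f p]|%:R in
  (1 - delta) * (#|T| ^ M)%:R <=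
  #|[set S : M.-tuple 'I_n | all (mem T) S && good S]|%:R.

(** * Randomized algorithms with oracles *)

(* The machine model is the real RAM, presented as a while language.  Memory
   consists of arrays of naturals and arrays of reals, addressed by a name
   fixed in the program and two computed indices.  Reals are subject to exact
   unit-cost field operations and comparison (no rounding); naturals are
   subject to addition and truncated subtraction only, so that their bit size
   grows at most linearly with time.  Every atomic command or test takes one
   step: expressions have a size fixed by the program. *)

Inductive nexp : Type :=
| NConst of nat
| NGet of nat & nexp & nexp
| NAdd of nexp & nexp
| NSub of nexp & nexp.

Inductive rexp : Type :=
| RNat of nexp
| RGet of nat & nexp & nexp
| RAdd of rexp & rexp
| RSub of rexp & rexp
| RMul of rexp & rexp
| RDiv of rexp & rexp.

Inductive bexp : Type :=
| BNlt of nexp & nexp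
| BRlt of rexp & rexp
| BNot of bexp
| BAnd of bexp & bexp.

(* - [Flip a i j p]: [a[i,j]] becomes 1 with probability [p] clipped to [0, 1],
     and 0 otherwise, independently of all other flips;
   - [Query a i j x y]: [a[i,j]] becomes the answer (0 or 1) to the same-cluster
     query on the points of indices [x] and [y];
   - [SampleSize a i j e d]: [a[i,j]] becomes the sample complexity at [(e, d)];
   - [Label x l]: appends (point [x], label [l]) to the labeled sample;
   - [Clear]: empties the labeled sample;
   - [Learn a]: runs the learner once on the instance and the labeled sample,
     storing in [a[p,0]] the label of each point [p].
   A labeled sample is built one pair per step, hence is never longer than the
   running time; a call to the learner counts as one step. *)
Inductive com : Type :=
| Skip
| NSet of nat & nexp & nexp & nexp
| RSet of nat & nexp & nexp & rexp
| Seq of com & com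
| If of bexp & com & com
| While of bexp & com
| Flip of nat & nexp & nexp & rexp
| Query of nat & nexp & nexp & nexp & nexp
| SampleSize of nat & nexp & nexp & rexp & rexp
| Label of nexp & nexp
| Clear
| Learn of nat.

Definition mem2d (V : Type) := nat -> nat -> nat -> V.

Definition upd (V : Type) (mu : mem2d V) (a i j : nat) (v : V) : mem2d V :=
  fun a' i' j' => if [&& a' == a, i' == i & j' == j] then v else mu a' i' j'.

Record state (R : realType) (n k : nat) : Type := State {
  nmem : mem2d nat;
  rmem : mem2d R;
  sample : seq ('I_n * 'I_k);
  queries : nat (* ghost counter, not readable by the program *)
}.

Record oracles (R : realType) (n k : nat) : Type := Oracles {
  same_cluster : 'I_n -> 'I_n -> bool;
  sample_size : R -> R -> nat;
  learned : seq ('I_n * 'I_k) -> 'I_n -> 'I_k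
}.

Fixpoint neval (R : realType) (n k : nat) (s : state R n k) (e : nexp) : nat :=
  match e with
  | NConst c => c
  | NGet a i j => nmem s a (neval s i) (neval s j)
  | NAdd e1 e2 => neval s e1 + neval s e2
  | NSub e1 e2 => neval s e1 - neval s e2
  end.

Fixpoint reval (R : realType) (n k : nat) (s : state R n k) (e : rexp) : R :=
  match e with
  | RNat e1 => (neval s e1)%:R
  | RGet a i j => rmem s a (neval s i) (neval s j)
  | RAdd e1 e2 => reval s e1 + reval s e2
  | RSub e1 e2 => reval s e1 - reval s e2
  | RMul e1 e2 => reval s e1 * reval s e2
  | RDiv e1 e2 => reval s e1 / reval s e2
  end.

Fixpoint beval (R : realType) (n k : nat) (s : state R n k) (b : bexp) : bool :=
  match b with
  | BNlt e1 e2 => (neval s e1 < neval s e2)%N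
  | BRlt e1 e2 => reval s e1 < reval s e2
  | BNot b1 => ~~ beval s b1
  | BAnd b1 b2 => beval s b1 && beval s b2
  end.

Definition set_nmem (R : realType) (n k : nat) (s : state R n k)
    (mu : mem2d nat) : state R n k :=
  State mu (rmem s) (sample s) (queries s).

Definition set_rmem (R : realType) (n k : nat) (s : state R n k)
    (mu : mem2d R) : state R n k :=
  State (nmem s) mu (sample s) (queries s).

Definition set_sample (R : realType) (n k : nat) (s : state R n k)
    (S : seq ('I_n * 'I_k)) : state R n k :=
  State (nmem s) (rmem s) S (queries s).

Definition nassign (R : realType) (n k : nat) (s : state R n k)
    (a : nat) (i j : nexp) (v : nat) : state R n k :=
  set_nmem s (upd (nmem s) a (neval s i) (neval s j) v).

(* Out-of-range indices are answered negatively, and are charged. *)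
Definition do_query (R : realType) (n k : nat) (O : oracles R n k)
    (s : state R n k) (a : nat) (i j x y : nexp) : state R n k :=
  let ans := match insub (neval s x), insub (neval s y) with
             | Some p, Some q => same_cluster O p q
             | _, _ => false
             end in
  let s' := nassign s a i j ans in
  State (nmem s') (rmem s') (sample s') (queries s').+1.

(* Out-of-range points or labels are ignored. *)
Definition do_label (R : realType) (n k : nat) (s : state R n k)
    (x l : nexp) : state R n k :=
  match insub (neval s x), insub (neval s l) with
  | Some p, Some i => set_sample s (rcons (sample s) (p, i))
  | _, _ => s
  end.

Definition do_learn (R : realType) (n k : nat) (O : oracles R n k)
    (s : state R n k) (a : nat) : state R n k :=
  set_nmem s (fun a' i' j' =>
    if (a' == a) && (j' == 0%N) then
      if insub i' is Some p then nat_of_ord (learned O (sample s) p)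
      else nmem s a' i' j'
    else nmem s a' i' j').

(* Outcome of the first step of [c] followed by the commands [K]; in
   [Toss p s1 s0], [0 < p < 1] is the probability of moving to [s1]. *)
Inductive outcome (R : realType) (n k : nat) : Type :=
| Next of seq com & state R n k
| Toss of R & state R n k & state R n k.

Definition step (R : realType) (n k : nat) (O : oracles R n k)
    (c : com) (K : seq com) (s : state R n k) : outcome R n k :=
  match c with
  | Skip => Next K s
  | NSet a i j e => Next K (nassign s a i j (neval s e))
  | RSet a i j e =>
      Next K (set_rmem s (upd (rmem s) a (neval s i) (neval s j) (reval s e)))
  | Seq c1 c2 => Next (c1 :: c2 :: K) s
  | If b c1 c2 => Next ((if beval s b then c1 else c2) :: K) s
  | While b c1 => Next (if beval s b then c1 :: c :: K else K) s
  | Flip a i j e =>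
      let p := reval s e in
      if p <= 0 then Next K (nassign s a i j 0)
      else if 1 <= p then Next K (nassign s a i j 1)
      else Toss p (nassign s a i j 1) (nassign s a i j 0)
  | Query a i j x y => Next K (do_query O s a i j x y)
  | SampleSize a i j e d =>
      Next K (nassign s a i j (sample_size O (reval s e) (reval s d)))
  | Label x l => Next K (do_label s x l)
  | Clear => Next K (set_sample s [::])
  | Learn a => Next K (do_learn O s a)
  end.

(* [surely t O K s E]: whatever the coin flips, the commands [K] run from [s]
   terminate within [t] steps, in a state satisfying [E]. *)
Fixpoint surely (R : realType) (n k : nat) (t : nat) (O : oracles R n k)
    (K : seq com) (s : state R n k) (E : state R n k -> Prop) : Prop :=
  match K, t with
  | [::], _ => E s
  | _ :: _, 0 => False
  | c :: K', t'.+1 =>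
      match step O c K' s with
      | Next K1 s1 => surely t' O K1 s1 E
      | Toss p s1 s0 => surely t' O K' s1 E /\ surely t' O K' s0 E
      end
  end.

(* [Pr t O K s E]: the probability that the commands [K] run from [s] terminate
   within [t] steps, in a state satisfying [E]. *)
Fixpoint Pr (R : realType) (n k : nat) (t : nat) (O : oracles R n k)
    (K : seq com) (s : state R n k) (E : state R n k -> Prop) : R :=
  match K, t with
  | [::], _ => `[< E s >]%:R
  | _ :: _, 0 => 0
  | c :: K', t'.+1 =>
      match step O c K' s with
      | Next K1 s1 => Pr t' O K1 s1 E
      | Toss p s1 s0 => p * Pr t' O K' s1 E + (1 - p) * Pr t' O K' s0 E
      end
  end.

Lemma surely_Pr (R : realType) (n k t : nat) (O : oracles R n k)
    (K : seq com) (s : state R n k) (E : state R n k -> Prop) :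
  surely t O K s E -> Pr t O K s E = 1.
Proof.
elim: t K s => [|t IH] [|c K] s //= => [Es|Es|]; try by rewrite (asboolT Es).
case: (step O c K s) => [K1 s1|p s1 s0] /=; first exact: IH.
by move=> [h1 h0]; rewrite !IH // !mulr1 addrC subrK.
Qed.

(* Input: [n], [r], [k] in cells [0[0,0]], [0[1,0]], [0[2,0]] of the memory of
   naturals; coordinate [j] of point [i] in cell [0[i,j]], and [eps], [delta] in
   cells [1[0,0]], [1[1,0]], of the memory of reals; 0 in all other cells. *)
Definition init_state (R : realType) (r n k : nat) (P : 'I_n -> 'rV[R]_r)
    (eps delta : R) : state R n k :=
  State
    (fun a i j => if (a == 0%N) && (j == 0%N) then nth 0%N [:: n; r; k] i
                  else 0%N)
    (fun a i j =>
       if a == 0%N then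
         match insub i, insub j with
         | Some p, Some q => P p 0 q
         | _, _ => 0
         end
       else if (a == 1%N) && (j == 0%N) then nth 0 [:: eps; delta] i
       else 0)
    [::] 0.

(* Output: the label of point [p] in cell [1[p,0]] of the memory of naturals. *)
Definition outputs (R : realType) (n k : nat) (s : state R n k)
    (g : kclustering n k) : Prop :=
  forall p : 'I_n, nmem s 1%N p 0%N = g p.

Definition kmeans_oracles (R : realType) (r n k : nat) (P : 'I_n -> 'rV[R]_r)
    (f : kclustering n k) (m : R -> R -> nat) (AL : learner R r k) :
    oracles R n k :=
  Oracles (fun p q => f p == f q) m (AL n P).

(* Main.v *)
(* Points are sampled with probabilities read off a rough solution: [2k + 1]
   seeds, found by farthest-first traversal and local search, whose cost is at
   most 122 OPT.  The probability of [p] is proportional to its share of that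
   cost plus the inverse of the size of its cell, hence dominates the share of
   [p] in OPT.  With [O(k^3 / (eps^2 delta))] draws, labeled by same-cluster
   queries, averages weighted by inverse probabilities approximate the centers
   of all the clusters that are well sampled; any other cluster is small and
   close to the center of a well sampled one.  The learner is run on two
   uniform samples and the better hypothesis on a validation sample is kept.
   It is followed on every point where its center is not much farther than the
   nearest approximate center: the excess adds up to at most [eps / 4] times the
   cost of the approximate centers, and few correct labels are spoiled.  Since
   queries only identify clusters by their order of discovery, a uniformly
   random renumbering makes the labels independent of the sample. *)
Require Import Defs.
From HB Require Import structures.
From mathcomp Require Import all_boot all_order all_algebra all_fingroup.
From mathcomp Require Import all_classical all_reals all_analysis.
From mathcomp Require Import zify ring lra.
Set Implicit Arguments.
Unset Strict Implicit.
Unset Printing Implicit Defensive.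
Import Order.TTheory GRing.Theory Num.Theory.
Local Open Scope ring_scope.


(** * Programs with loops of known length *)

(** A cluster may be tiny and still carry most of OPT, so uniform draws do not suffice for the
    centers: the weights must dominate shares of OPT that are unknown. Even then some clusters are
    seen too rarely, and since such a cluster cannot be recognized it has to be harmless: it meets a
    cell far larger than itself, and climbing to ever larger cells ends at a well sampled cluster
    nearby. One call to the learner may fail with probability delta, the whole allowance; two
    independent calls fail together with probability delta^2 only, which leaves room for the center
    estimates and for the validation, delta / 4 each. A labeled draw costs at most k queries, so k^3
    / (eps^2 delta) draws account for the first term of the bound. On the program side only [draws]
    tosses coins, those of the renumbering included. Everything else is written in the deterministic
    language [fcom], whose running time is read off the syntax, and the analysis of the coins
    reduces to expectations [Ex] over sequences of points. *)

Inductive fcom : Type :=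
| FSkip
| FN of nat & nexp & nexp & nexp
| FR of nat & nexp & nexp & rexp
| FSeq of fcom & fcom
| FIf of bexp & fcom & fcom
| FFor of nat & nat & fcom
| FQuery of nat & nexp & nexp & nexp & nexp
| FSize of nat & nexp & nexp & rexp & rexp
| FLabel of nexp & nexp
| FClear
| FLearn of nat.

Notation cell a i := (NGet a i (NConst 0)).
Notation var a := (NGet a (NConst 0) (NConst 0)).
Notation rvar a := (RGet a (NConst 0) (NConst 0)).

(* Every loop bound is a cell of array 2, which no loop may write: loop counts
   are thus known on entry, and bounded by the entries of that array. *)
Fixpoint compile (c : fcom) : com :=
  match c with
  | FSkip => Skip
  | FN a i j e => NSet a i j e
  | FR a i j e => RSet a i j e
  | FSeq c1 c2 => Seq (compile c1) (compile c2)
  | FIf b c1 c2 => If b (compile c1) (compile c2)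
  | FFor v b c1 =>
      Seq (NSet v (NConst 0) (NConst 0) (NConst 0))
        (While (BNlt (var v) (cell 2 (NConst b)))
          (Seq (compile c1)
            (NSet v (NConst 0) (NConst 0) (NAdd (var v) (NConst 1)))))
  | FQuery a i j x y => Query a i j x y
  | FSize a i j e d => SampleSize a i j e d
  | FLabel x l => Label x l
  | FClear => Clear
  | FLearn a => Learn a
  end.

Fixpoint nwrites (c : fcom) : seq nat :=
  match c with
  | FN a _ _ _ | FQuery a _ _ _ _ | FSize a _ _ _ _ | FLearn a => [:: a]
  | FSeq c1 c2 | FIf _ c1 c2 => nwrites c1 ++ nwrites c2
  | FFor v _ c1 => v :: nwrites c1
  | _ => [::]
  end.

Fixpoint rwrites (c : fcom) : seq nat :=
  match c with
  | FR a _ _ _ => [:: a]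
  | FSeq c1 c2 | FIf _ c1 c2 => rwrites c1 ++ rwrites c2
  | FFor _ _ c1 => rwrites c1
  | _ => [::]
  end.

Fixpoint wf (c : fcom) : bool :=
  match c with
  | FSeq c1 c2 | FIf _ c1 c2 => wf c1 && wf c2
  | FFor v _ c1 => [&& v != 2, v \notin nwrites c1, 2 \notin nwrites c1 & wf c1]
  | _ => true
  end.

(** An iteration costs 3 steps besides its body: the test, the unfolding of [Seq] and the increment.
    The final 3 are the outer [Seq], the reset of the counter and the failing test. *)
Fixpoint steps (c : fcom) (L : nat) : nat :=
  match c with
  | FSeq c1 c2 | FIf _ c1 c2 => (steps c1 L + steps c2 L).+1
  | FFor _ _ c1 => (L * (steps c1 L + 3) + 3)%N
  | _ => 1
  end.

Fixpoint query_free (c : fcom) : bool :=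
  match c with
  | FQuery _ _ _ _ _ => false
  | FSeq c1 c2 | FIf _ c1 c2 => query_free c1 && query_free c2
  | FFor _ _ c1 => query_free c1
  | _ => true
  end.

Fixpoint fsize (c : fcom) : nat :=
  match c with
  | FSeq c1 c2 | FIf _ c1 c2 => (fsize c1 + fsize c2).+1
  | FFor _ _ c1 => (fsize c1).+3 .*2
  | _ => 1
  end.

Fixpoint fdepth (c : fcom) : nat :=
  match c with
  | FSeq c1 c2 | FIf _ c1 c2 => maxn (fdepth c1) (fdepth c2)
  | FFor _ _ c1 => (fdepth c1).+1
  | _ => 0
  end.

(** Each loop level multiplies the cost by at most [L.+1], up to the constants absorbed by [fsize];
    the degree is thus the nesting depth. *)
Lemma steps_poly c L : (steps c L <= fsize c * L.+1 ^ fdepth c)%N.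
Proof.
elim: c => /=; try by move=> *; rewrite expn0.
- move=> c1 IH1 c2 IH2.
  have h1 := leq_pexp2l (ltn0Sn L) (leq_maxl (fdepth c1) (fdepth c2)).
  have h2 := leq_pexp2l (ltn0Sn L) (leq_maxr (fdepth c1) (fdepth c2)).
  have h0 : (0 < L.+1 ^ maxn (fdepth c1) (fdepth c2))%N by rewrite expn_gt0.
  have := leq_mul (leqnn (fsize c1)) h1; have := leq_mul (leqnn (fsize c2)) h2.
  lia.
- move=> _ c1 IH1 c2 IH2.
  have h1 := leq_pexp2l (ltn0Sn L) (leq_maxl (fdepth c1) (fdepth c2)).
  have h2 := leq_pexp2l (ltn0Sn L) (leq_maxr (fdepth c1) (fdepth c2)).
  have h0 : (0 < L.+1 ^ maxn (fdepth c1) (fdepth c2))%N by rewrite expn_gt0.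
  have := leq_mul (leqnn (fsize c1)) h1; have := leq_mul (leqnn (fsize c2)) h2.
  lia.
- move=> _ _ c IH.
  have h0 : (0 < L.+1 ^ fdepth c)%N by rewrite expn_gt0.
  have := leq_mul (leqnn L) IH.
  rewrite expnS; nia.
Qed.

Section Semantics.
Variables (R : realType) (n k : nat) (O : oracles R n k).
Implicit Types (s : state R n k) (E : state R n k -> Prop) (K : seq com).

Lemma step_toss c K s p s1 s0 : step O c K s = Toss p s1 s0 -> 0 < p < 1.
Proof.
case: c => //= a i j e; case: (lerP (reval s e) 0) => // h0.
by case: (lerP 1 (reval s e)) => // h1 [<- _ _]; rewrite h0 h1.
Qed.

Lemma Pr_ge0 t K s E : 0 <= Pr t O K s E.
Proof.
elim: t K s => [|t IH] [|c K] s /=; rewrite ?ler0n //.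
case e: (step O c K s) => [K1 s1|p s1 s0] //.
have /andP[p0 p1] := step_toss e.
by apply: addr_ge0; apply: mulr_ge0; rewrite ?subr_ge0 ?IH ?(ltW p0) ?(ltW p1).
Qed.

Lemma Pr_leq t t' K s E : (t <= t')%N -> Pr t O K s E <= Pr t' O K s E.
Proof.
elim: t t' K s => [|t IH] t' [|c K] s tt'; try by case: t' tt'.
  exact: Pr_ge0.
case: t' tt' => // t' tt' /=.
case e: (step O c K s) => [K1 s1|p s1 s0]; first exact: IH.
have /andP[p0 p1] := step_toss e.
by apply: lerD; apply: ler_wpM2l; rewrite ?subr_ge0 ?IH ?(ltW p0) ?(ltW p1).
Qed.

Lemma Pr_le1 t K s E : Pr t O K s E <= 1.
Proof.
elim: t K s => [|t IH] [|c K] s /=; rewrite ?lern1 ?leq_b1 ?ler01 //.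
case e: (step O c K s) => [K1 s1|p s1 s0] //.
have /andP[p0 p1] := step_toss e.
have h1 := ler_wpM2l (ltW p0) (IH K s1).
have p1' : 0 <= 1 - p by rewrite subr_ge0 ltW.
have h0 := ler_wpM2l p1' (IH K s0); lra.
Qed.

(** Both sides of a toss have positive probability, so an average of numbers at most 1 that reaches
    1 forces each of them to be 1. Termination and the query bound on all runs thereby also follow
    from lower bounds on [Pr]. *)
Lemma Pr1_surely t K s E : 1 <= Pr t O K s E -> surely t O K s E.
Proof.
have done0 s' : (1 : R) <= `[< E s' >]%:R -> E s'.
  by case: asboolP => //; rewrite ler10.
elim: t K s => [|t IH] [|c K] s /=; rewrite ?ler10 //; first exact: done0.
  exact: done0.
case e: (step O c K s) => [K1 s1|p s1 s0]; first exact: IH.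
have /andP[p0 p1] := step_toss e => h.
have p1' : 0 < 1 - p by rewrite subr_gt0.
split; apply: IH; rewrite leNgt; apply/negP => lt.
  have := ler_wpM2l (ltW p1') (Pr_le1 t K s0 E).
  have : p * Pr t O K s1 E < p * 1 by rewrite ltr_pM2l.
  lra.
have := ler_wpM2l (ltW p0) (Pr_le1 t K s1 E).
have : (1 - p) * Pr t O K s0 E < (1 - p) * 1 by rewrite ltr_pM2l.
lra.
Qed.

(** Deterministic execution seen through probabilities: quantifying over the event and the remaining
    time makes the relation compose, and an inequality suffices because only lower bounds on success
    are sought. *)
Definition reach t K s K' s' := forall E t0, Pr t0 O K' s' E <= Pr (t + t0) O K s E.

Lemma reach_trans t1 t2 K s K1 s1 K2 s2 :
  reach t1 K s K1 s1 -> reach t2 K1 s1 K2 s2 -> reach (t1 + t2) K s K2 s2.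
Proof.
move=> h1 h2 E t0; rewrite -addnA.
exact: le_trans (h2 E t0) (h1 E _).
Qed.

Lemma reach_leq t t' K s K1 s1 :
  (t <= t')%N -> reach t K s K1 s1 -> reach t' K s K1 s1.
Proof.
by move=> tt' h E t0; apply: le_trans (h E t0) _; apply: Pr_leq; rewrite leq_add2r.
Qed.

Lemma reach_step c K s K1 s1 : step O c K s = Next K1 s1 -> reach 1 (c :: K) s K1 s1.
Proof. by move=> h E t0; rewrite /= h. Qed.

Definition setv v x s := set_nmem s (upd (nmem s) v 0 0 x).

Fixpoint fsem (c : fcom) s : state R n k :=
  match c with
  | FSkip => s
  | FN a i j e => nassign s a i j (neval s e)
  | FR a i j e => set_rmem s (upd (rmem s) a (neval s i) (neval s j) (reval s e))
  | FSeq c1 c2 => fsem c2 (fsem c1 s)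
  | FIf b c1 c2 => if beval s b then fsem c1 s else fsem c2 s
  | FFor v b c1 =>
      iter (nmem s 2 b 0)
        (fun s1 => setv v (nmem (fsem c1 s1) v 0 0 + 1) (fsem c1 s1)) (setv v 0 s)
  | FQuery a i j x y => do_query O s a i j x y
  | FSize a i j e d => nassign s a i j (sample_size O (reval s e) (reval s d))
  | FLabel x l => do_label s x l
  | FClear => set_sample s [::]
  | FLearn a => do_learn O s a
  end.

(** Whole arrays are framed, not single cells: the arrays written by a program are computed from its
    syntax, so that side conditions are decided by evaluation. *)
Definition frame (wn wr : seq nat) s s' :=
  (forall a, a \notin wn -> nmem s' a = nmem s a) /\
  (forall a, a \notin wr -> rmem s' a = rmem s a).

Lemma frame_refl wn wr s : frame wn wr s s. Proof. by []. Qed.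

Lemma frame_trans wn wr s1 s2 s3 :
  frame wn wr s1 s2 -> frame wn wr s2 s3 -> frame wn wr s1 s3.
Proof.
move=> [h1 h2] [h3 h4]; split=> a ha; first by rewrite h3 // h1.
by rewrite h4 // h2.
Qed.

Lemma frame_sub wn wr wn' wr' s s' :
  {subset wn <= wn'} -> {subset wr <= wr'} -> frame wn wr s s' -> frame wn' wr' s s'.
Proof.
move=> hn hr [h1 h2]; split=> a ha; [apply: h1|apply: h2];
  by apply: contra ha => /hn || apply: contra ha => /hr.
Qed.

Lemma upd_neq V (mu : mem2d V) a i j v b : b != a -> upd mu a i j v b = mu b.
Proof. by move=> /negPf h; apply/funext => i'; apply/funext => j'; rewrite /upd h. Qed.

Lemma frame_nassign wn wr s a i j v : a \in wn -> frame wn wr s (nassign s a i j v).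
Proof.
move=> aw; split=> // b hb; rewrite /= upd_neq //.
by apply: contraNneq hb => ->.
Qed.

Lemma frame_setv wn wr s a v : a \in wn -> frame wn wr s (setv a v s).
Proof.
move=> aw; split=> // b hb; rewrite /= upd_neq //.
by apply: contraNneq hb => ->.
Qed.

Lemma frame_fsem c s : frame (nwrites c) (rwrites c) s (fsem c s).
Proof.
elim: c s => //=.
- by move=> a i j e s; apply: frame_nassign; rewrite inE.
- move=> a i j e s; split=> // b; rewrite inE => hb.
  by rewrite /= upd_neq.
- move=> c1 IH1 c2 IH2 s; apply: (@frame_trans _ _ _ (fsem c1 s)).
    by apply: frame_sub (IH1 s) => a; rewrite mem_cat => ->.
  by apply: frame_sub (IH2 _) => a; rewrite mem_cat => ->; rewrite orbT.
- move=> b c1 IH1 c2 IH2 s; case: ifP => _.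
    by apply: frame_sub (IH1 s) => a; rewrite mem_cat => ->.
  by apply: frame_sub (IH2 _) => a; rewrite mem_cat => ->; rewrite orbT.
- move=> v b c1 IH s; elim: (nmem s 2 b 0) => [|N IHN] /=.
    by apply: frame_setv; rewrite mem_head.
  apply: frame_trans IHN _; set s1 := iter _ _ _.
  apply: (@frame_trans _ _ _ (fsem c1 s1)).
    by apply: frame_sub (IH _) => a //; rewrite inE => ->; rewrite orbT.
  by apply: frame_setv; rewrite mem_head.
- by move=> a i j x y s; split=> // b; rewrite inE => hb; rewrite /= upd_neq.
- by move=> a i j e d s; apply: frame_nassign; rewrite inE.
- by move=> x l s; rewrite /do_label; case: insub => // p; case: insub.
- move=> a s; split=> // b; rewrite inE => /negPf hb.
  by apply/funext => i; apply/funext => j; rewrite /= hb.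
Qed.

Lemma fsem_n c s a : a \notin nwrites c -> nmem (fsem c s) a = nmem s a.
Proof. by have [h _] := frame_fsem c s; apply: h. Qed.

Lemma fsem_r c s a : a \notin rwrites c -> rmem (fsem c s) a = rmem s a.
Proof. by have [_ h] := frame_fsem c s; apply: h. Qed.

Lemma query_freeP c s : query_free c -> queries (fsem c s) = queries s.
Proof.
elim: c s => //=.
- by move=> c1 IH1 c2 IH2 s /andP[h1 h2]; rewrite IH2 // IH1.
- by move=> b c1 IH1 c2 IH2 s /andP[h1 h2]; case: ifP => _; rewrite ?IH2 ?IH1.
- move=> v b c IH s h; elim: (nmem s 2 b 0) => //= N IHN.
  by rewrite -IHN IH.
- by move=> x l s; rewrite /do_label; case: insub => // p; case: insub.
Qed.

(** As array 2 is not written, its entries stay below [L] throughout, and the step count depends on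
    the syntax and on [L] only. *)
Lemma compileP c s K L : wf c -> 2 \notin nwrites c -> (forall b, (nmem s 2 b 0 <= L)%N) ->
  reach (steps c L) (compile c :: K) s K (fsem c s).
Proof.
elim: c s K => /=; try by move=> *; apply: reach_step.
- move=> c1 IH1 c2 IH2 s K /andP[w1 w2]; rewrite mem_cat negb_or => /andP[n1 n2] hL.
  rewrite -add1n; apply: reach_trans.
    by apply: reach_step.
  apply: reach_trans; first exact: IH1.
  by apply: IH2 => // b; rewrite fsem_n.
- move=> b c1 IH1 c2 IH2 s K /andP[w1 w2]; rewrite mem_cat negb_or => /andP[n1 n2] hL.
  rewrite -add1n; apply: reach_trans.
    by apply: reach_step.
  case: ifP => _.
    by apply: reach_leq (IH1 _ _ w1 n1 hL); rewrite leq_addr.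
  by apply: reach_leq (IH2 _ _ w2 n2 hL); rewrite leq_addl.
- move=> v b c IH s K /and4P[v2 vc c2 wc]; rewrite inE negb_or => /andP[_ _] hL.
  set B := nmem s 2 b 0.
  apply: (@reach_leq (1 + (1 + (B * (steps c L + 3) + 1)))%N).
    have := hL b; rewrite -/B => hB.
    have := leq_mul hB (leqnn (steps c L + 3)); lia.
  apply: reach_trans; first by apply: reach_step.
  apply: reach_trans; first by apply: reach_step.
  set W := While _ _.
  set body := fun s1 => _.
  have inv i : (i <= B)%N -> let s1 := iter i body (setv v 0 s) in
      nmem s1 v 0 0 = i /\ nmem s1 2 = nmem s 2.
    elim: i => [|i IHi] /=.
      by rewrite /upd !eqxx; split=> //; apply: upd_neq; rewrite eq_sym.
    move=> iB; have [h1 h2] := IHi (ltnW iB); split.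
      by rewrite /body /upd !eqxx /= fsem_n // h1 addn1.
    by rewrite /body /= upd_neq 1?eq_sym // fsem_n.
  (* Induction on the number [j] of iterations still to be run. *)
  suff H j : (j <= B)%N -> reach (j * (steps c L + 3) + 1) (W :: K)
      (iter (B - j) body (setv v 0 s)) K (iter B body (setv v 0 s)).
    by have := H B (leqnn _); rewrite subnn.
  elim: j => [|j IHj] jB.
    rewrite subn0; apply: reach_step => /=.
    by have [-> ->] := inv B (leqnn _); rewrite ltnn.
  have lt : (B - j.+1 < B)%N by lia.
  have [h1 h2] := inv _ (ltnW lt).
  have -> : (j.+1 * (steps c L + 3) + 1 =
     1 + (1 + (steps c L + (1 + (j * (steps c L + 3) + 1)))))%N by lia.
  set s1 := iter (B - j.+1) body _ in h1 h2 *.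
  apply: reach_trans.
    by apply: reach_step; rewrite /= -/W h1 h2 lt.
  apply: reach_trans; first by apply: reach_step.
  apply: reach_trans.
    by apply: IH => // b'; rewrite h2.
  apply: reach_trans; first by apply: reach_step.
  have -> : nassign (fsem c s1) v (NConst 0) (NConst 0)
     (neval (fsem c s1) (NAdd (var v) (NConst 1))) = iter (B - j) body (setv v 0 s).
    by rewrite (_ : B - j = (B - j.+1).+1)%N //; lia.
  exact: IHj (ltnW jB).
Qed.

(** Invariant rule by which the results of loops are established. The step also receives the frame
    condition since the loop entry and the value of the counter, so that invariants need not carry
    them. *)
Lemma for_ind v b c s (N : nat) (I : nat -> state R n k -> Prop) :
  nmem s 2 b 0 = N -> v \notin nwrites c ->
  I 0 (setv v 0 s) ->
  (forall (i : 'I_N) s', frame (v :: nwrites c) (rwrites c) s s' -> nmem s' v 0 0 = i ->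
     I i s' -> I i.+1 (setv v i.+1 (fsem c s'))) ->
  I N (fsem (FFor v b c) s).
Proof.
move=> /= -> vc I0 IS; set body := fun s1 => _.
have inv i : (i <= N)%N -> let s1 := iter i body (setv v 0 s) in
    [/\ nmem s1 v 0 0 = i, frame (v :: nwrites c) (rwrites c) s s1 & I i s1].
  elim: i => [|i IHi] /=.
    split=> //; first by rewrite /upd !eqxx.
    by apply: frame_setv; rewrite mem_head.
  move=> iB; have [h1 h2 h3] := IHi (ltnW iB).
  set s1 := iter i body _ in h1 h2 h3 *.
  have e : body s1 = setv v i.+1 (fsem c s1) by rewrite /body fsem_n // h1 addn1.
  split; first by rewrite /upd !eqxx /= fsem_n // h1 addn1.
    apply: frame_trans h2 _; apply: (@frame_trans _ _ _ (fsem c s1)).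
      by apply: frame_sub (frame_fsem _ _) => a //; rewrite inE => ->; rewrite orbT.
    by apply: frame_setv; rewrite mem_head.
  by rewrite -/(body s1) e; exact: (IS (Ordinal iB)).
by have [] := inv N (leqnn N).
Qed.

End Semantics.

(** * Sequences of independent draws *)

Section Expectation.
Variables (R : realFieldType) (T : finType).
Implicit Types (w : T -> R) (ws : seq (T -> R)) (F G : seq T -> R).

(* Expectation of [F] over a sequence of independent draws, the [i]-th one
   following the weights [nth _ ws i]. *)
Fixpoint Ex ws F : R :=
  if ws is w :: ws' then \sum_p w p * Ex ws' (fun x => F (p :: x)) else F [::].

Definition distr w := (forall p, 0 <= w p) /\ \sum_p w p = 1.

(** Sequences of positive probability. The shuffle is correct on these only, since its draw of rank
    [t] must not exceed [t]. *)
Definition possible ws (x : seq T) := all2 (fun w p => 0 < w p) ws x.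

Lemma Ex_ext ws F G : (forall x, size x = size ws -> F x = G x) -> Ex ws F = Ex ws G.
Proof.
elim: ws F G => /= [|w ws IH] F G h; first exact: h.
by apply: eq_bigr => p _; congr (_ * _); apply: IH => x sx; rewrite h //= sx.
Qed.

Lemma Ex_le ws F G : (forall w, List.In w ws -> forall p, 0 <= w p) ->
  (forall x, possible ws x -> F x <= G x) -> Ex ws F <= Ex ws G.
Proof.
elim: ws F G => /= [|w ws IH] F G hw h; first exact: h.
apply: ler_sum => p _; have w0 : 0 <= w p by apply: hw; left.
have [->|wp] := eqVneq (w p) 0; first by rewrite !mul0r.
apply: ler_wpM2l => //; apply: IH => [w' hw'|x px]; first by apply: hw; right.
by apply: h; rewrite /possible /= lt_def wp w0.
Qed.

Lemma ExD ws F G : Ex ws (fun x => F x + G x) = Ex ws F + Ex ws G.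
Proof.
elim: ws F G => //= w ws IH F G; rewrite -big_split; apply: eq_bigr => p _ /=.
by rewrite IH mulrDr.
Qed.

Lemma ExZ ws a F : Ex ws (fun x => a * F x) = a * Ex ws F.
Proof.
elim: ws F => //= w ws IH F; rewrite mulr_sumr; apply: eq_bigr => p _ /=.
by rewrite IH mulrCA.
Qed.

Lemma Ex0 ws : Ex ws (fun=> 0) = 0.
Proof. by rewrite -[RHS](mul0r (Ex ws (fun=> 0))) -ExZ; apply: Ex_ext => x _; rewrite mul0r. Qed.

Lemma Ex_sum I (r : seq I) (P : pred I) ws (F : I -> seq T -> R) :
  Ex ws (fun x => \sum_(i <- r | P i) F i x) = \sum_(i <- r | P i) Ex ws (F i).
Proof.
elim: r => [|i r IH].
  by rewrite big_nil -[RHS](Ex0 ws); apply: Ex_ext => x _; rewrite big_nil.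
rewrite big_cons -IH; case: ifP => h; last by apply: Ex_ext => x _; rewrite big_cons h.
by rewrite -ExD; apply: Ex_ext => x _; rewrite big_cons h.
Qed.

Lemma Ex_const ws a : (forall w, List.In w ws -> distr w) -> Ex ws (fun=> a) = a.
Proof.
elim: ws => //= w ws IH h; rewrite -mulr_suml (h w _).2 ?mul1r; last by left.
by apply: IH => w' hw'; apply: h; right.
Qed.

Lemma Ex_cat ws1 ws2 F :
  Ex (ws1 ++ ws2) F = Ex ws1 (fun x => Ex ws2 (fun y => F (x ++ y))).
Proof. by elim: ws1 F => //= w ws IH F; apply: eq_bigr => p _; rewrite IH. Qed.

Lemma Ex_exchange ws1 ws2 (F : seq T -> seq T -> R) :
  Ex ws1 (fun x => Ex ws2 (F x)) = Ex ws2 (fun y => Ex ws1 (F^~ y)).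
Proof.
elim: ws1 F => //= w ws IH F; rewrite Ex_sum; apply: eq_bigr => p _ /=.
by rewrite IH -ExZ.
Qed.

Lemma In_nseq N (w w' : T -> R) : List.In w' (nseq N w) -> w' = w.
Proof. by elim: N => //= N IH [->|]. Qed.

Lemma Ex_iid_ge0 N w F : (forall p, 0 <= w p) -> (forall x, 0 <= F x) -> 0 <= Ex (nseq N w) F.
Proof.
move=> w0 F0; rewrite -(Ex0 (nseq N w)); apply: Ex_le => // w' /In_nseq ->; exact: w0.
Qed.

Lemma Ex_iid_const N w a : distr w -> Ex (nseq N w) (fun=> a) = a.
Proof. by move=> dw; apply: Ex_const => w' /In_nseq ->. Qed.

Lemma Ex_iid_mean N w (g : T -> R) : distr w ->
  Ex (nseq N w) (fun x => \sum_(p <- x) g p) = N%:R * \sum_p w p * g p.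
Proof.
move=> dw; elim: N => [|N IH] /=; first by rewrite big_nil mul0r.
transitivity (\sum_p w p * (g p + N%:R * \sum_p w p * g p)).
  apply: eq_bigr => p _; congr (_ * _); rewrite -IH.
  rewrite -[g p in RHS](Ex_iid_const N (g p) dw) -ExD.
  by apply: Ex_ext => x _; rewrite big_cons.
set m := \sum_p w p * g p.
rewrite (eq_bigr (fun p => w p * g p + w p * (N%:R * m))); last first.
  by move=> p _; rewrite mulrDr.
by rewrite big_split /= -mulr_suml dw.2 -natr1 -/m; ring.
Qed.

(** Induction on the number of draws: the first deviation is independent of the others, so the cross
    term has mean zero. The variance of one draw is bounded by its second moment. *)
Lemma Ex_iid_variance N w (g : T -> R) : distr w ->
  Ex (nseq N w) (fun x => (\sum_(p <- x) g p - N%:R * \sum_p w p * g p) ^+ 2)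
    <= N%:R * \sum_p w p * g p ^+ 2.
Proof.
move=> dw; set m := \sum_p w p * g p; set v := \sum_p w p * g p ^+ 2.
elim: N => [|N IH] /=; first by rewrite big_nil !mul0r subrr expr0n.
set V := Ex _ _ in IH.
have -> : \sum_p w p * Ex (nseq N w) (fun x =>
    (\sum_(q <- p :: x) g q - N.+1%:R * m) ^+ 2)
  = \sum_p (w p * g p ^+ 2 - 2 * m * (w p * g p) + w p * (m ^+ 2 + V)).
  apply: eq_bigr => p _.
  transitivity (w p * ((g p - m) ^+ 2 + V)); last by ring.
  congr (_ * _).
  transitivity (Ex (nseq N w) (fun x => (g p - m) ^+ 2 +
    (2 * (g p - m) * (\sum_(q <- x) g q - N%:R * m) +
     (\sum_(q <- x) g q - N%:R * m) ^+ 2))).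
    by apply: Ex_ext => x _; rewrite big_cons -natr1; ring.
  rewrite ExD Ex_iid_const // ExD ExZ -/V; congr (_ + _).
  rewrite (_ : Ex _ _ = 0) ?mulr0 ?add0r //.
  by rewrite ExD Ex_iid_mean // Ex_iid_const // subrr.
rewrite big_split /= sumrB -mulr_sumr -mulr_suml dw.2 -/m -/v -natr1.
have := sqr_ge0 m; lra.
Qed.

Lemma Ex_markov ws F a : (forall w, List.In w ws -> forall p, 0 <= w p) ->
  (forall x, 0 <= F x) -> a * Ex ws (fun x => (a < F x)%R%:R) <= Ex ws F.
Proof.
move=> w0 F0; rewrite -ExZ; apply: Ex_le => // x _.
by case: ltP => h; rewrite ?mulr1 ?mulr0 ?F0 // ltW.
Qed.

Lemma Ex_chebyshev N w (g : T -> R) a : distr w -> 0 < a ->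
  Ex (nseq N w) (fun x => (a < `|\sum_(p <- x) g p - N%:R * \sum_p w p * g p|)%R%:R)
    <= N%:R * (\sum_p w p * g p ^+ 2) / a ^+ 2.
Proof.
move=> dw a0; rewrite ler_pdivlMr ?exprn_gt0 // mulrC.
apply: le_trans (Ex_iid_variance N g dw).
apply: le_trans (@Ex_markov _ _ (a ^+ 2) _ _); last by move=> x; rewrite sqr_ge0.
  rewrite ler_wpM2l ?sqr_ge0 //; apply: Ex_le => [w' /In_nseq -> p|x _]; first exact: dw.1.
  rewrite ler_nat; case: ltP => // h.
  by rewrite -(ger0_norm (sqr_ge0 (_ - _))) normrX ltrXn2r ?h ?ltW //.
by move=> w' /In_nseq -> p; exact: dw.1.
Qed.

Lemma big_tuple_cons N (F : N.+1.-tuple T -> R) :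
  \sum_(S : N.+1.-tuple T) F S = \sum_p \sum_(S : N.-tuple T) F [tuple of p :: S].
Proof.
rewrite pair_big /= (reindex (fun u : T * N.-tuple T => [tuple of u.1 :: u.2])) //=.
exists (fun S : N.+1.-tuple T => (thead S, [tuple of behead S])) => [[p S] _|S _] /=.
  by congr (_, _); apply: val_inj.
by rewrite -tuple_eta.
Qed.

(** Bridge to [learns], which expresses probabilities by counting tuples. *)
Lemma Ex_uniform N F :
  Ex (nseq N (fun=> #|T|%:R^-1)) F = (#|T| ^ N)%:R^-1 * \sum_(S : N.-tuple T) F S.
Proof.
elim: N F => [|N IH] F /=.
  by rewrite expn0 invr1 mul1r (big_pred1 [tuple]) // => S; rewrite (tuple0 S) /= eqxx.
rewrite big_tuple_cons -mulr_sumr expnS natrM invfM -mulrA; congr (_ * _).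
by rewrite mulr_sumr; apply: eq_bigr => p _; rewrite IH.
Qed.

End Expectation.

(** * Local search for seeds *)

Section SquaredDistance.
Variables (R : realFieldType) (r : nat).
Implicit Types u v w z : 'rV[R]_r.

Definition sqdist u v : R := \sum_(j < r) (u 0 j - v 0 j) ^+ 2.

Lemma sqdist_ge0 u v : 0 <= sqdist u v.
Proof. by apply: sumr_ge0 => j _; rewrite sqr_ge0. Qed.

Lemma sqdistC u v : sqdist u v = sqdist v u.
Proof. by apply: eq_bigr => j _; rewrite -sqrrN opprB. Qed.

Lemma sqdistxx u : sqdist u u = 0.
Proof. by apply: big1 => j _; rewrite subrr expr0n. Qed.

Lemma sqdist_tri2 u v w : sqdist u w <= 2 * sqdist u v + 2 * sqdist v w.
Proof.
rewrite !mulr_sumr -big_split; apply: ler_sum => j _ /=.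
have := sqr_ge0 (u 0 j - 2 * v 0 j + w 0 j); lra.
Qed.

Lemma sqdist_tri3 u v w z :
  sqdist u z <= 3 * sqdist u v + 3 * sqdist v w + 3 * sqdist w z.
Proof.
rewrite !mulr_sumr -!big_split; apply: ler_sum => j _ /=.
have := sqr_ge0 (u 0 j - 2 * v 0 j + w 0 j).
have := sqr_ge0 (v 0 j - 2 * w 0 j + z 0 j).
have := sqr_ge0 (u 0 j - v 0 j - w 0 j + z 0 j).
lra.
Qed.

(** Case t = 5 of (a + b)^2 <= (1 + t) a^2 + (1 + 1/t) b^2. Applied twice it keeps the last
    coefficient at 36/25, below 3/2, which makes the swaps contract. *)
Lemma sqdist_tri6 u v w : sqdist u w <= 6 * sqdist u v + 6 / 5 * sqdist v w.
Proof.
rewrite !mulr_sumr -big_split; apply: ler_sum => j _ /=.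
have := sqr_ge0 (5 * (u 0 j - v 0 j) - (v 0 j - w 0 j)); lra.
Qed.

End SquaredDistance.

Lemma exists_minimum (R : realFieldType) (T : finType) (x0 : T) (F : T -> R) :
  exists x, forall y, F x <= F y.
Proof.
by exists [arg min_(x < x0) F x]%O => y; case: arg_minP => // x _; apply.
Qed.

Lemma sum_const_ord (R : realFieldType) k (a : R) : \sum_(i < k) a = k%:R * a.
Proof. by rewrite sumr_const card_ord mulr_natl. Qed.

Section LocalSearch.
Variables (R : realFieldType) (r n k K : nat) (P : 'I_n -> 'rV[R]_r).
Variables (f : 'I_n -> 'I_k) (o : 'I_k -> 'rV[R]_r).
Implicit Types (B : 'I_K.+1 -> 'I_n) (p i : 'I_n) (a b : 'I_K.+1).

Let dd p i := sqdist (P p) (P i).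
Let x p := sqdist (P p) (o (f p)).
Let X := \sum_p x p.

Definition nearest B p : 'I_K.+1 := [arg min_(b < ord0) sqdist (P p) (P (B b))]%O.

Definition seed_cost B : R := \sum_p sqdist (P p) (P (B (nearest B p))).

Definition swap B a i : 'I_K.+1 -> 'I_n := fun b => if b == a then i else B b.

Lemma nearest_le B p b :
  sqdist (P p) (P (B (nearest B p))) <= sqdist (P p) (P (B b)).
Proof. by rewrite /nearest; case: arg_minP => // i _; apply. Qed.

Lemma seed_cost_le B (h : 'I_n -> 'I_K.+1) :
  seed_cost B <= \sum_p sqdist (P p) (P (B (h p))).
Proof. by apply: ler_sum => p _; apply: nearest_le. Qed.

Let x_ge0 p : 0 <= x p. Proof. exact: sqdist_ge0. Qed.

(* With twice as many seeds as clusters, at least [k] seeds are not the closest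
   one to (the data point nearest to) any optimal center.  Swapping the [j]-th
   such seed for an approximation of the center of cluster [j] is charged to
   cluster [j] only, so the best swap is at least as good as the average one. *)
Lemma swap_improves B : (0 < n)%N -> (0 < k)%N -> (2 * k <= K)%N ->
  exists a i, 2 * k%:R * seed_cost (swap B a i) <=
              (2 * k%:R - 1) * seed_cost B + 120 * X.
Proof.
move=> n0 k0 kK.
pose rep (j : 'I_k) : 'I_n := [arg min_(i < Ordinal n0) sqdist (P i) (o j)]%O.
have repP j p : sqdist (P (rep j)) (o j) <= sqdist (P p) (o j).
  by rewrite /rep; case: arg_minP => // i _; apply.
pose beta j := nearest B (rep j).
pose free := ~: [set beta j | j : 'I_k]%SET.
have cfree : (k <= #|free|)%N.
  have hb : (#|[set beta j | j : 'I_k]%SET| <= k)%N.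
    by apply: leq_trans (leq_imset_card _ _) _; rewrite card_ord.
  by rewrite cardsCs finset.setCK card_ord; lia.
pose out (j : 'I_k) : 'I_K.+1 := nth ord0 (enum free) j.
have sz (j : 'I_k) : (j < size (enum free))%N.
  by rewrite -cardE; apply: leq_trans cfree.
have outP j : out j \in free by rewrite -mem_enum mem_nth.
have out_inj : injective out.
  move=> j j' /eqP; rewrite nth_uniq ?enum_uniq // => /eqP; exact: val_inj.
have out_beta j j' : beta j' != out j.
  apply: contraTneq (outP j) => <-; rewrite inE negbK.
  by apply: imset_f.
pose y p := dd p (B (nearest B p)).
(* After the swap for [j], points of cluster [j] use the new seed, points that lost their seed use
   the one nearest to the representative of their cluster, which is never swapped out, and all
   others keep theirs. *)
pose T j p := if f p == j then 4 * x p else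
              if nearest B p == out j then dd p (B (beta (f p))) else y p.
have swapT j : seed_cost (swap B (out j) (rep j)) <= \sum_p T j p.
  pose h p := if f p == j then out j else
              if nearest B p == out j then beta (f p) else nearest B p.
  apply: le_trans (seed_cost_le _ h) _; apply: ler_sum => p _.
  rewrite /T /h /swap; have [<-|_] := eqVneq (f p) j.
    rewrite eqxx; apply: le_trans (sqdist_tri2 _ (o (f p)) _) _.
    rewrite -/(x p) [sqdist (o _) _]sqdistC.
    have : sqdist (P (rep (f p))) (o (f p)) <= x p by apply: repP.
    lra.
  case: (eqVneq (nearest B p) (out j)) => [_|h'].
    by rewrite (negPf (out_beta _ _)).
  by rewrite (negPf h').
have sumT p : \sum_j T j p <= 60 * x p + (k%:R - 1 / 2) * y p.
  have y0 : 0 <= y p by apply: sqdist_ge0.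
  (* The path goes from [p] to the representative [q] and back, with
     [sqdist (P p) (P q) <= 4 * x p]: the constants are 4 * (6 + 36/5) = 264/5 and 36/25, rounded
     up. *)
  have db : dd p (B (beta (f p))) <= 56 * x p + 3 / 2 * y p.
    pose q := rep (f p).
    have h1 := sqdist_tri6 (P p) (P q) (P (B (beta (f p)))).
    have h2 : sqdist (P q) (P (B (beta (f p)))) <= dd q (B (nearest B p)) by apply: nearest_le.
    have h3 := sqdist_tri6 (P q) (P p) (P (B (nearest B p))).
    have h4 := sqdist_tri2 (P p) (o (f p)) (P q).
    have h5 : sqdist (P q) (o (f p)) <= x p by apply: repP.
    have h6 := x_ge0 p.
    rewrite [sqdist (P q) (P p)]sqdistC in h3.
    rewrite [sqdist (o _) _]sqdistC in h4.
    rewrite -/(x p) -/(x _) in h4 h6.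
    rewrite /y /dd in y0 h2 *; lra.
  rewrite (bigD1 (f p)) //= {1}/T eqxx.
  have -> : \sum_(j < k | j != f p) T j p = \sum_(j < k | j != f p)
     (y p + (if nearest B p == out j then dd p (B (beta (f p))) - y p else 0)).
    apply: eq_bigr => j /negPf h; rewrite /T eq_sym h; case: ifP => _; last by rewrite addr0.
    by rewrite addrC subrK.
  rewrite big_split /= sumr_const -[X in y p *+ X]/(#|predC1 (f p)|).
  have -> : y p *+ #|predC1 (f p)| = (k%:R - 1) * y p.
    rewrite -[LHS]mulr_natl; congr (_ * _).
    by have := cardC1 (f p); rewrite card_ord => ->; rewrite -subn1 natrB.
  have : \sum_(j < k | j != f p)
    (if nearest B p == out j then dd p (B (beta (f p))) - y p else 0) <= 56 * x p + y p / 2.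
    have x0 : 0 <= x p by apply: x_ge0.
    (* Since [out] is injective, [p] loses its seed for at most one [j]. *)
    rewrite -big_mkcondr /=; case: (pickP [pred j | (j != f p) && (nearest B p == out j)]) => [j hj|h0].
      rewrite (big_pred1 j) => [|j'] /=; first by lra.
      case/andP: hj => hj /eqP hj'; rewrite hj' (inj_eq out_inj) [j == j']eq_sym.
      by case: (eqVneq j' j) => [->|]; rewrite ?hj ?andbF.
    by rewrite big_pred0 //; lra.
  lra.
have : \sum_j seed_cost (swap B (out j) (rep j)) <= 60 * X + (k%:R - 1 / 2) * seed_cost B.
  apply: (@le_trans _ _ (\sum_j \sum_p T j p)); first by apply: ler_sum => j _.
  rewrite exchange_big /= !mulr_sumr -big_split /=; apply: ler_sum => p _; exact: sumT.
set S := \sum_j _ => hS.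
have [j hj] : exists j, k%:R * seed_cost (swap B (out j) (rep j)) <= S.
  have [j jP] := exists_minimum (Ordinal k0) (fun j => seed_cost (swap B (out j) (rep j))).
  exists j; rewrite mulr_natl -[k in _ *+ k]card_ord -sumr_const.
  by apply: ler_sum => j1 _; apply: jP.
by exists (out j), (rep j); lra.
Qed.

(** What the analysis keeps of the traversal: when [B b] was selected, its distance to each earlier
    seed [B a] was at least the distance of any point to its closest seed. *)
Definition farthest_first B := forall (a b : 'I_K.+1) p, (a < b)%N ->
  exists c : 'I_K.+1, sqdist (P p) (P (B c)) <= sqdist (P (B b)) (P (B a)).

(** Among more than [k] seeds two lie in one cluster, at squared distance at most [2 * X]; no point
    is farther than that from its closest seed. This crude bound starts the local search. *)
Lemma farthest_first_cost B : (k <= K)%N -> farthest_first B ->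
  seed_cost B <= 2 * n%:R * X.
Proof.
move=> kK far; rewrite [leRHS](_ : _ = \sum_(p < n) 2 * X); last first.
  by rewrite sumr_const card_ord -[RHS]mulr_natr mulrAC.
apply: ler_sum => p _.
have : ~~ injectiveb (f \o B).
  apply/injectiveP => inj. have := leq_card _ inj. rewrite !card_ord. lia.
case/injectivePn => a [b ab eab].
wlog lt : a b ab eab / (a < b)%N => [hw|].
  case: (ltngtP a b) => h; [exact: (hw a b)| |by move: ab; rewrite -val_eqE /= h eqxx].
  by apply: (hw b a); rewrite // eq_sym.
have [c hc] := far a b p lt.
apply: le_trans (nearest_le B p c) (le_trans hc _).
have X0 : 0 <= X by apply: sumr_ge0 => i _; apply: x_ge0.
have [->|nab] := eqVneq (B b) (B a); first by rewrite sqdistxx; lra.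
apply: le_trans (sqdist_tri2 _ (o (f (B b))) _) _.
rewrite -/(x (B b)) [sqdist (o _) _]sqdistC -[f (B b)]eab -/(x (B a)).
rewrite -mulrDr ler_pM2l //.
rewrite /X (bigD1 (B b)) //= (bigD1 (B a)) 1?eq_sym //= addrA lerDl.
by apply: sumr_ge0 => i _; apply: x_ge0.
Qed.

End LocalSearch.

(** The excess over [120 * X] shrinks by the factor 1 - 1/m with m = 2k, and (m - 1)(m + t + 1) <= m
    (m + t). The resulting harmonic decay is weaker than the geometric one but involves no
    logarithm. *)
Lemma local_search_decay (R : realFieldType) (n k t : nat) (X Y Y' : R) :
  (0 < k)%N -> 0 <= X -> 2 * k%:R * Y' <= (2 * k%:R - 1) * Y + 120 * X ->
  (Y - 120 * X) * (2 * k%:R + t%:R) <= 4 * n%:R * k%:R * X ->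
  (Y' - 120 * X) * (2 * k%:R + t.+1%:R) <= 4 * n%:R * k%:R * X.
Proof.
move=> k0 X0 hY hI; rewrite -[t.+1%:R]natr1.
have k1 : 1 <= k%:R :> R by rewrite ler1n.
have n0 : 0 <= n%:R :> R by [].
have t0 : 0 <= t%:R :> R by [].
set m := 2 * k%:R in hY hI *; have m2 : 2 <= m by rewrite /m; lra.
have hz : m * (Y' - 120 * X) <= (m - 1) * (Y - 120 * X) by lra.
have rhs0 : 0 <= 4 * n%:R * k%:R * X by rewrite !mulr_ge0.
have [neg|pos] := lerP (Y' - 120 * X) 0.
  by apply: le_trans rhs0; rewrite mulr_le0_ge0 //; lra.
have zpos : 0 < Y - 120 * X.
  have m1 : 0 < m - 1 by lra.
  rewrite -(pmulr_rgt0 _ m1); apply: lt_le_trans hz; rewrite mulr_gt0 //; lra.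
apply: le_trans hI; rewrite -(ler_pM2l (_ : 0 < m)); last lra.
rewrite mulrA; apply: (@le_trans _ _ ((m - 1) * (Y - 120 * X) * (m + (t%:R + 1)))).
  by apply: ler_wpM2r; lra.
nra.
Qed.

(** After 2kn swaps the excess is at most 4nkX / (2k + 2kn) <= 2X. *)
Lemma local_search_bound (R : realFieldType) (n k t : nat) (X Y : R) :
  (0 < k)%N -> 0 <= X -> (2 * k * n <= t)%N ->
  (Y - 120 * X) * (2 * k%:R + t%:R) <= 4 * n%:R * k%:R * X -> Y <= 122 * X.
Proof.
move=> k0 X0; rewrite -(ler_nat R) !natrM => ht hI.
have k1 : 1 <= k%:R :> R by rewrite ler1n.
have n0 : 0 <= n%:R :> R by [].
have [neg|pos] := lerP (Y - 120 * X) 0; first by lra.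
suff : Y - 120 * X <= 2 * X by lra.
have d0 : 0 < 2 * k%:R + t%:R :> R by have : 0 <= t%:R :> R by []; lra.
rewrite -(ler_pM2r d0); apply: le_trans hI _.
have := ler_wpM2l X0 ht; have : 0 <= k%:R * X by rewrite mulr_ge0.
lra.
Qed.

(** * Clusters covered by the sample *)

Lemma eucl_dist_sqdist (R : realType) r (u v : 'rV[R]_r) : eucl_dist u v ^+ 2 = sqdist u v.
Proof. exact: eucl_dist_sqr. Qed.

Lemma cost_sqdist (R : realType) r n k (P : 'I_n -> 'rV[R]_r) (f : kclustering n k) :
  cost P f = \sum_p sqdist (P p) (centroid P (kcluster f (f p))).
Proof.
rewrite (partition_big f predT) //=; apply: eq_bigr => j _.
rewrite /cost_at (eq_bigl (fun p => f p == j)) => [|p]; last by rewrite inE.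
by apply: eq_bigr => p /eqP ->; rewrite eucl_dist_sqdist.
Qed.

Lemma cost_le_sqdist (R : realType) r n k (P : 'I_n -> 'rV[R]_r) (f : kclustering n k)
    (c : 'I_k -> 'rV[R]_r) : cost P f <= \sum_p sqdist (P p) (c (f p)).
Proof.
rewrite [leRHS](partition_big f predT) //=; apply: ler_sum => j _.
apply: le_trans (centroid_min _ _ (c j)) _.
rewrite /cost_at (eq_bigl (fun p => f p == j)) => [|p]; last by rewrite inE.
by apply: ler_sum => p /eqP ->; rewrite eucl_dist_sqdist.
Qed.

Section Coverage.
Variables (R : realType) (r n k K : nat) (P : 'I_n -> 'rV[R]_r) (f : kclustering n k).
Variables (seed : 'I_K -> 'rV[R]_r) (slot : 'I_n -> 'I_K) (q : 'I_n -> R) (gamma : R).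

Let o j := centroid P (kcluster f j).
Let x p := sqdist (P p) (o (f p)).
Let X := \sum_p x p.
Let y p := sqdist (P p) (seed (slot p)).
Let Y := \sum_p y p.
Let s j : R := #|kcluster f j|%:R.
Let cell_size b : R := #|[set p | slot p == b]|%:R.

(** A condition on every point rather than on the mass of the cluster: inverse probabilities are
    then at most [s j / gamma], which bounds the variance of the estimated size. *)
Definition well_sampled j := [forall p, (f p == j) ==> (gamma <= s j * q p)].

Hypothesis k0 : (0 < k)%N.
Hypothesis closest : forall p p', x p <= sqdist (P p) (o (f p')).
Hypothesis Y_le : Y <= 122 * X.
Hypothesis q_cost : forall p, y p <= 3 * k%:R * Y * q p.
Hypothesis q_cell : forall p, 1 <= 3 * k%:R * cell_size (slot p) * q p.
Hypothesis gamma_gt0 : 0 < gamma.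
Hypothesis gamma_le : 10 ^+ 7 * (gamma * k%:R ^+ 2) <= 1.

Let k1 : 1 <= k%:R :> R. Proof. by rewrite ler1n. Qed.
Let x_ge0 p : 0 <= x p. Proof. exact: sqdist_ge0. Qed.
Let y_ge0 p : 0 <= y p. Proof. exact: sqdist_ge0. Qed.
Let X_ge0 : 0 <= X. Proof. exact: sumr_ge0. Qed.
Let Y_ge0 : 0 <= Y. Proof. exact: sumr_ge0. Qed.
Let s_ge0 j : 0 <= s j. Proof. exact: ler0n. Qed.
Let kX_ge0 : 0 <= k%:R * X. Proof. by rewrite mulr_ge0. Qed.

Let cell_gt0 p : 0 < cell_size (slot p).
Proof. by rewrite ltr0n card_gt0; apply/finset.set0Pn; exists p; rewrite inE. Qed.

Let q_gt0 p : 0 < q p.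
Proof.
rewrite -(pmulr_rgt0 _ (_ : 0 < 3 * k%:R * cell_size (slot p))).
  exact: lt_le_trans (q_cell p).
by rewrite !mulr_gt0 // (lt_le_trans ltr01).
Qed.

Let y_le p : y p <= 366 * k%:R * X * q p.
Proof.
apply: le_trans (q_cost p) _; apply: ler_wpM2r; first exact: ltW.
have : k%:R * Y <= k%:R * (122 * X) by apply: ler_wpM2l.
lra.
Qed.

Let sum_cell (b : 'I_K) (F G : 'I_n -> R) (a : R) : (forall p, 0 <= G p) ->
  (forall p, slot p = b -> a <= F p + G p) ->
  cell_size b * a <= \sum_(p | slot p == b) F p + \sum_p G p.
Proof.
move=> G0 h; rewrite mulr_natl -sumr_const (eq_bigl (fun p => slot p == b)); last first.
  by move=> p; rewrite inE.
apply: (@le_trans _ _ (\sum_(p | slot p == b) (F p + G p))).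
  by apply: ler_sum => p /eqP; apply: h.
rewrite big_split lerD2l /= big_mkcond /=; apply: ler_sum => p _.
by case: ifP.
Qed.

(* Some point of the cell of [p] has a close optimal center, which cannot be
   closer to [p] than the center of its own cluster. *)
Lemma sensitivity p : x p <= 2205 * k%:R * X * q p.
Proof.
set b := slot p; have c0 := cell_gt0 p; rewrite -/b in c0.
(* Sum over the points [p'] of the cell of [x p <= 3 * y p + 3 * y p' + 3 * x p']; here 369 = 3 + 3
   * 122. The final constant is 2205 = 3 * 369 + 3 * 366. *)
have h : cell_size b * (x p - 3 * y p) <= 369 * X.
  apply: (@le_trans _ _ (\sum_p (3 * x p + 3 * y p))).
    have := @sum_cell b (fun=> 0) (fun p' => 3 * x p' + 3 * y p') (x p - 3 * y p).
    rewrite big1 // add0r; apply=> [p'|p' hb].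
      by have := x_ge0 p'; have := y_ge0 p'; lra.
    have := closest p p'.
    have := sqdist_tri3 (P p) (seed b) (P p') (o (f p')).
    have -> : sqdist (P p) (seed b) = y p by [].
    have -> : sqdist (seed b) (P p') = y p' by rewrite sqdistC -hb.
    have -> : sqdist (P p') (o (f p')) = x p' by [].
    lra.
  rewrite big_split /= -!mulr_sumr -/X -/Y. have := Y_le; lra.
have h1 : x p - 3 * y p <= 369 * X / cell_size b by rewrite ler_pdivlMr // mulrC.
have h2 : 369 * X / cell_size b <= 369 * X * (3 * k%:R * q p).
  apply: ler_wpM2l; first by have := X_ge0; lra.
  rewrite -[_^-1]mul1r ler_pdivrMr //; have := q_cell p; rewrite -/b; lra.
have := y_le p; lra.
Qed.

Let o_seed p : sqdist (o (f p)) (seed (slot p)) <= 5142 * k%:R * X * q p.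
Proof.
apply: le_trans (sqdist_tri2 _ (P p) _) _.
rewrite sqdistC; have := sensitivity p; have := y_le p; rewrite /x /y; lra.
Qed.

(** Since [q p] is at least the inverse of [3 * k * cell_size], a point drawn too rarely for its
    cluster shows that the cluster is tiny compared with the cell. *)
Let s_cell p : s (f p) * q p < gamma ->
  s (f p) <= 3 * k%:R * gamma * cell_size (slot p).
Proof.
move=> h; have h1 := q_cell p; have := s_ge0 (f p) => s0.
have c0 := ltW (cell_gt0 p).
apply: (@le_trans _ _ (s (f p) * (3 * k%:R * cell_size (slot p) * q p))).
  by rewrite ler_peMr.
have : (3 * k%:R * cell_size (slot p)) * (s (f p) * q p) <=
       (3 * k%:R * cell_size (slot p)) * gamma.
  by apply: ler_wpM2l; [rewrite !mulr_ge0|exact: ltW].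
lra.
Qed.

Let o_seed_s p : s (f p) * q p < gamma ->
  s (f p) * sqdist (o (f p)) (seed (slot p)) <= 5142 * k%:R * gamma * X.
Proof.
move=> h; apply: le_trans (ler_wpM2l (s_ge0 _) (o_seed p)) _.
have := ler_wpM2l kX_ge0 (ltW h); lra.
Qed.

(* A large part of the cell lies in clusters whose center is close to the seed;
   take the largest such cluster. *)
Let cell_cluster (p0 : 'I_n) : let b := slot p0 in
  exists p, cell_size b * sqdist (seed b) (o (f p)) <= 492 * X /\
            cell_size b <= 2 * k%:R * s (f p).
Proof.
move=> b; have c0 := cell_gt0 p0; rewrite -/b in c0.
(* Markov's inequality: over the cell, the squared distances from the seed to the centers of the
   points add up to at most (2 + 2 * 122) X = 246 X, so at least half of the points meet the
   threshold 492 = 2 * 246. *)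
pose H := [set p | (slot p == b) && (cell_size b * sqdist (seed b) (o (f p)) <= 492 * X)].
have hH : cell_size b <= 2 * #|H|%:R.
  rewrite leNgt; apply/negP => lt.
  pose G := [set p | (slot p == b) && (492 * X < cell_size b * sqdist (seed b) (o (f p)))].
  have cG : cell_size b = #|H|%:R + #|G|%:R.
    rewrite /cell_size -natrD; congr (_%:R).
    rewrite -(cardsID H); congr (_ + _)%N.
      by apply: eq_card => p; rewrite !inE; case: (slot p == b).
    by apply: eq_card => p; rewrite !inE ltNge; case: (slot p == b); rewrite ?andbT ?andbF.
  have G0 : 0 < #|G|%:R :> R by lra.
  have h1 : #|G|%:R * (492 * X) < \sum_(p in G) cell_size b * sqdist (seed b) (o (f p)).
    rewrite mulr_natl -sumr_const; apply: ltr_sum => [|p]; last by rewrite inE => /andP[].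
    move: G0; rewrite ltr0n card_gt0 => /finset.set0Pn[p hp].
    by apply/hasP; exists p => //; rewrite mem_index_enum.
  have h2 : \sum_(p in G) sqdist (seed b) (o (f p)) <= 246 * X.
    apply: (@le_trans _ _ (\sum_p (2 * x p + 2 * y p))); last first.
      by rewrite big_split /= -!mulr_sumr -/X -/Y; have := Y_le; lra.
    rewrite [leRHS](bigID (mem G)) /=.
    apply: (@le_trans _ _ (\sum_(p in G) (2 * x p + 2 * y p))); last first.
      by rewrite lerDl; apply: sumr_ge0 => p _; have := x_ge0 p; have := y_ge0 p; lra.
    apply: ler_sum => p; rewrite inE => /andP[/eqP <- _].
    have := sqdist_tri2 (seed (slot p)) (P p) (o (f p)); rewrite sqdistC [sqdist (seed _) _]sqdistC.
    rewrite /x /y; lra.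
  rewrite -mulr_sumr in h1.
  have h3 : cell_size b * \sum_(p in G) sqdist (seed b) (o (f p)) <= cell_size b * (246 * X).
    by apply: ler_wpM2l => //; exact: ltW.
  have : cell_size b * X <= 2 * #|G|%:R * X by apply: ler_wpM2r => //; lra.
  lra.
(* Pigeonhole: some cluster contains at least a fraction 1 / k of [H]. Minimizing the opposite of
   the count selects the largest. *)
pose cnt j := #|[set p in H | f p == j]|.
have [j hj] := exists_minimum (f p0) (fun j => - (cnt j)%:R : R).
have sumH : #|H|%:R <= k%:R * (cnt j)%:R :> R.
  rewrite -sum1_card natr_sum (partition_big f predT) //= -sum_const_ord.
  apply: ler_sum => i _.
  rewrite -lerN2; apply: le_trans (hj i) _; rewrite lerN2.
  by rewrite -natr_sum sum1dep_card.
have cj : (0 < cnt j)%N.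
  rewrite -(ltr0n R) -(pmulr_rgt0 _ (lt_le_trans ltr01 k1)); lra.
move: (cj); rewrite card_gt0 => /finset.set0Pn[p]; rewrite !inE => /andP[/andP[sp hp] /eqP fp].
exists p; split => //; rewrite fp.
have : (cnt j)%:R <= s j.
  rewrite ler_nat; apply: subset_leq_card; apply/fintype.subsetP => p'.
  by rewrite !inE => /andP[].
move=> h; have : k%:R * (cnt j)%:R <= k%:R * s j by apply: ler_wpM2l.
lra.
Qed.

(* If the cluster found above is not well sampled, it has a point in a much
   larger cell with a close seed: induction on the size of the cell. *)
Lemma cell_well_sampled (p0 : 'I_n) : let b := slot p0 in
  exists p, [/\ well_sampled (f p),
    cell_size b * sqdist (seed b) (o (f p)) <= 1600 * X &
    cell_size b <= 2 * k%:R * s (f p)].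
Proof.
have [N] := ubnP (n - #|[set p | slot p == slot p0]|).
elim: N p0 => // N IH p0 hN b.
have c0 := cell_gt0 p0; rewrite -/b in c0.
have [p [h1 h2]] := cell_cluster p0; rewrite -/b in h1 h2.
have [gp|] := boolP (well_sampled (f p)).
  by exists p; split => //; apply: le_trans h1 _; have := X_ge0; lra.
rewrite negb_forall => /existsP[p1]; rewrite negb_imply -ltNge => /andP[/eqP fp1 lo].
rewrite -fp1 in lo h1 h2.
have h3 := s_cell lo; have h4 := o_seed_s lo; set b1 := slot p1 in h3 h4.
have c1 := cell_gt0 p1; rewrite -/b1 in c1.
have kk : 6 * (gamma * k%:R ^+ 2) <= 1 / 100 by have := gamma_le; lra.
have h5 : cell_size b <= 6 * (gamma * k%:R ^+ 2) * cell_size b1.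
  apply: le_trans h2 _.
  have : 2 * k%:R * s (f p1) <= 2 * k%:R * (3 * k%:R * gamma * cell_size b1).
    by apply: ler_wpM2l => //; rewrite mulr_ge0.
  by rewrite expr2; lra.
have h6 : cell_size b <= 1 / 100 * cell_size b1.
  by apply: le_trans h5 _; apply: ler_wpM2r => //; exact: ltW.
have [|p2 [g2 h7 h8]] := IH p1.
  have lt : cell_size b < cell_size b1 by lra.
  rewrite ltr_nat in lt; apply: leq_trans (_ : n - #|[set p | slot p == b]| <= N)%N => //.
  by rewrite ltn_sub2l // (leq_trans lt) // -[leqRHS]card_ord max_card.
exists p2; rewrite -/b1 in h7 h8; split => //; last by lra.
(* The three terms give 3 * 492 + 3 * 2 + 3 * 1600 / 100 = 1530: as cells grow at least a
   hundredfold, the constant reproduces itself along the induction. *)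
have := sqdist_tri3 (seed b) (o (f p1)) (seed b1) (o (f p2)).
move=> /(ler_wpM2l (ltW c0)) h; apply: le_trans h _.
have h9 : cell_size b * sqdist (seed b1) (o (f p2)) <= 16 * X.
  have := ler_wpM2r (sqdist_ge0 (seed b1) (o (f p2))) h6; lra.
have h10 : cell_size b * sqdist (o (f p1)) (seed b1) <= 2 * X.
  have := ler_wpM2r (sqdist_ge0 (o (f p1)) (seed b1)) h2.
  have := ler_wpM2l (ler0n R k) h4.
  have := ler_wpM2r X_ge0 gamma_le; rewrite expr2.
  have := X_ge0; lra.
have := X_ge0; lra.
Qed.

(** A distance that is moderate on the scale of the cell is negligible on that of the much smaller
    cluster. The constant bounds 3 * (5142 + 3 * 1600 + 6), the last term coming from
    [k%:R * eta <= 1]. *)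
Lemma undersampled_covered (c : 'I_k -> 'rV[R]_r) (eta : R) j : 0 <= eta ->
  k%:R * eta <= 1 ->
  (forall i, well_sampled i -> s i * sqdist (o i) (c i) <= eta * X) ->
  ~~ well_sampled j ->
  exists i, s j * sqdist (o j) (c i) <= 3 * 10 ^+ 4 * k%:R * gamma * X /\
            s j <= 3 * k%:R * gamma * n%:R.
Proof.
move=> eta0 keta hc; rewrite negb_forall => /existsP[p].
rewrite negb_imply -ltNge => /andP[/eqP fp lo]; rewrite -fp in lo *.
have h1 := s_cell lo; have h2 := o_seed_s lo.
have [p1 [g1 h3 h4]] := cell_well_sampled p.
set b := slot p in h1 h2 h3 h4.
have c0 : 0 < cell_size b := cell_gt0 p.
have kg : 0 <= 3 * k%:R * gamma by rewrite !mulr_ge0 // ltW.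
exists (f p1); split; last first.
  apply: le_trans h1 _; apply: ler_wpM2l => //.
  by rewrite ler_nat -[n in (_ <= n)%N]card_ord max_card.
have := sqdist_tri3 (o (f p)) (seed b) (o (f p1)) (c (f p1)).
move=> /(ler_wpM2l (s_ge0 (f p))) h; apply: le_trans h _.
have h5 := ler_wpM2r (sqdist_ge0 (seed b) (o (f p1))) h1.
have h6 := ler_wpM2l kg h3.
have h7 := ler_wpM2r (sqdist_ge0 (o (f p1)) (c (f p1))) h1.
have h8 := ler_wpM2r (sqdist_ge0 (o (f p1)) (c (f p1))) (ler_wpM2l kg h4).
have kgk : 0 <= 3 * k%:R * gamma * (2 * k%:R) by rewrite mulr_ge0 // mulr_ge0.
have h9 := ler_wpM2l kgk (hc _ g1).
have kgX : 0 <= k%:R * gamma * X by rewrite !mulr_ge0 // ltW.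
have h10 := ler_wpM2l kgX keta.
lra.
Qed.

End Coverage.

(** * Inverse-probability estimates of the centers *)

Section Estimation.
Variables (R : realType) (r n k : nat) (P : 'I_n -> 'rV[R]_r) (f : kclustering n k).
Variables (q : 'I_n -> R).

Let o j := centroid P (kcluster f j).
Let x p := sqdist (P p) (o (f p)).
Let X := \sum_p x p.
Let s j : R := #|kcluster f j|%:R.

Definition sample_weight (S : seq 'I_n) j := \sum_(p <- S | f p == j) (q p)^-1.

(** A ratio of two inverse-probability estimates, which does without the unknown size of the
    cluster. *)
Definition sample_center (S : seq 'I_n) j : 'rV[R]_r :=
  (sample_weight S j)^-1 *: \sum_(p <- S | f p == j) (q p)^-1 *: P p.

Let deviation (S : seq 'I_n) j :=
  \sum_c (\sum_(p <- S | f p == j) (P p 0 c - o j 0 c) / q p) ^+ 2.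

Lemma sum_cluster (F : 'I_n -> R) j :
  \sum_(p in kcluster f j) F p = \sum_(p | f p == j) F p.
Proof. by apply: eq_bigl => p; rewrite inE. Qed.

Lemma centroid_sum0 j c : \sum_(p | f p == j) (P p 0 c - o j 0 c) = 0.
Proof.
rewrite -sum_cluster /o; set A := kcluster f j.
have [->|A0] := eqVneq A finset.set0; first by rewrite big_set0.
rewrite sumrB sumr_const mxE summxE -[X in _ - X]mulr_natr mulrAC.
by rewrite mulVf ?mul1r ?subrr // pnatr_eq0 cards_eq0.
Qed.

(** The error of the ratio is a sum of mean zero divided by the sampled weight. Half of the expected
    weight in the denominator yields the factor s * (2 / (N s))^2. *)
Lemma sqdist_sample_center S j N : 0 < s j -> (0 < N)%N ->
  N%:R * s j / 2 <= sample_weight S j ->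
  s j * sqdist (o j) (sample_center S j) <= 4 / (N%:R ^+ 2 * s j) * deviation S j.
Proof.
move=> s0 N0 hW; set W := sample_weight S j in hW.
have N0' : 0 < N%:R :> R by rewrite ltr0n.
have a0 : 0 < N%:R * s j / 2 by rewrite divr_gt0 ?mulr_gt0.
have W0 : 0 < W by apply: lt_le_trans hW.
have -> : sqdist (o j) (sample_center S j) = W^-1 ^+ 2 * deviation S j.
  rewrite mulr_sumr; apply: eq_bigr => c _; rewrite -exprMn -[LHS]sqrrN opprB; congr (_ ^+ 2).
  rewrite mxE summxE -/W.
  rewrite (eq_bigr (fun p => P p 0 c / q p)) => [|p _]; last by rewrite mxE mulrC.
  rewrite [in RHS](eq_bigr (fun p => P p 0 c / q p - o j 0 c * (q p)^-1)) => [|p _]; last by rewrite mulrBl.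
  rewrite sumrB -mulr_sumr -[\sum_(_ <- _ | _) (q _)^-1]/W.
  by rewrite mulrBr mulrCA mulVf ?mulr1 ?gt_eqF.
rewrite mulrA; apply: ler_wpM2r; first by apply: sumr_ge0 => c _; exact: sqr_ge0.
have : W^-1 <= (N%:R * s j / 2)^-1 by rewrite lef_pV2 ?posrE.
move=> hi; have : W^-1 ^+ 2 <= (N%:R * s j / 2)^-1 ^+ 2.
  by apply: lerXn2r hi; rewrite nnegrE invr_ge0 ltW.
move=> /(ler_wpM2l (ltW s0)) h; apply: le_trans h _.
by rewrite le_eqVlt; apply/orP; left; apply/eqP; field; rewrite !gt_eqF.
Qed.

Hypothesis dq : distr q.
Hypothesis q_gt0 : forall p, 0 < q p.

(** Chebyshev's inequality at half the mean: being well sampled bounds the second moment of one draw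
    by [s j ^+ 2 / gamma]. *)
Lemma sample_weight_conc j (gamma : R) N : (0 < N)%N -> 0 < gamma ->
  (0 < #|kcluster f j|)%N -> well_sampled f q gamma j ->
  Ex (nseq N q) (fun S => (sample_weight S j < N%:R * s j / 2)%R%:R) <= 4 / (N%:R * gamma).
Proof.
move=> N0 g0 s0 /forallP ws; rewrite -(ltr0n R) -/(s j) in s0.
have N0' : 0 < N%:R :> R by rewrite ltr0n.
pose g p := if f p == j then (q p)^-1 else 0.
have mg : \sum_p q p * g p = s j.
  rewrite /s -sum1_card natr_sum sum_cluster [RHS]big_mkcond /=.
  by apply: eq_bigr => p _; rewrite /g; case: ifP; rewrite ?mulr0 // divff // gt_eqF.
have vg : \sum_p q p * g p ^+ 2 <= s j * (s j / gamma).
  rewrite mulr_natl -sumr_const sum_cluster [leRHS]big_mkcond /=.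
  apply: ler_sum => p _; rewrite /g; case: ifP => h; last by rewrite expr0n mulr0.
  rewrite expr2 mulrA divff ?gt_eqF // mul1r -[_^-1]mul1r ler_pdivrMr // mulrAC ler_pdivlMr //.
  by rewrite mul1r; have := ws p; rewrite h.
have a0 : 0 < N%:R * s j / 2 by rewrite divr_gt0 ?mulr_gt0.
have := Ex_chebyshev N g dq a0; rewrite mg => cheb.
apply: le_trans (le_trans _ cheb) _.
  apply: Ex_le => [w /In_nseq -> p|S _]; first exact: ltW.
  have -> : \sum_(p <- S) g p = sample_weight S j by rewrite /g -big_mkcond.
  rewrite ler_nat; case: (ltP (sample_weight S j)) => // h.
  by rewrite lt0b ltr_normr; apply/orP; right; lra.
apply: (@le_trans _ _ (N%:R * (s j * (s j / gamma)) / (N%:R * s j / 2) ^+ 2)).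
  by rewrite ler_pM2r ?invr_gt0 ?exprn_gt0 // ler_pM2l.
by rewrite le_eqVlt; apply/orP; left; apply/eqP; field; rewrite !gt_eqF.
Qed.

(** Draws are centered at the true center, so variances add up; one draw contributes the sum over
    the cluster of [x p / q p], each term being at most the sensitivity bound [L]. *)
Lemma deviation_mean j (L : R) N : (forall p, x p <= L * q p) ->
  Ex (nseq N q) (fun S => deviation S j) <= N%:R * (s j * L).
Proof.
move=> hL; rewrite Ex_sum.
pose g c p := if f p == j then (P p 0 c - o j 0 c) / q p else 0.
have mg c : \sum_p q p * g c p = 0.
  rewrite -[RHS](centroid_sum0 j c) [RHS]big_mkcond /=; apply: eq_bigr => p _.
  rewrite /g; case: ifP => _; last by rewrite mulr0.
  by rewrite mulrC divfK // gt_eqF.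
apply: (@le_trans _ _ (\sum_c N%:R * \sum_p q p * g c p ^+ 2)).
  apply: ler_sum => c _; apply: le_trans (Ex_iid_variance N (g c) dq).
  rewrite mg mulr0; apply: Ex_le => [w /In_nseq -> p|S _]; first exact: ltW.
  by rewrite subr0 /g -big_mkcond.
rewrite -mulr_sumr ler_wpM2l // exchange_big /= mulr_natl -sumr_const sum_cluster.
rewrite [leRHS]big_mkcond /=; apply: ler_sum => p _; rewrite -mulr_sumr /g.
case: eqP => [h|_]; last by rewrite big1 ?mulr0 // => c _; rewrite expr0n.
rewrite (eq_bigr (fun c => (q p)^-2 * (P p 0 c - o j 0 c) ^+ 2)); last first.
  by move=> c _; rewrite expr_div_n mulrC.
rewrite -mulr_sumr -[\sum_c _]/(sqdist (P p) (o j)) -h -/(x p).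
have -> : q p * ((q p)^-2 * x p) = x p / q p by field; rewrite gt_eqF.
by rewrite ler_pdivrMr.
Qed.

End Estimation.

Section CenterQuality.
Variables (R : realType) (r n k K : nat) (P : 'I_n -> 'rV[R]_r) (f : kclustering n k).

Let o j := centroid P (kcluster f j).
Let X := \sum_p sqdist (P p) (o (f p)).
Let s j : R := #|kcluster f j|%:R.

(* Clusters not fixed by [a] are those that the sample may have missed. *)
Definition good_centers (eps : R) (c : 'I_k -> 'rV[R]_r) := exists a : 'I_k -> 'I_k,
  #|[set p | a (f p) != f p]|%:R <= eps / 8 * n%:R /\
  \sum_p sqdist (P p) (c (a (f p))) <= (1 + eps ^+ 2 / 32) * X.

Lemma sum_sqdist_shift (c : 'I_k -> 'rV[R]_r) :
  \sum_p sqdist (P p) (c (f p)) = X + \sum_j s j * sqdist (o j) (c j).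
Proof.
rewrite /X !(partition_big f predT (P := predT)) //= -big_split /=; apply: eq_bigr => j _.
have := cost_at_centroid P (kcluster f j) (c j); rewrite /cost_at !sum_cluster.
rewrite eucl_dist_sqdist => h.
rewrite (eq_bigr (fun p => eucl_dist (P p) (c j) ^+ 2)) => [|p /eqP ->]; last first.
  by rewrite eucl_dist_sqdist.
rewrite h; congr (_ + _); apply: eq_bigr => p /eqP ->.
by rewrite eucl_dist_sqdist.
Qed.

Variables (seed : 'I_K -> 'rV[R]_r) (slot : 'I_n -> 'I_K) (q : 'I_n -> R) (eps : R).
Let y p := sqdist (P p) (seed (slot p)).
Let Y := \sum_p y p.

Hypothesis k0 : (0 < k)%N.
Hypothesis X_gt0 : 0 < X.
Hypothesis eps01 : 0 < eps < 1.
Hypothesis closest : forall p p', sqdist (P p) (o (f p)) <= sqdist (P p) (o (f p')).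
Hypothesis Y_le : Y <= 122 * X.
Hypothesis q_cost : forall p, y p <= 3 * k%:R * Y * q p.
Hypothesis q_cell : forall p, 1 <= 3 * k%:R * #|[set p' | slot p' == slot p]|%:R * q p.
Hypothesis dq : distr q.

(** The 1 / k^2 in [gamma] pays for a sum over [k] clusters of bounds of order [k * gamma]; the 1 /
    k in [eta] is what [undersampled_covered] requires. *)
Let gamma := eps ^+ 2 / (10 ^+ 7 * k%:R ^+ 2).
Let eta := eps ^+ 2 / (64 * k%:R).

Let k1 : 1 <= k%:R :> R. Proof. by rewrite ler1n. Qed.
Let kgt0 : 0 < k%:R :> R. Proof. by rewrite ltr0n. Qed.
Let eps0 : 0 < eps. Proof. by case/andP: eps01. Qed.
Let e2_gt0 : 0 < eps ^+ 2. Proof. by rewrite exprn_gt0. Qed.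
Let e2_le : eps ^+ 2 <= eps.
Proof. by rewrite expr2 ler_piMr ?ltW //; case/andP: eps01. Qed.
Let e2_lt1 : eps ^+ 2 < 1.
Proof. by apply: le_lt_trans e2_le _; case/andP: eps01. Qed.
Let gammaE : 10 ^+ 7 * (gamma * k%:R ^+ 2) = eps ^+ 2.
Proof. by rewrite /gamma; field; rewrite gt_eqF. Qed.
Let etaE : k%:R * eta = eps ^+ 2 / 64.
Proof. by rewrite /eta; field; rewrite gt_eqF. Qed.
Let gamma_gt0 : 0 < gamma.
Proof. by rewrite divr_gt0 // !mulr_gt0 // exprn_gt0. Qed.
Let eta_gt0 : 0 < eta.
Proof. by rewrite divr_gt0 // mulr_gt0. Qed.

Let q_gt0 p : 0 < q p.
Proof.
have [q0 _] := dq; rewrite lt_def q0 andbT; apply: contraTneq (q_cell p) => ->.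
by rewrite mulr0 -ltNge.
Qed.

Let gamma_le : 10 ^+ 7 * (gamma * k%:R ^+ 2) <= 1.
Proof. by rewrite gammaE ltW. Qed.

Let ws := well_sampled f q gamma.

(** The map [a] fixes the well sampled clusters and sends each other one to the cluster that covers
    it. In units of [X] the excess is at most eps^2 / 64 for the former and 3 eps^2 / 1000 for the
    latter, less than eps^2 / 32 together. *)
Lemma good_centersP (c : 'I_k -> 'rV[R]_r) :
  \sum_(j | ws j) s j * sqdist (o j) (c j) <= eta * X -> good_centers eps c.
Proof.
move=> hc.
have sd0 j u : 0 <= s j * sqdist (o j) (c u) by rewrite mulr_ge0 // sqdist_ge0.
have hc1 i : ws i -> s i * sqdist (o i) (c i) <= eta * X.
  move=> wi; apply: le_trans hc; rewrite (bigD1 i) //= lerDl.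
  by apply: sumr_ge0 => j _; apply: sd0.
have keta : k%:R * eta <= 1 by rewrite etaE; have := e2_lt1; lra.
have cov j : exists i, ~~ ws j ->
    s j * sqdist (o j) (c i) <= 3 * 10 ^+ 4 * k%:R * gamma * X /\
    s j <= 3 * k%:R * gamma * n%:R.
  have [wj|wj] := boolP (ws j); first by exists j.
  have [i hi] := undersampled_covered k0 closest Y_le q_cost q_cell gamma_gt0 gamma_le
    (ltW eta_gt0) keta hc1 wj.
  by exists i.
have [b hb] := boolp.choice cov.
pose a j := if ws j then j else b j.
exists a; split.
  apply: (@le_trans _ _ (\sum_(j | ~~ ws j) s j)).
    rewrite -natr_sum ler_nat -sum1_card (partition_big f (fun j => ~~ ws j)) => [|p] /=.
      apply: leq_sum => j _; rewrite /= sum1_card; apply: subset_leq_card.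
      by apply/fintype.subsetP => p; rewrite !inE => /andP[].
    by rewrite inE /a; case: ifP; rewrite ?eqxx.
  apply: (@le_trans _ _ (\sum_(j < k) 3 * k%:R * gamma * n%:R)).
    rewrite big_mkcond; apply: ler_sum => j _; case: ifP => [/hb[]//|_].
    by rewrite !mulr_ge0 // ltW.
  rewrite sum_const_ord.
  have -> : k%:R * (3 * k%:R * gamma * n%:R) = 3 * (gamma * k%:R ^+ 2) * n%:R by ring.
  apply: ler_wpM2r; first exact: ler0n.
  have := gammaE; have := e2_le; have := eps0; lra.
rewrite (sum_sqdist_shift (fun j => c (a j))) (bigID ws) /=.
have -> : \sum_(j | ws j) s j * sqdist (o j) (c (a j)) = \sum_(j | ws j) s j * sqdist (o j) (c j).
  by apply: eq_bigr => j wj; rewrite /a wj.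
have : \sum_(j | ~~ ws j) s j * sqdist (o j) (c (a j)) <= k%:R * (3 * 10 ^+ 4 * k%:R * gamma * X).
  rewrite -sum_const_ord big_mkcond; apply: ler_sum => j _.
  case: ifP => [wj|_]; first by rewrite /a (negPf wj); case: (hb j wj).
  have : 0 <= k%:R * gamma * X by rewrite !mulr_ge0 // ltW.
  lra.
have -> : k%:R * (3 * 10 ^+ 4 * k%:R * gamma * X) = 3 * 10 ^+ 4 * (gamma * k%:R ^+ 2) * X by ring.
move=> h1.
have h0 : 10 ^+ 7 * (gamma * k%:R ^+ 2) * X = eps ^+ 2 * X by rewrite gammaE.
have h2 : eta * X <= k%:R * eta * X.
  by rewrite -mulrA ler_peMl // mulr_ge0 // ltW.
rewrite etaE in h2.
have : 0 <= eps ^+ 2 * X by rewrite mulr_ge0 // ltW.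
lra.
Qed.

(** Two ways to fail: some well sampled cluster receives too little weight (Chebyshev and a union
    bound over [k] clusters), or the total estimation error is too large (Markov). Both have order
    k^3 / (eps^2 N), which dictates the number of draws. *)
Lemma good_centers_Pr N : (0 < N)%N ->
  Ex (nseq N q) (fun S => (~~ `[< good_centers eps (sample_center P f q S) >])%:R) <=
  10 ^+ 8 * k%:R ^+ 3 / (eps ^+ 2 * N%:R).
Proof.
move=> N0; have N0' : 0 < N%:R :> R by rewrite ltr0n.
pose L := 2205 * k%:R * X.
have sens p : sqdist (P p) (o (f p)) <= L * q p.
  exact: (sensitivity k0 closest Y_le q_cost q_cell).
pose dev (S : seq 'I_n) j :=
  \sum_c (\sum_(p <- S | f p == j) (P p 0 c - o j 0 c) / q p) ^+ 2.
pose Z S := \sum_j 4 / (N%:R ^+ 2 * s j) * dev S j.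
have Z0 S : 0 <= Z S.
  apply: sumr_ge0 => j _; apply: mulr_ge0; last by apply: sumr_ge0 => c _; exact: sqr_ge0.
  by rewrite divr_ge0 // mulr_ge0.
(* Empty clusters are vacuously well sampled but never receive any weight; they are excluded from
   the event. *)
pose lowW S j := (0 < s j) && ws j && (sample_weight f q S j < N%:R * s j / 2).
have bad S : (~~ `[< good_centers eps (sample_center P f q S) >])%:R <=
   \sum_j (lowW S j)%:R + (eta * X < Z S)%R%:R :> R.
  have nn : 0 <= \sum_j (lowW S j)%:R :> R by apply: sumr_ge0.
  have [gc|/asboolP gc] := boolP `[< _ >] => /=; first by rewrite addr_ge0.
  have [|hZ] := ltP; first by rewrite lerDr.
  have [/existsP[j hj]|] := boolP [exists j, lowW S j].
    by rewrite (bigD1 j) //= hj -addrA lerDl addr_ge0 // sumr_ge0.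
  rewrite negb_exists => /forallP nlow; case: gc; apply: good_centersP.
  apply: le_trans hZ; rewrite /Z big_mkcond /=; apply: ler_sum => j _.
  have t0 : 0 <= 4 / (N%:R ^+ 2 * s j) * dev S j.
    apply: mulr_ge0; last by apply: sumr_ge0 => c _; exact: sqr_ge0.
    by rewrite divr_ge0 // mulr_ge0.
  case: ifP => // wj.
  have [sj|] := ltP 0 (s j).
    apply: sqdist_sample_center => //.
    by have := nlow j; rewrite /lowW sj wj /= -leNgt.
  by rewrite /s lern0 => /eqP e; rewrite e mul0r; rewrite /s e in t0.
apply: le_trans (Ex_le _ (fun S _ => bad S)) _.
  by move=> w /In_nseq -> p; exact: ltW.
rewrite ExD Ex_sum.
have h1 : \sum_j Ex (nseq N q) (fun S => (lowW S j)%:R) <= k%:R * (4 / (N%:R * gamma)).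
  rewrite -sum_const_ord; apply: ler_sum => j _.
  have b0 : 0 <= 4 / (N%:R * gamma) by rewrite divr_ge0 // mulr_ge0 // ltW.
  rewrite /lowW; have [/andP[sj wj]|] := boolP ((0 < s j) && ws j).
    by apply: sample_weight_conc => //; rewrite -(ltr0n R).
  by move=> _; rewrite Ex0.
have h2 : Ex (nseq N q) (fun S => (eta * X < Z S)%R%:R) <= 4 * k%:R * L / (N%:R * (eta * X)).
  have eX : 0 < eta * X by rewrite mulr_gt0.
  rewrite invfM mulrA ler_pdivlMr // mulrC.
  apply: le_trans (Ex_markov _ _ Z0) _; first by move=> w /In_nseq -> p; exact: ltW.
  rewrite Ex_sum; apply: (@le_trans _ _ (\sum_(j < k) 4 * L / N%:R)); last first.
    rewrite sum_const_ord.
    by rewrite le_eqVlt; apply/orP; left; apply/eqP; field; rewrite gt_eqF.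
  apply: ler_sum => j _; rewrite ExZ.
  apply: (@le_trans _ _ (4 / (N%:R ^+ 2 * s j) * (N%:R * (s j * L)))).
    apply: ler_wpM2l; first by rewrite divr_ge0 // mulr_ge0.
    exact: deviation_mean.
  have [->|sj] := eqVneq (s j) 0.
    rewrite mulr0 invr0 mulr0 mul0r divr_ge0 //.
    have : 0 <= k%:R * X by rewrite mulr_ge0 // ltW.
    by rewrite /L; lra.
  by rewrite le_eqVlt; apply/orP; left; apply/eqP; field; rewrite sj gt_eqF.
apply: le_trans (lerD h1 h2) _.
have -> : k%:R * (4 / (N%:R * gamma)) = 4 * 10 ^+ 7 * k%:R ^+ 3 / (eps ^+ 2 * N%:R).
  by rewrite /gamma; field; rewrite !gt_eqF.
have -> : 4 * k%:R * L / (N%:R * (eta * X)) = 64 * 8820 * k%:R ^+ 3 / (eps ^+ 2 * N%:R).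
  by rewrite /eta /L; field; rewrite !gt_eqF.
rewrite -mulrDl ler_pM2r ?invr_gt0 ?mulr_gt0 // -mulrDl ler_pM2r ?exprn_gt0 //.
lra.
Qed.

End CenterQuality.

(** * From approximate centers to a clustering *)

Section Combine.
Variables (R : realType) (r n k : nat) (P : 'I_n -> 'rV[R]_r).

Definition mismatch (f h : 'I_n -> 'I_k) : nat := #|[set p | f p != h p]|.

Lemma error_le (g f : kclustering n k) (s : 'S_k) : (error g f <= #|[set p | f p != s (g p)]|)%N.
Proof.
rewrite /error; have := mem_index_enum s; elim: index_enum => // s' l IH.
rewrite inE big_cons geq_min => /predU1P[->|/IH ->]; by rewrite ?leqnn ?orbT.
Qed.

Definition relabel (s : 'S_k) (f : kclustering n k) : kclustering n k := [ffun p => s (f p)].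

Lemma kcluster_relabel s f j : kcluster (relabel s f) (s j) = kcluster f j.
Proof. by apply/setP => p; rewrite !inE ffunE (inj_eq perm_inj). Qed.

Lemma cost_relabel s f : cost P (relabel s f) = cost P f.
Proof.
rewrite /cost (reindex_inj (@perm_inj _ s)) /=.
by apply: eq_bigr => j _; rewrite kcluster_relabel.
Qed.

Lemma cost_ge0 (f : kclustering n k) : 0 <= cost P f.
Proof. by rewrite cost_sqdist sumr_ge0 // => p _; exact: sqdist_ge0. Qed.

Lemma optimal_relabel s f : is_optimal P f -> is_optimal P (relabel s f).
Proof. by move=> h g; rewrite cost_relabel. Qed.

(** Since [error] ignores names, accuracy can be measured against the relabeled optimum that the
    program actually sees. *)
Lemma error_relabel g f s : (error g f <= mismatch (relabel s f) g)%N.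
Proof.
apply: leq_trans (error_le g f s^-1) _; rewrite leq_eqVlt; apply/orP; left; apply/eqP.
by apply: eq_card => p; rewrite !inE ffunE -(inj_eq (@perm_inj _ s)) permKV.
Qed.

(** Centers are taken at [f p'], so that only nonempty clusters are compared. *)
Lemma optimal_closest (f : kclustering n k) : no_boundary P k -> is_optimal P f -> forall p p',
  sqdist (P p) (centroid P (kcluster f (f p))) <= sqdist (P p) (centroid P (kcluster f (f p'))).
Proof.
move=> nb fo p p'; have [->//|ne] := eqVneq (f p') (f p).
have := nb f fo p (f p') ne; rewrite -!eucl_dist_sqdist => h.
apply: lerXn2r; rewrite ?nnegrE ?sqrtr_ge0 //; apply/ltW/h.
by apply/finset.set0Pn; exists p'; rewrite inE.
Qed.

(* Follow [h] unless its center is much worse than the nearest one. Since the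
   total excess of the centers of the true clusters is small, few points on
   which [h] is right are affected. *)
Lemma combine (f g : kclustering n k) (h : 'I_n -> 'I_k) (c : 'I_k -> 'rV[R]_r)
    (phi : 'I_n -> R) (eps : R) :
  let Phi := \sum_p phi p in let tau := eps * Phi / (4 * n%:R) in
  0 < eps < 1 -> is_optimal P f -> good_centers P f eps c ->
  (mismatch f h)%:R <= 3 / 4 * eps * n%:R ->
  (forall p j, phi p <= sqdist (P p) (c j)) ->
  (forall p, exists j, phi p = sqdist (P p) (c j)) ->
  (forall p, sqdist (P p) (c (g p)) <= phi p + tau) ->
  (forall p, sqdist (P p) (c (h p)) <= phi p + tau -> g p = h p) ->
  (mismatch f g)%:R <= eps * n%:R /\ cost P g <= (1 + eps) * cost P f.
Proof.
move=> Phi tau /andP[e0 e1] fo [a [ha hc]] hh phi_le phi_att g_le g_h.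
rewrite -(cost_sqdist P f) in hc.
have [n0|n0] := posnP n.
  split.
    rewrite (_ : mismatch f g = 0%N) ?mulr_ge0 ?ler0n ?ltW //.
    by apply/eqP; rewrite -leqn0 (leq_trans (max_card _)) // card_ord n0.
  apply: le_trans (_ : 0 <= _).
    rewrite cost_sqdist big1 // => p; by have := ltn_ord p; rewrite [X in (_ < X)%N]n0.
  by apply: mulr_ge0; [rewrite addr_ge0 // ltW|exact: cost_ge0].
have n0' : 0 < n%:R :> R by rewrite ltr0n.
set X := cost P f in hc *.
have phi0 p : 0 <= phi p by have [j ->] := phi_att p; exact: sqdist_ge0.
have Phi0 : 0 <= Phi by apply: sumr_ge0.
(* Following the nearest center is itself a clustering, whose cost is at most [Phi]. *)
have X_Phi : X <= Phi.
  have [nn hnn] := boolp.choice phi_att.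
  apply: le_trans (fo [ffun p => nn p]) _.
  apply: le_trans (cost_le_sqdist _ _ c) _.
  by apply: ler_sum => p _; rewrite ffunE hnn.
have Phi_X : Phi <= (1 + eps ^+ 2 / 32) * X.
  by apply: le_trans hc; apply: ler_sum => p _; exact: phi_le.
have e2 : eps ^+ 2 <= eps by rewrite expr2 ler_piMr // ltW.
have e20 : 0 < eps ^+ 2 by rewrite exprn_gt0.
have X0 : 0 <= X by exact: cost_ge0.
have tauE : tau * n%:R = eps * Phi / 4 by rewrite /tau; field; rewrite gt_eqF.
have tau0 : 0 <= tau by rewrite /tau divr_ge0 // mulr_ge0 // ltW.
split; last first.
  apply: le_trans (cost_le_sqdist _ _ c) _.
  apply: (@le_trans _ _ (\sum_p (phi p + tau))); first by apply: ler_sum => p _; exact: g_le.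
  rewrite big_split /= sum_const_ord -/Phi mulrC tauE.
  have h1 := ler_wpM2l (ltW e0) Phi_X.
  have h2 := ler_wpM2r X0 e2.
  have h3 : eps * (eps ^+ 2 * X) <= eps ^+ 2 * X.
    by rewrite ler_piMl ?mulr_ge0 // ltW.
  lra.
(* A wrong output comes from a mistake of [h], from a cluster moved by [a], or from overruling a
   correct label, in [E]. Their shares are 3/4, 1/8 and 1/8 of [eps * n]. *)
pose E := [set p | (a (f p) == f p) && (phi p + tau < sqdist (P p) (c (f p)))].
have sub : [set p | f p != g p] \subset
    [set p | f p != h p] :|: [set p | a (f p) != f p] :|: E.
  apply/fintype.subsetP => p; rewrite !inE => fg.
  case: (eqVneq (f p) (h p)) => [fh|//] /=; case: (eqVneq (a (f p)) (f p)) => //= _.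
  by rewrite ltNge; apply: contra fg => le; rewrite (g_h p) -fh.
have mE : (mismatch f g)%:R <= (mismatch f h)%:R + #|[set p | a (f p) != f p]|%:R + #|E|%:R :> R.
  rewrite -!natrD ler_nat; apply: leq_trans (subset_leq_card sub) _.
  apply: leq_trans (leq_card_setU _ _) _; rewrite leq_add2r.
  exact: leq_card_setU.
suff cE : #|E|%:R <= eps / 8 * n%:R.
  by apply: le_trans mE _; lra.
(* Extending the sum to all points adds nonnegative terms; since [Phi >= X], only the eps^2 / 32 of
   [good_centers] remains. *)
have excess : \sum_(p in E) (sqdist (P p) (c (f p)) - phi p) <= eps ^+ 2 / 32 * X.
  apply: (@le_trans _ _ (\sum_p (sqdist (P p) (c (a (f p))) - phi p))).
    rewrite [leRHS](bigID (mem E)) /=.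
    apply: (@le_trans _ _ (\sum_(p in E) (sqdist (P p) (c (a (f p))) - phi p))).
      by apply: ler_sum => p; rewrite inE => /andP[/eqP ->].
    by rewrite lerDl; apply: sumr_ge0 => p _; rewrite subr_ge0.
  rewrite sumrB -/Phi; lra.
have [E0|Ene] := posnP #|E|; first by rewrite E0 mulr_ge0 // divr_ge0 // ltW.
have Ene' : 0 < #|E|%:R :> R by rewrite ltr0n.
(* Every point of [E] exceeds [tau], so E has at most (eps^2 / 32) * (4n / eps) = eps n / 8
   points. *)
have lt : #|E|%:R * tau < \sum_(p in E) (sqdist (P p) (c (f p)) - phi p).
  rewrite mulr_natl -sumr_const; apply: ltr_sum => [|p].
    move: Ene; rewrite card_gt0 => /finset.set0Pn[p hp].
    by apply/hasP; exists p => //; rewrite mem_index_enum.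
  by rewrite inE => /andP[_]; lra.
have Phi1 : 0 < Phi.
  rewrite lt_def Phi0 andbT; apply: contraTneq (lt_le_trans lt excess) => Phi_z.
  have X_z : X = 0 by apply/eqP; rewrite eq_le X0 andbT -Phi_z.
  by rewrite X_z mulr0 -leNgt mulr_ge0.
have h1 : eps * Phi / 4 * #|E|%:R <= eps ^+ 2 / 32 * Phi * n%:R.
  rewrite -tauE [leLHS](_ : _ = #|E|%:R * tau * n%:R); last by ring.
  rewrite ler_pM2r //; apply: le_trans (ltW lt) (le_trans excess _).
  by rewrite ler_pM2l // divr_gt0.
have d0 : 0 < eps * Phi / 4 by rewrite divr_gt0 // mulr_gt0.
rewrite -(ler_pM2l d0); apply: le_trans h1 _; rewrite expr2; lra.
Qed.

End Combine.

(** * Choosing between two hypotheses by validation *)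

Section Learning.
Variables (R : realType) (r n k : nat) (P : 'I_n -> 'rV[R]_r) (f : kclustering n k).
Variables (eps delta : R).
Hypotheses (eps01 : 0 < eps < 1) (delta01 : 0 < delta < 1) (n0 : (0 < n)%N).

Let e0 : 0 < eps. Proof. by case/andP: eps01. Qed.
Let d0 : 0 < delta. Proof. by case/andP: delta01. Qed.
Let n0' : 0 < n%:R :> R. Proof. by rewrite ltr0n. Qed.

Definition uniform (n : nat) : 'I_n -> R := fun=> n%:R^-1.

Lemma distr_uniform : distr (@uniform n).
Proof.
split=> [p|]; first by rewrite invr_ge0.
by rewrite sum_const_ord divff // gt_eqF.
Qed.

Definition mistakes (h : 'I_n -> 'I_k) (S : seq 'I_n) : R := \sum_(p <- S) (h p != f p)%:R.

Definition select h1 h2 S := if mistakes h2 S < mistakes h1 S then h2 else h1.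

Lemma mean_mistake h : \sum_p @uniform n p * (h p != f p)%:R = (mismatch f h)%:R / n%:R.
Proof.
rewrite -mulr_sumr mulrC; congr (_ / _); rewrite -natr_sum -big_mkcond /= sum1dep_card.
by congr _%:R; apply: eq_card => p; rewrite !inE eq_sym.
Qed.

(** Only a pair made of a good and a bad hypothesis matters: the error rates then differ by more
    than eps / 4, and keeping the bad one requires the empirical difference to deviate by as much.
    Chebyshev's inequality gives 16 / (eps^2 N) <= delta / 4. *)
Lemma select_Pr N h1 h2 : 64 / (eps ^+ 2 * delta) <= N%:R ->
  (mismatch f h1)%:R <= eps / 2 * n%:R \/ (mismatch f h2)%:R <= eps / 2 * n%:R ->
  1 - delta / 4 <= Ex (nseq N (@uniform n)) (fun S =>
     ((mismatch f (select h1 h2 S))%:R <= 3 / 4 * eps * n%:R)%R%:R).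
Proof.
move=> hN hor.
have du := distr_uniform.
have N0 : 0 < N%:R :> R.
  by apply: lt_le_trans hN; rewrite divr_gt0 // mulr_gt0 // exprn_gt0.
have en : 0 < eps * n%:R by rewrite mulr_gt0.
pose b h := (mismatch f h)%:R <= 3 / 4 * eps * n%:R.
have [|] := boolP (b h1 && b h2).
  move=> /andP[b1 b2]; rewrite (Ex_ext (G := fun=> 1)).
    by rewrite Ex_iid_const //; have := d0; lra.
  by move=> S _; rewrite /select; case: ifP => _; rewrite -/(b _) ?b1 ?b2.
move=> nb.
pose g p : R := (h1 p != f p)%:R - (h2 p != f p)%:R.
have mg : \sum_p @uniform n p * g p = (mismatch f h1)%:R / n%:R - (mismatch f h2)%:R / n%:R.
  by rewrite -!mean_mistake -sumrB; apply: eq_bigr => p _; rewrite mulrBr.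
have vg : \sum_p @uniform n p * g p ^+ 2 <= 1.
  rewrite -[leRHS]du.2; apply: ler_sum => p _; rewrite ler_piMr ?invr_ge0 // /g.
  by case: (h1 p != f p); case: (h2 p != f p); rewrite ?subrr ?subr0 ?sub0r ?sqrrN ?expr0n ?expr1n.
set mu := \sum_p @uniform n p * g p in mg.
have gap : eps / 4 < `|mu|.
  rewrite mg -mulrBl normrM normfV (gtr0_norm n0') ltr_pdivlMr // ltr_normr.
  move: nb; rewrite negb_and /b -!ltNge => /orP[]; case: hor => h h'; apply/orP;
    by [left; lra|right; lra].
have a0 : 0 < N%:R * (eps / 4) by rewrite !mulr_gt0 // divr_gt0.
have cheb := Ex_chebyshev N g du a0; rewrite -/mu in cheb.
have cheb2 : N%:R * (\sum_p @uniform n p * g p ^+ 2) / (N%:R * (eps / 4)) ^+ 2 <= delta / 4.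
  have ed0 : 0 < eps ^+ 2 * delta by rewrite mulr_gt0 // exprn_gt0.
  apply: (@le_trans _ _ (N%:R * 1 / (N%:R * (eps / 4)) ^+ 2)).
    by rewrite ler_pM2r ?invr_gt0 ?exprn_gt0 // ler_pM2l.
  rewrite ler_pdivrMr in hN => //; rewrite ler_pdivrMr ?exprn_gt0 //.
  have := ler_wpM2l (ltW N0) hN; rewrite !expr2; lra.
rewrite lerBlDr -[leLHS](Ex_iid_const N 1 du).
apply: le_trans (_ : Ex (nseq N (@uniform n)) (fun S =>
  ((mismatch f (select h1 h2 S))%:R <= 3 / 4 * eps * n%:R)%R%:R +
  (N%:R * (eps / 4) < `|\sum_(p <- S) g p - N%:R * mu|)%R%:R) <= _); last first.
  by rewrite ExD lerD2l (le_trans cheb).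
apply: Ex_le => [w /In_nseq -> p|S _]; first by rewrite invr_ge0.
case: (lerP (mismatch f _)%:R) => bad; first by rewrite lerDl.
rewrite add0r (_ : (_ < _) = true) //.
have gapN : N%:R * (eps / 4) < `|N%:R * mu| by rewrite normrM ger0_norm // ltr_pM2l.
apply: lt_le_trans gapN _.
have gS : \sum_(p <- S) g p = mistakes h1 S - mistakes h2 S by rewrite sumrB.
rewrite gS.
have Nmu : N%:R * mu = N%:R / n%:R * ((mismatch f h1)%:R - (mismatch f h2)%:R).
  by rewrite mg; ring.
have Nn : 0 < N%:R / n%:R :> R by rewrite divr_gt0.
move: bad; rewrite /select; case: (ltP (mistakes h2 S)) => hm bad.
  have neg : N%:R * mu <= 0.
    rewrite Nmu; apply: mulr_ge0_le0; first exact: ltW.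
    by move: nb; rewrite /b; case: hor; lra.
  rewrite (ler0_norm neg) ler_normr; apply/orP; left; lra.
have pos : 0 <= N%:R * mu.
  rewrite Nmu; apply: mulr_ge0; first exact: ltW.
  by move: nb; rewrite /b; case: hor; lra.
by rewrite (ger0_norm pos) ler_normr; apply/orP; right; lra.
Qed.

End Learning.

(** * Probability of success *)

Section Success.
Variables (R : realType) (r n k : nat) (P : 'I_n -> 'rV[R]_r).
Variables (AL : learner R r k) (m : R -> R -> nat) (eps delta : R).
Hypotheses (eps01 : 0 < eps < 1) (delta01 : 0 < delta < 1) (n0 : (0 < n)%N) (k2 : (1 < k)%N).
Hypotheses (learnsAL : learns AL m) (injP : injective P) (nbP : no_boundary P k).

Let e0 : 0 < eps. Proof. by case/andP: eps01. Qed.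
Let d0 : 0 < delta. Proof. by case/andP: delta01. Qed.
Let n0' : 0 < n%:R :> R. Proof. by rewrite ltr0n. Qed.

Definition hypothesis (f : kclustering n k) (S : seq 'I_n) := AL P [seq (s, f s) | s <- S].

(** Learnability for the set of all points. The accuracy is sufficient because eps^4 / k <= eps / 2
    when [1 < k]. *)
Lemma learner_Pr (f : kclustering n k) : is_optimal P f ->
  1 - delta <= Ex (nseq (m (eps ^+ 4 / k%:R) delta) (@uniform R n)) (fun S =>
     ((mismatch f (hypothesis f S))%:R <= eps / 2 * n%:R)%R%:R).
Proof.
move=> fo; set e4 := eps ^+ 4 / k%:R; set M := m e4 delta.
have k2' : 2 <= k%:R :> R by rewrite ler_nat.
have k0' : 0 < k%:R :> R by rewrite ltr0n ltnW.
have [_ e1] := andP eps01.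
have e40 : 0 < e4 by rewrite divr_gt0 // exprn_gt0.
have e4_le : e4 <= eps / 2.
  have h : eps ^+ 4 <= eps.
    by rewrite exprS; apply: ler_piMr; [exact: ltW|apply: exprn_ile1; exact: ltW].
  rewrite ler_pdivrMr //; apply: le_trans h _.
  rewrite -mulrA; apply: ler_peMr; [exact: ltW|lra].
have e41 : 0 < e4 < 1 by rewrite e40; lra.
have [_ H] := learnsAL e41 delta01.
have := H n P injP nbP f fo [set: 'I_n] M (leqnn M) => /= {}H.
have -> : @uniform R n = fun=> #|'I_n|%:R^-1 by rewrite card_ord.
rewrite Ex_uniform card_ord mulrC ler_pdivlMr ?ltr0n ?expn_gt0 ?n0 //.
rewrite cardsT card_ord in H; apply: le_trans H _.
rewrite -sum1_card natr_sum big_mkcond /=; apply: ler_sum => S _.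
rewrite inE; case: ifP => [/andP[_ h]|_]; last exact: ler0n.
rewrite (_ : ((mismatch f (hypothesis f S))%:R <= eps / 2 * n%:R) = true) //.
have cm : n%:R = #|[set p in [set: 'I_n] | hypothesis f S p == f p]|%:R + (mismatch f (hypothesis f S))%:R :> R.
  have := cardsID [set p | hypothesis f S p == f p] [set: 'I_n].
  rewrite cardsT card_ord => e; rewrite -natrD; congr _%:R; rewrite -[LHS]e.
  by congr (_ + _)%N; apply: eq_card => p; rewrite !inE ?andbT // eq_sym.
have h2 : e4 * n%:R <= eps / 2 * n%:R by rewrite ler_wpM2r.
apply: le_trans h2; rewrite -(lerD2l #|[set p in [set: 'I_n] | hypothesis f S p == f p]|%:R) -cm.
by rewrite -lerBlDr -[X in X - _]mul1r -mulrBl.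
Qed.

Variables (q : 'I_n -> R) (N : nat).

Definition success (f : kclustering n k) (S0 S1 S2 S3 : seq 'I_n) : bool :=
  `[< good_centers P f eps (sample_center P f q S0) >] &&
  ((mismatch f (select R f (hypothesis f S1) (hypothesis f S2) S3))%:R <= 3 / 4 * eps * n%:R :> R).

(** The four samples are independent, and (1 - delta / 4)^2 (1 - delta^2) >= 1 - delta. *)
Lemma success_Pr (f : kclustering n k) : distr q -> is_optimal P f ->
  Ex (nseq N q) (fun S => (~~ `[< good_centers P f eps (sample_center P f q S) >])%:R) <= delta / 4 ->
  64 / (eps ^+ 2 * delta) <= N%:R ->
  1 - delta <= Ex (nseq N q) (fun S0 =>
     Ex (nseq (m (eps ^+ 4 / k%:R) delta) (@uniform R n)) (fun S1 =>
     Ex (nseq (m (eps ^+ 4 / k%:R) delta) (@uniform R n)) (fun S2 => Ex (nseq N (@uniform R n)) (fun S3 =>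
     (success f S0 S1 S2 S3)%:R)))).
Proof.
move=> dq fo hg hN; set M := m _ _; have du := distr_uniform R n0.
have u0 ws : forall w, List.In w (nseq ws (@uniform R n)) -> forall p, 0 <= w p.
  by move=> w /In_nseq -> p; rewrite invr_ge0.
have q0 ws : forall w, List.In w (nseq ws q) -> forall p, 0 <= w p.
  by move=> w /In_nseq -> p; exact: dq.1.
pose L S : R := ((mismatch f (hypothesis f S))%:R <= eps / 2 * n%:R)%R%:R.
have L1 S : 0 <= 1 - L S by rewrite subr_ge0 /L lern1 leq_b1.
pose G S : R := `[< good_centers P f eps (sample_center P f q S) >]%:R.
have G0 S : 0 <= G S by [].
have dd : 0 <= 1 - delta / 4 by have /andP[_] := delta01; lra.
(* The expression [1 - (1 - L S1) * (1 - L S2)] is the indicator that at least one of the two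
   hypotheses is good. *)
have step S0 S1 S2 : G S0 * ((1 - delta / 4) * (1 - (1 - L S1) * (1 - L S2))) <=
    Ex (nseq N (@uniform R n)) (fun S3 => (success f S0 S1 S2 S3)%:R).
  pose Sel S3 : R := ((mismatch f (select R f (hypothesis f S1) (hypothesis f S2) S3))%:R
                  <= 3 / 4 * eps * n%:R)%R%:R.
  rewrite (Ex_ext (G := fun S3 => G S0 * Sel S3)) => [|S3 _]; last first.
    by rewrite /success -mulnb natrM.
  rewrite ExZ; apply: ler_wpM2l => //.
  have [l12|] := boolP (((mismatch f (hypothesis f S1))%:R <= eps / 2 * n%:R :> R) ||
                        ((mismatch f (hypothesis f S2))%:R <= eps / 2 * n%:R :> R)).
    apply: le_trans (_ : 1 - delta / 4 <= _); last first.
      by apply: select_Pr => //; apply/orP.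
    by rewrite ler_piMr // lerBlDr lerDl mulr_ge0.
  rewrite negb_or /L => /andP[/negPf -> /negPf ->].
  rewrite subr0 mulr1 subrr mulr0; apply: Ex_iid_ge0 => // p; by rewrite invr_ge0.
apply: le_trans (_ : Ex (nseq N q) (fun S0 => Ex (nseq M (@uniform R n)) (fun S1 =>
     Ex (nseq M (@uniform R n)) (fun S2 =>
     G S0 * ((1 - delta / 4) * (1 - (1 - L S1) * (1 - L S2)))))) <= _); last first.
  apply: (Ex_le (q0 N)) => S0 _; apply: (Ex_le (u0 M)) => S1 _.
  by apply: (Ex_le (u0 M)) => S2 _.
set EL := Ex (nseq M (@uniform R n)) L.
have hL : 1 - delta <= EL by exact: learner_Pr.
have inner S0 : Ex (nseq M (@uniform R n)) (fun S1 => Ex (nseq M (@uniform R n)) (fun S2 =>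
     G S0 * ((1 - delta / 4) * (1 - (1 - L S1) * (1 - L S2)))))
   = G S0 * ((1 - delta / 4) * (1 - (1 - EL) ^+ 2)).
  transitivity (Ex (nseq M (@uniform R n)) (fun S1 =>
    G S0 * (1 - delta / 4) * EL + G S0 * (1 - delta / 4) * (1 - EL) * L S1)).
    apply: Ex_ext => S1 _.
    rewrite (Ex_ext (G := fun S2 => G S0 * (1 - delta / 4) * L S1 +
        G S0 * (1 - delta / 4) * (1 - L S1) * L S2)) => [|S2 _]; last by ring.
    by rewrite ExD Ex_iid_const // ExZ -/EL; ring.
  by rewrite ExD Ex_iid_const // ExZ -/EL; ring.
rewrite (Ex_ext (G := fun S0 => ((1 - delta / 4) * (1 - (1 - EL) ^+ 2)) * G S0)); last first.
  by move=> S0 _; rewrite inner mulrC.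
rewrite ExZ.
have hG : 1 - delta / 4 <= Ex (nseq N q) G.
  rewrite lerBlDr -[leLHS](Ex_iid_const N 1 dq).
  apply: le_trans (lerD (lexx _) hg); rewrite -ExD; apply: (Ex_le (q0 N)) => S _.
  by rewrite /G; case: `[< _ >]; rewrite ?addr0 ?add0r.
have EL1 : EL <= 1.
  rewrite -[leRHS](Ex_iid_const M 1 du); apply: (Ex_le (u0 M)) => S _.
  by rewrite /L lern1 leq_b1.
have [_ d1] := andP delta01.
have h1 : (1 - EL) ^+ 2 <= delta ^+ 2.
  by apply: lerXn2r; rewrite ?nnegrE; lra.
have d2 : delta ^+ 2 < 1 by rewrite expr2 mulr_ilt1 // ltW.
apply: (@le_trans _ _ ((1 - delta / 4) * (1 - delta ^+ 2) * (1 - delta / 4))).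
  have [d01 d11] := (ltW d0, ltW d1).
  have t1 : 0 <= delta * (1 - delta) by rewrite mulr_ge0 // subr_ge0.
  have t2 : 0 <= delta * (1 - delta) * (1 - delta) by rewrite mulr_ge0 // subr_ge0.
  have t3 : 0 <= delta * delta * (1 - delta * delta) by rewrite !mulr_ge0 // subr_ge0 -expr2 ltW.
  rewrite !expr2; lra.
apply: ler_pM => //; first by rewrite mulr_ge0 // subr_ge0 ltW.
by apply: ler_wpM2l => //; lra.
Qed.

End Success.

(** * Uniform random renumbering of the clusters *)

Section FisherYates.
Variables (R : realType) (n k : nat) (i0 : 'I_k).
Implicit Types (x : seq 'I_n) (s : 'S_k).

(** The random indices of the shuffle are drawn as points, by the same device as the samples; this
    is why [k <= n] is needed below. *)
Definition row_upto t : 'I_n -> R := fun p => if (p < t.+1)%N then t.+1%:R^-1 else 0.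

Definition ord_at (i : nat) : 'I_k := insubd i0 i.

Fixpoint fisher_yates (x : seq nat) (t : nat) : 'S_k :=
  if t is t'.+1 then (tperm (ord_at t') (ord_at (nth 0%N x t')) * fisher_yates x t')%g else 1%g.

Lemma fisher_yates_cat x y t : (t <= size x)%N ->
  fisher_yates [seq val p | p <- x ++ y] t = fisher_yates [seq val p | p <- x] t.
Proof.
elim: t => [//|t IH] lt; rewrite [LHS]/= [RHS]/= (IH (ltnW lt)).
by rewrite [X in nth _ X]map_cat nth_cat size_map lt.
Qed.

Let fix_above t := [set s : 'S_k | [forall i : 'I_k, (t <= i)%N ==> (s i == i)]].

(** A permutation fixing everything above [t] factors uniquely as the transposition of [t] and [j]
    followed by one that also fixes [t], where [j] is the preimage of [t]. *)
Let sum_fix_above t (F : 'S_k -> R) : (t < k)%N ->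
  \sum_(j < t.+1) \sum_(s in fix_above t) F (tperm (ord_at t) (ord_at j) * s)%g =
  \sum_(s in fix_above t.+1) F s.
Proof.
move=> tk; have ot (i : 'I_k) : ord_at i = i by apply: val_inj; rewrite val_insubd ltn_ord.
have vt : val (ord_at t) = t by rewrite val_insubd tk.
have vj (j : 'I_t.+1) : val (ord_at j) = j.
  by rewrite val_insubd (leq_trans (ltn_ord j)).
rewrite [RHS](partition_big (fun s : 'S_k => inord (val (s^-1 (ord_at t))%g) : 'I_t.+1) predT) //=.
apply: eq_bigr => j _.
rewrite [RHS](reindex_inj (mulgI (tperm (ord_at t) (ord_at j)))) /=; apply: eq_bigl => s.
rewrite !inE; apply/idP/andP.
  move=> /forallP hs; have st : s (ord_at t) = ord_at t.
    by apply/eqP; have := hs (ord_at t); rewrite vt leqnn.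
  split.
    apply/forallP => i; apply/implyP => ti; rewrite permM tpermD.
    - by have := hs i; rewrite (ltnW ti).
    - by apply: contraTneq ti => <-; rewrite vt ltnn.
    - by apply: contraTneq ti => <-; rewrite vj -leqNgt -ltnS.
  rewrite invMg permM tpermV -{2}st permK tpermL; apply/eqP/val_inj.
  by rewrite /= inordK vj.
move=> [/forallP hs /eqP hj].
have lt_inv : (val ((tperm (ord_at t) (ord_at j) * s)^-1 (ord_at t))%g < t.+1)%N.
  rewrite ltnNge; apply/negP => lt; set u := ((tperm (ord_at t) (ord_at j) * s)^-1 (ord_at t))%g in lt hj.
  have := hs u; rewrite lt /= permKV => /eqP e.
  by rewrite -e vt ltnn in lt.
have st : s (ord_at t) = ord_at t.
  have : ((tperm (ord_at t) (ord_at j) * s)^-1 (ord_at t))%g = ord_at j.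
    by apply: val_inj; rewrite vj; have := congr1 val hj; rewrite /= inordK.
  by move=> /(congr1 (tperm (ord_at t) (ord_at j) * s)%g); rewrite permKV permM tpermR.
apply/forallP => i; apply/implyP; rewrite leq_eqVlt => /orP[/eqP ti|ti].
  by rewrite -[i](ot i) -ti st.
have := hs i; rewrite ti /= permM tpermD //.
- by apply: contraTneq ti => <-; rewrite vt ltnn.
- by apply: contraTneq ti => <-; rewrite vj -leqNgt -ltnS.
Qed.

Lemma fisher_yates_uniform (F : 'S_k -> R) : (k <= n)%N ->
  Ex (mkseq row_upto k) (fun x => F (fisher_yates [seq val p | p <- x] k)) =
  (k`!)%:R^-1 * \sum_s F s.
Proof.
move=> kn.
have H t : (t <= k)%N ->
  forall F, Ex (mkseq row_upto t) (fun x => F (fisher_yates [seq val p | p <- x] t)) =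
  (t`!)%:R^-1 * \sum_(s in fix_above t) F s.
  elim: t => [_|t IH tk] {}F.
    rewrite /= fact0 invr1 mul1r (big_pred1 1%g) // => s; rewrite inE /=.
    apply/forallP/eqP => [h|->]; last by move=> i; rewrite perm1 eqxx.
    by apply/permP => i; rewrite perm1; apply/eqP/h.
  rewrite /mkseq -addn1 iotaD map_cat Ex_cat add0n /=.
  pose G s := \sum_(j < t.+1) t.+1%:R^-1 * F (tperm (ord_at t) (ord_at j) * s)%g.
  rewrite (Ex_ext (G := fun x => G (fisher_yates [seq val p | p <- x] t))); last first.
    move=> x; rewrite size_map size_iota => sx.
    rewrite /G (big_ord_widen n (fun j => t.+1%:R^-1 * F (tperm (ord_at t) (ord_at j) * _)%g)).
      rewrite [RHS]big_mkcond /=; apply: eq_bigr => p _.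
      rewrite addn1 /= /row_upto; case: ifP => _; last by rewrite mul0r.
      rewrite fisher_yates_cat ?sx //; congr (_ * F (tperm _ (ord_at _) * _)%g).
      by rewrite map_cat nth_cat size_map sx ltnn subnn.
    exact: leq_trans tk kn.
  rewrite (IH (ltnW tk)) /G exchange_big /= addn1 -sum_fix_above // factS natrM invfM.
  rewrite [X in _ = X * _]mulrC -mulrA; congr (_ * _); rewrite mulr_sumr.
  by apply: eq_bigr => j _; rewrite mulr_sumr.
rewrite (H k (leqnn k)); congr (_ * _); apply: eq_bigl => s; rewrite inE.
by apply/forallP => i; rewrite leqNgt ltn_ord.
Qed.

End FisherYates.

(** * The programs *)

(* Array 2 holds the loop bounds: n, k, r, the number 2k + 1 of seeds, the size
   N of the weighted and of the validation sample, the size M of a learning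
   sample, the numbers k + 2N + 2M of draws and 2N + 2M of labeled draws, 2k,
   and the number of local search steps.  Arrays of naturals: 13 to 19 counters,
   20 seeds, 22 closest seed, 24 draws, 25 renumbering of the clusters, 26
   labels of the draws, 27 and 28 cluster representatives and their number, 29
   and 30 hypotheses.  Arrays of reals: 2 squared distances, 6 weights of each
   draw, 9 approximate centers, 10 distances to them, 13 sampling weights. *)

Notation Z := (NConst 0).

Definition draw_accept (bn : nat) : com :=
  If (BNlt Z (var 12))
    (Seq (NSet 24 (var 10) Z (var 11)) (NSet 11 Z Z (cell 2 (NConst bn))))
    (Seq (RSet 4 Z Z (RSub (rvar 4) (RGet 6 (var 10) (var 11))))
         (NSet 11 Z Z (NAdd (var 11) (NConst 1)))).

Definition draw_row (bn : nat) : com :=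
  While (BNlt (var 11) (cell 2 (NConst bn)))
    (Seq (Flip 12 Z Z (RDiv (RGet 6 (var 10) (var 11)) (rvar 4))) (draw_accept bn)).

Definition draw_rows (bT bn : nat) : com :=
  While (BNlt (var 10) (cell 2 (NConst bT)))
    (Seq (Seq (RSet 4 Z Z (RNat (NConst 1))) (Seq (NSet 11 Z Z Z) (draw_row bn)))
         (NSet 10 Z Z (NAdd (var 10) (NConst 1)))).

(* Array 24 receives independent draws, the [t]-th one following the weights in
   row [t] of array 6: points are examined in order, each being accepted with
   its probability conditional on the rejection of its predecessors. *)
Definition draws (bT bn : nat) : com := Seq (NSet 10 Z Z Z) (draw_rows bT bn).

(** * Distribution of the output of the sampling program *)

Section Draws.
Variables (R : realType) (n k : nat) (O : oracles R n k).
Implicit Types (s : state R n k) (E : state R n k -> Prop) (K : seq com).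

Definition same_rest s s' := sample s' = sample s /\ queries s' = queries s.

Definition drawn t (i : 'I_n) s s' :=
  [/\ frame [:: 11; 12; 24] [:: 4] s s', nmem s' 24 t 0 = i,
      forall t', t' != t -> nmem s' 24 t' 0 = nmem s 24 t' 0 & same_rest s s'].

(** Induction on the number [d] of points still to be examined. Multiplying by the remaining mass,
    stored in real cell 4, turns conditional probabilities back into weights. The 8 steps per point
    are 2 for the loop, 1 for the toss and at most 5 after it. *)
Lemma draw_row_Pr bn t (w : 'I_n -> R) (v : 'I_n -> R) t0 K E d s :
  nmem s 2 bn 0 = n -> nmem s 10 0 0 = t -> (d <= n)%N -> nmem s 11 0 0 = (n - d)%N ->
  (forall p : 'I_n, rmem s 6 t p = w p) -> (forall p, 0 <= w p) ->
  rmem s 4 0 0 = \sum_(p < n | (n - d <= p)%N) w p -> 0 < rmem s 4 0 0 ->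
  (forall p s', 0 < w p -> drawn t p s s' -> v p <= Pr t0 O K s' E) ->
  \sum_(p < n | (n - d <= p)%N) w p * v p <=
    rmem s 4 0 0 * Pr (8 * d + t0) O (draw_row bn :: K) s E.
Proof.
move=> hn ht dn hp hw w0; elim: d dn s hn ht hp hw => [|d IH] dn s hn ht hp hw hrem rem0 hv.
  move: rem0; rewrite hrem big_pred0 ?ltxx // => p.
  by rewrite subn0 leqNgt ltn_ord.
have lt : (n - d.+1 < n)%N by lia.
pose p := Ordinal lt; set rem := rmem s 4 0 0 in hrem rem0 *.
have split (F : 'I_n -> R) : \sum_(i < n | (n - d.+1 <= i)%N) F i =
    F p + \sum_(i < n | (n - d <= i)%N) F i.
  rewrite (bigD1 p) //=; congr (_ + _); apply: eq_bigl => i.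
  by rewrite -val_eqE /=; lia.
rewrite split in hrem; rewrite split.
pose sc b := nassign s 12 Z Z b.
have wp : rmem s 6 t (n - d.+1)%N = w p by exact: (hw p).
have chosen : v p <= Pr (5 + t0) O (draw_accept bn :: draw_row bn :: K) (sc 1%N) E \/ w p = 0.
  have [|wp0] := leP (w p) 0; first by right; apply/eqP; rewrite eq_le w0 andbT.
  left.
  pose s1 := nassign (sc 1%N) 24 (var 10) Z (n - d.+1)%N.
  pose s2 := nassign s1 11 Z Z n.
  apply: (@le_trans _ _ (Pr t0 O K s2 E)).
    apply: hv => //; split.
    - apply: (@frame_trans _ _ _ _ _ _ s1); last by apply: frame_nassign.
      by apply: (@frame_trans _ _ _ _ _ _ (sc 1%N)); apply: frame_nassign.
    - by rewrite /= /upd /= ht eqxx.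
    - by move=> t' /negPf h; rewrite /= /upd /= ht h.
    - by [].
  have : reach O 5 (draw_accept bn :: draw_row bn :: K) (sc 1%N) K s2.
    apply: (@reach_trans _ _ _ _ 1 4); first by apply: reach_step.
    apply: (@reach_trans _ _ _ _ 1 3); first by apply: reach_step.
    apply: (@reach_trans _ _ _ _ 1 2); first by apply: reach_step.
    apply: (@reach_trans _ _ _ _ 1 1); first by apply: reach_step.
    have -> : nassign (nassign (sc 1%N) 24 (var 10) Z (neval (sc 1%N) (var 11))) 11 Z Z
       (neval (nassign (sc 1%N) 24 (var 10) Z (neval (sc 1%N) (var 11))) (cell 2 (NConst bn)))
       = s2.
      by rewrite /s2 /s1 /= /upd /= hp hn.
    apply: reach_step; rewrite /= /upd /= hn ltnn //.
  exact.
have skipped : \sum_(i < n | (n - d <= i)%N) w i * v i <=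
    (rem - w p) * Pr (4 + (8 * d + t0)) O (draw_accept bn :: draw_row bn :: K) (sc 0%N) E.
  (* If no mass remains, all later weights vanish and the left-hand side is at most 0. *)
  have [|pos] := leP (rem - w p) 0.
    rewrite hrem addrAC subrr add0r => h0.
    have z : \sum_(i < n | (n - d <= i)%N) w i = 0.
      by apply/eqP; rewrite eq_le h0 sumr_ge0.
    rewrite z mul0r; apply: sumr_le0 => i hi.
    have /eqP := z; rewrite psumr_eq0 // => /allP /(_ i (mem_index_enum _)).
    by rewrite hi => /eqP ->; rewrite mul0r.
  pose s1 := set_rmem (sc 0%N) (upd (rmem s) 4 0 0 (rem - w p)).
  pose s2 := nassign s1 11 Z Z (n - d)%N.
  have rem2 : rmem s2 4 0 0 = rem - w p by rewrite /= /upd /=.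
  have fr : frame [:: 11; 12; 24] [:: 4] s s2.
    split=> a; rewrite !inE; last by move=> a4; rewrite /= upd_neq.
    by rewrite !negb_or => /and3P[a1 a2 a3]; rewrite /= upd_neq // upd_neq.
  have g1 : nmem s2 2 bn 0 = n by case: fr => -> .
  have g2 : nmem s2 10 0 0 = t by case: fr => -> .
  have g4 i : rmem s2 6 t (val i) = w i by case: fr => _ -> //; exact: hw.
  have g5 : rmem s2 4 0 0 = \sum_(i < n | (n - d <= i)%N) w i.
    by rewrite rem2 hrem addrAC subrr add0r.
  have g6 i s' : 0 < w i -> drawn t i s2 s' -> v i <= Pr t0 O K s' E.
    move=> wi [f1 f2 f3 f4]; apply: hv => //; split=> //.
    by apply: frame_trans fr f1.
  have g7 : 0 < rmem s2 4 0 0 by rewrite rem2.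
  apply: le_trans (IH (ltnW dn) s2 g1 g2 (erefl _) g4 g5 g7 g6) _; rewrite rem2.
  apply: ler_wpM2l; first exact: ltW.
  have : reach O 4 (draw_accept bn :: draw_row bn :: K) (sc 0%N) (draw_row bn :: K) s2.
    apply: (@reach_trans _ _ _ _ 1 3); first by apply: reach_step.
    apply: (@reach_trans _ _ _ _ 1 2); first by apply: reach_step.
    have e1 : reval (sc 0%N) (RSub (rvar 4) (RGet 6 (var 10) (var 11))) = rem - w p.
      by rewrite /= /upd /= ht hp wp.
    have e2 : neval s1 (NAdd (var 11) (NConst 1)) = (n - d)%N.
      by rewrite /= /upd /= hp; lia.
    apply: (@reach_trans _ _ _ _ 1 1 _ _ _ s1); first by apply: reach_step; rewrite /step e1.
    by apply: reach_step; rewrite /step e2.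
  exact.
have head : reach O 2 (draw_row bn :: K) s
    (Flip 12 Z Z (RDiv (RGet 6 (var 10) (var 11)) (rvar 4)) :: draw_accept bn :: draw_row bn :: K) s.
  apply: (@reach_trans _ _ _ _ 1 1); first by apply: reach_step; rewrite /= hp hn lt.
  exact: reach_step.
have t_eq : (8 * d.+1 + t0 = 2 + (5 + (8 * d + t0)).+1)%N by lia.
rewrite t_eq; apply: le_trans (ler_wpM2l (ltW rem0) (head E _)).
have pval : rmem s 6 (nmem s 10 0 0) (nmem s 11 0 0) / rmem s 4 0 0 = w p / rem.
  by rewrite ht hp wp.
have mono a b c (h : (a <= b)%N) : Pr a O c (sc 0%N) E <= Pr b O c (sc 0%N) E by apply: Pr_leq.
have mono1 a b c (h : (a <= b)%N) : Pr a O c (sc 1%N) E <= Pr b O c (sc 1%N) E by apply: Pr_leq.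
have wrem : w p <= rem by rewrite hrem lerDl sumr_ge0.
have ch : w p * v p <= w p * Pr (5 + (8 * d + t0)) O (draw_accept bn :: draw_row bn :: K) (sc 1%N) E.
  case: chosen => [h|->]; last by rewrite !mul0r.
  by apply: ler_wpM2l => //; apply: le_trans h (mono1 _ _ _ _); lia.
have sk : \sum_(i < n | (n - d <= i)%N) w i * v i <=
    (rem - w p) * Pr (5 + (8 * d + t0)) O (draw_accept bn :: draw_row bn :: K) (sc 0%N) E.
  apply: le_trans skipped _; apply: ler_wpM2l; first by rewrite subr_ge0.
  by apply: mono; lia.
move: (5 + (8 * d + t0))%N ch sk => tt ch sk.
rewrite [Pr tt.+1 _ _ _ _]/= pval.
(* [Flip] is a genuine toss only strictly between 0 and 1; the two extremes are deterministic
   steps. *)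
case: (leP (w p / rem) 0) => [h|h].
  have wz : w p = 0.
    by apply/eqP; rewrite eq_le w0 andbT; move: h; rewrite pmulr_lle0 // invr_gt0.
  by rewrite wz subr0 in sk *; rewrite mul0r add0r.
case: (leP 1 (w p / rem)) => [h1|h1].
  have wz : w p = rem.
    by apply/eqP; rewrite eq_le wrem; move: h1; rewrite ler_pdivlMr // mul1r.
  rewrite wz subrr mul0r in sk; rewrite -[leRHS]addr0; apply: lerD => //.
  by rewrite -wz.
set A := Pr _ _ _ _ _ in ch *; set B := Pr _ _ _ (sc 0%N) _ in sk *.
have -> : rem * (w p / rem * A + (1 - w p / rem) * B) = w p * A + (rem - w p) * B.
  by field; rewrite gt_eqF.
exact: lerD.
Qed.

Definition drawn_all (x : seq 'I_n) t s s' :=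
  [/\ frame [:: 10; 11; 12; 24] [:: 4] s s',
      forall i, (i < size x)%N -> nmem s' 24 (t + i)%N 0 = nth 0%N (map val x) i,
      forall t', (t' < t)%N -> nmem s' 24 t' 0 = nmem s 24 t' 0 & same_rest s s'].

(** The value [v] of [draw_row_Pr] is the expectation over the remaining rows. A row takes at most
    8n steps, plus 6 to enter it and 1 for the increment. *)
Lemma draw_rows_Pr bT bn (ws : seq ('I_n -> R)) (F : seq 'I_n -> R) t0 K E t s :
  nmem s 2 bn 0 = n -> nmem s 2 bT 0 = (t + size ws)%N -> nmem s 10 0 0 = t ->
  (forall i (p : 'I_n), (i < size ws)%N -> rmem s 6 (t + i)%N p = nth (fun=> 0) ws i p) ->
  (forall w, List.In w ws -> distr w) ->
  (forall x s', possible ws x -> drawn_all x t s s' -> F x <= Pr t0 O K s' E) ->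
  Ex ws F <= Pr (size ws * (8 * n + 7) + 1 + t0) O (draw_rows bT bn :: K) s E.
Proof.
move=> hn; elim: ws t F s hn => [|w ws IH] t F s hn hT ht hw dw hF.
  apply: le_trans (hF [::] s isT _) _; first by split.
  by rewrite mul0n add0n add1n /= hT ht addn0 ltnn.
have [w0 w1] := dw w (or_introl erefl).
pose sa := set_rmem s (upd (rmem s) 4 0 0 1); pose sb := nassign sa 11 Z Z 0.
pose incr := NSet 10 Z Z (NAdd (var 10) (NConst 1)).
have head : reach O 6 (draw_rows bT bn :: K) s
   (draw_row bn :: incr :: draw_rows bT bn :: K) sb.
  apply: (@reach_trans _ _ _ _ 1 5).
    by apply: reach_step; rewrite /= hT ht /= -addSnnS leq_addr.
  apply: (@reach_trans _ _ _ _ 1 4); first by apply: reach_step.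
  apply: (@reach_trans _ _ _ _ 1 3); first by apply: reach_step.
  apply: (@reach_trans _ _ _ _ 1 2 _ _ _ sa); first by apply: reach_step.
  apply: (@reach_trans _ _ _ _ 1 1); first by apply: reach_step.
  exact: reach_step.
have frb : frame [:: 10; 11; 12; 24] [:: 4] s sb.
  split=> a; rewrite !inE; last by move=> a4; rewrite /= upd_neq.
  by rewrite !negb_or => /and4P[_ a1 _ _]; rewrite /= upd_neq.
set t1 := (size ws * (8 * n + 7) + 1 + t0)%N in IH.
have -> : (size (w :: ws) * (8 * n + 7) + 1 + t0 = 6 + (8 * n + (1 + t1)))%N.
  by rewrite /t1 /=; lia.
apply: le_trans (head E _); rewrite /=.
have rem1 : rmem sb 4 0 0 = 1 by [].
have hwb (p : 'I_n) : rmem sb 6 t p = w p.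
  by have := hw 0%N p (ltn0Sn _); rewrite addn0.
have := @draw_row_Pr bn t w (fun p => Ex ws (fun x => F (p :: x))) (1 + t1) (incr :: draw_rows bT bn :: K) E n sb.
rewrite subnn rem1 mul1r; apply=> //.
move=> p s' wp [f1 f2 f3 [f4 f5]].
pose s2 := nassign s' 10 Z Z t.+1.
have fr2 : frame [:: 10; 11; 12; 24] [:: 4] sb s2.
  apply: (@frame_trans _ _ _ _ _ _ s'); last exact: frame_nassign.
  by apply: frame_sub f1 => a //; rewrite !inE => /or3P[] ->; rewrite ?orbT.
have fr := frame_trans frb fr2.
have : reach O 1 (incr :: draw_rows bT bn :: K) s' (draw_rows bT bn :: K) s2.
  have e : neval s' (NAdd (var 10) (NConst 1)) = t.+1.
    by rewrite /= addn1; case: f1 => -> //=; rewrite /upd /= ht.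
  by apply: reach_step; rewrite /incr /step e.
move=> /(_ E t1) h; apply: le_trans h.
apply: (IH t.+1 _ s2).
- by case: fr => ->.
- by case: fr => -> //; rewrite hT addSnnS.
- by [].
- move=> i q iw; case: fr => _ -> //.
  by have := hw i.+1 q; rewrite addnS -addSn => -> //.
- by move=> w' hw'; apply: dw; right.
- move=> x s'' px [g1 g2 g3 [g4 g5]]; apply: hF.
    by rewrite /possible /= wp.
  split.
  + exact: frame_trans fr g1.
  + case=> [|i] hi; rewrite /= ?addn0; first by rewrite g3 //= /upd /= f2.
    by rewrite addnS -addSn g2.
  + move=> t' lt; have ne : t' != t by rewrite neq_ltn lt.
    rewrite (g3 _ (ltnW lt)); transitivity (nmem s' 24 t' 0); first by [].
    by rewrite (f3 _ ne).
  + by rewrite /same_rest g4 g5 /= f4 f5.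
Qed.

Lemma draws_Pr bT bn (ws : seq ('I_n -> R)) (F : seq 'I_n -> R) t0 K E s :
  nmem s 2 bn 0 = n -> nmem s 2 bT 0 = size ws ->
  (forall i (p : 'I_n), (i < size ws)%N -> rmem s 6 i p = nth (fun=> 0) ws i p) ->
  (forall w, List.In w ws -> distr w) ->
  (forall x s', possible ws x -> frame [:: 10; 11; 12; 24] [:: 4] s s' ->
     (forall i, (i < size x)%N -> nmem s' 24 i 0 = nth 0%N (map val x) i) ->
     same_rest s s' -> F x <= Pr t0 O K s' E) ->
  Ex ws F <= Pr (size ws * (8 * n + 7) + 3 + t0) O (draws bT bn :: K) s E.
Proof.
move=> hn hT hw dw hF; pose sa := nassign s 10 Z Z 0.
have fra : frame [:: 10; 11; 12; 24] [:: 4] s sa by exact: frame_nassign.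
have head : reach O 2 (draws bT bn :: K) s (draw_rows bT bn :: K) sa.
  by apply: (@reach_trans _ _ _ _ 1 1); apply: reach_step.
have -> : (size ws * (8 * n + 7) + 3 + t0 = 2 + (size ws * (8 * n + 7) + 1 + t0))%N by lia.
apply: le_trans (head E _); apply: (@draw_rows_Pr bT bn ws F t0 K E 0 sa hn hT (erefl _) _ dw).
  by move=> i p hi; rewrite add0n; apply: hw.
move=> x s' px [f1 f2 _ f4]; apply: hF => //.
exact: frame_trans fra f1.
Qed.

End Draws.

(** * Loop patterns and their specifications *)

Definition fsum v b a pre x :=
  FSeq (FR a Z Z (RNat Z)) (FFor v b (FSeq pre (FR a Z Z (RAdd (rvar a) x)))).

(** The test means [first iteration or strictly smaller], so that no infinite initial value is
    needed. *)
Definition fargmin v b ai av pre x :=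
  FFor v b (FSeq pre (FIf (BNot (BAnd (BNlt Z (var v)) (BNot (BRlt x (rvar av)))))
    (FSeq (FR av Z Z x) (FN ai Z Z (var v))) FSkip)).

Definition fntab v b a pre e := FFor v b (FSeq pre (FN a (var v) Z e)).

Definition frtab v b a pre x := FFor v b (FSeq pre (FR a (var v) Z x)).

Definition frtab2 v b v' b' a pre x :=
  FFor v b (FFor v' b' (FSeq pre (FR a (var v) (var v') x))).

Section Macros.
Variables (R : realType) (n k : nat) (O : oracles R n k).
Implicit Types (s : state R n k).

Lemma setv_neq v x s a : a != v -> nmem (setv v x s) a = nmem s a.
Proof. by move=> h; rewrite /= upd_neq. Qed.

Lemma fsum_val v b a pre x s N (F : 'I_N -> R) :
  nmem s 2 b 0 = N -> v \notin nwrites pre -> a \notin rwrites pre ->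
  (forall (i : 'I_N) s', frame (v :: nwrites pre) (a :: rwrites pre) s s' ->
     nmem s' v 0 0 = i -> reval (fsem O pre s') x = F i) ->
  rmem (fsem O (fsum v b a pre x) s) a 0 0 = \sum_i F i.
Proof.
move=> hN hv ha hF; set s0 := (fsem O (FR a Z Z (RNat Z)) s).
rewrite -[LHS]/(rmem (fsem O (FFor v b (FSeq pre (FR a Z Z (RAdd (rvar a) x)))) s0) a 0 0).
pose G (i : nat) : R := if insub i is Some j then F j else 0.
have -> : \sum_i F i = \sum_(i < N) G i.
  by apply: eq_bigr => i _; rewrite /G valK.
apply: (@for_ind _ _ _ O v b (FSeq pre (FR a Z Z (RAdd (rvar a) x))) s0 N
   (fun i s' => rmem s' a 0 0 = \sum_(j < i) G j)) => //=.
- by rewrite cats0.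
- by rewrite /upd !eqxx /= big_ord0.
move=> i s' [f1 f2] hi hs; rewrite /upd !eqxx /= fsem_r // hs big_ord_recr /=; congr (_ + _).
rewrite cats0 in f1; rewrite /G valK; apply: hF => //; split=> c hc; first by rewrite f1.
rewrite f2 ?mem_cat ?inE; last by move: hc; rewrite inE orbC.
by rewrite /s0 /= upd_neq //; apply: contraNneq hc => ->; rewrite mem_head.
Qed.

Lemma fargmin_val v b ai av pre x s N (F : 'I_N -> R) :
  nmem s 2 b 0 = N -> (0 < N)%N -> v != ai -> v \notin nwrites pre ->
  ai \notin nwrites pre -> av \notin rwrites pre ->
  (forall (i : 'I_N) s', frame (v :: ai :: nwrites pre) (av :: rwrites pre) s s' ->
     nmem s' v 0 0 = i -> reval (fsem O pre s') x = F i) ->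
  let s' := (fsem O (fargmin v b ai av pre x) s) in
  exists i, [/\ nmem s' ai 0 0 = val i, rmem s' av 0 0 = F i & forall j, F i <= F j].
Proof.
move=> hN N0 vai hv hai hav hF s'; rewrite {}/s' /fargmin; set c := FSeq pre _.
suff : (0 < N)%N -> exists i, [/\ nmem (fsem O (FFor v b c) s) ai 0 0 = val i,
    rmem (fsem O (FFor v b c) s) av 0 0 = F i & forall j : 'I_N, (j < N)%N -> F i <= F j].
  by move=> /(_ N0) [i [h1 h2 h3]]; exists i; split=> // j; apply: h3.
apply: (@for_ind _ _ _ O v b c s N (fun i s' => (0 < i)%N ->
   exists i0, [/\ nmem s' ai 0 0 = val i0, rmem s' av 0 0 = F i0 &
     forall j : 'I_N, (j < i)%N -> F i0 <= F j])) => //.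
  by rewrite /= mem_cat inE negb_or hv.
move=> i s' [f1 f2] hi hs _.
have fx : reval (fsem O pre s') x = F i.
  apply: hF => //; split=> a; rewrite !inE !negb_or.
    by case/and3P=> a1 a2 a3; apply: f1; rewrite /= inE mem_cat inE !negb_or a1 a2 a3.
  by case/andP=> a1 a2; apply: f2; rewrite /= mem_cat inE !negb_or a1 a2.
have pv : nmem (fsem O pre s') v 0 0 = i by rewrite fsem_n.
have pai : nmem (fsem O pre s') ai = nmem s' ai by rewrite fsem_n.
have pav : rmem (fsem O pre s') av = rmem s' av by rewrite fsem_r.
rewrite /c /= pv fx pav.
case: ifP => [better|worse].
  exists i; split.
  - by rewrite /= upd_neq 1?eq_sym // /upd !eqxx /=.
  - by rewrite /= /upd !eqxx.
  - move=> j; rewrite ltnS leq_eqVlt => /orP[/eqP/val_inj -> //|ji].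
    move: better; rewrite negb_and negbK -leqNgt leqn0 => /orP[/eqP i0|lt].
      by move: ji; rewrite i0.
    have [i0 [_ e h]] := hs (leq_ltn_trans (leq0n _) ji).
    by rewrite e in lt; apply: le_trans (ltW lt) (h j ji).
have i_gt0 : (0 < i)%N by move: worse; case: (0 < i)%N.
have [i0 [h1 h2 h3]] := hs i_gt0; exists i0; split.
- by rewrite /= upd_neq 1?eq_sym // pai.
- by rewrite /= pav.
- move=> j; rewrite ltnS leq_eqVlt => /orP[/eqP/val_inj ->|]; last exact: h3.
  by move: worse; rewrite i_gt0 /= => /negbFE; rewrite h2 -leNgt.
Qed.

(** A relation instead of a function, since an entry such as the index of a closest seed is
    specified only up to ties. *)
Lemma fntab_val v b a pre e s N (Q : 'I_N -> nat -> Prop) :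
  nmem s 2 b 0 = N -> v != a -> v \notin nwrites pre -> a \notin nwrites pre ->
  (forall (i : 'I_N) s', frame (v :: a :: nwrites pre) (rwrites pre) s s' ->
     nmem s' v 0 0 = i -> Q i (neval (fsem O pre s') e)) ->
  forall i : 'I_N, Q i (nmem (fsem O (fntab v b a pre e) s) a i 0).
Proof.
move=> hN va hv ha hQ i; rewrite /fntab; set c := FSeq pre _.
suff : forall j : 'I_N, (j < N)%N -> Q j (nmem (fsem O (FFor v b c) s) a j 0) by apply.
apply: (@for_ind _ _ _ O v b c s N (fun i s' => forall j : 'I_N, (j < i)%N ->
  Q j (nmem s' a j 0))) => //.
  by rewrite /= mem_cat inE negb_or hv.
move=> {}i s' [f1 f2] hi hs j.
have fx : Q i (neval (fsem O pre s') e).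
  apply: hQ => //; split=> d hd; [apply: f1|apply: f2]; rewrite /= ?cats0 //.
  by apply: contra hd; rewrite !inE mem_cat inE => /or3P[] ->; rewrite ?orbT.
have pv : nmem (fsem O pre s') v 0 0 = i by rewrite fsem_n.
rewrite /c /= pv upd_neq 1?eq_sym // /upd eqxx /= andbT.
rewrite ltnS leq_eqVlt; case: eqVneq => [/val_inj -> //|ne] /= lt.
by rewrite fsem_n //; apply: hs.
Qed.

Lemma frtab_val v b a pre x s N (F : 'I_N -> R) :
  nmem s 2 b 0 = N -> v \notin nwrites pre -> a \notin rwrites pre ->
  (forall (i : 'I_N) s', frame (v :: nwrites pre) (a :: rwrites pre) s s' ->
     nmem s' v 0 0 = i -> reval (fsem O pre s') x = F i) ->
  forall i : 'I_N, rmem (fsem O (frtab v b a pre x) s) a i 0 = F i.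
Proof.
move=> hN hv ha hF i; rewrite /frtab; set c := FSeq pre _.
suff : forall j : 'I_N, (j < N)%N -> rmem (fsem O (FFor v b c) s) a j 0 = F j by apply.
apply: (@for_ind _ _ _ O v b c s N (fun i s' => forall j : 'I_N, (j < i)%N ->
  rmem s' a j 0 = F j)) => //.
  by rewrite /= cats0.
move=> {}i s' [f1 f2] hi hs j.
have fx : reval (fsem O pre s') x = F i.
  apply: hF => //; split=> d hd; [apply: f1|apply: f2]; rewrite /= ?cats0 //.
  by apply: contra hd; rewrite !inE mem_cat inE orbC.
have pv : nmem (fsem O pre s') v 0 0 = i by rewrite fsem_n.
rewrite /c /= fx pv /upd eqxx /= andbT.
rewrite ltnS leq_eqVlt; case: eqVneq => [/val_inj -> //|ne] /= lt.
by rewrite fsem_r // hs.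
Qed.

Lemma frtab2_val v b v' b' a pre x s N N' (F : 'I_N -> 'I_N' -> R) :
  nmem s 2 b 0 = N -> nmem s 2 b' 0 = N' -> v != v' -> v \notin nwrites pre ->
  v' \notin nwrites pre -> a \notin rwrites pre ->
  2 != v -> 2 != v' -> 2 \notin nwrites pre ->
  (forall (i : 'I_N) (j : 'I_N') s',
     frame (v :: v' :: nwrites pre) (a :: rwrites pre) s s' ->
     nmem s' v 0 0 = i -> nmem s' v' 0 0 = j -> reval (fsem O pre s') x = F i j) ->
  forall i j, rmem (fsem O (frtab2 v b v' b' a pre x) s) a (val i) (val j) = F i j.
Proof.
move=> hN hN' vv' hv hv' ha v2 v2' p2 hF i0 j0; rewrite /frtab2; set c := FSeq pre _.
suff : forall (i : 'I_N) (j : 'I_N'), (i < N)%N -> rmem (fsem O (FFor v b (FFor v' b' c)) s) a i j = F i j.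
  by apply.
apply: (@for_ind _ _ _ O v b (FFor v' b' c) s N (fun i s' => forall (j : 'I_N) (l : 'I_N'),
  (j < i)%N -> rmem s' a j l = F j l)) => //.
  by rewrite /= cats0 inE negb_or vv' hv.
move=> i s1 f1 hi hs.
have h2 : nmem s1 2 b' 0 = N'.
  by case: f1 => -> //; rewrite !inE /= cats0 !negb_or v2 v2'.
(* Lexicographic invariant: rows before [i] are complete, and row [i] is filled up to the inner
   counter. *)
suff H : forall (j : 'I_N) (l : 'I_N'), (j < i)%N || ((j == i) && (l < N')%N) ->
    rmem (fsem O (FFor v' b' c) s1) a j l = F j l.
  move=> j l; rewrite ltnS leq_eqVlt => h; apply: H.
  by rewrite ltn_ord andbT orbC.
apply: (@for_ind _ _ _ O v' b' c s1 N' (fun i' s' => forall (j : 'I_N) (l : 'I_N'),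
   (j < i)%N || ((j == i) && (l < i')%N) -> rmem s' a j l = F j l)) => //.
- by rewrite /= cats0.
- by move=> j l; rewrite ltn0 andbF orbF; apply: hs.
move=> i' s2 f2 hi' hs2 j l.
have sv : nmem s2 v 0 0 = i.
  by case: f2 => -> //; rewrite /= cats0 inE negb_or vv' hv.
have fx : reval (fsem O pre s2) x = F i i'.
  have f12 : frame (v :: v' :: nwrites pre) (a :: rwrites pre) s s2.
    apply: (@frame_trans _ _ _ _ _ _ s1).
      apply: frame_sub f1 => d; rewrite /= ?cats0 //.
      by rewrite mem_cat !inE orbC.
    apply: frame_sub f2 => d; rewrite /= ?cats0.
      by rewrite !inE orbC => /orP[] ->; rewrite ?orbT.
    by rewrite mem_cat !inE orbC.
  exact: hF.
have pv : nmem (fsem O pre s2) v 0 0 = i by rewrite fsem_n.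
have pv' : nmem (fsem O pre s2) v' 0 0 = i' by rewrite fsem_n.
rewrite /c /= fx pv pv' /upd eqxx /= fsem_r // -val_eqE.
have [/val_inj -> /=|ji] := eqVneq (val j) (val i).
  have [/val_inj -> //|li] := eqVneq (val l) (val i').
  rewrite ltnn /= ltnS leq_eqVlt (negPf li) /= => lt; apply: hs2.
  by rewrite eqxx lt orbT.
by rewrite /= orbF => lt; apply: hs2; rewrite lt.
Qed.

End Macros.

Arguments fsem : simpl never.

(** * Programs for the rough solution *)

Definition rsqr x := RMul x x.

Definition dist_prog :=
  frtab2 13 0 14 0 2
    (fsum 15 2 20 FSkip (rsqr (RSub (RGet 0 (var 13) (var 15)) (RGet 0 (var 14) (var 15)))))
    (rvar 20).

Definition closest_seed vp seeds :=
  fargmin 17 3 34 22 FSkip (RGet 2 (var vp) (cell seeds (var 17))).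

(** Slots not yet filled contain 0 and act as copies of the first seed, so [closest_seed] may scan
    all slots at every stage. The farthest point minimizes the opposite of the distance. *)
Definition farthest_prog :=
  FSeq (FN 20 Z Z Z)
    (FFor 13 8 (FSeq (fargmin 14 0 33 21 (closest_seed 14 20) (RSub (RNat Z) (rvar 22)))
                     (FN 20 (NAdd (var 13) (NConst 1)) Z (var 33)))).

Definition swap_cost_prog :=
  FSeq (fntab 17 3 21 FSkip (cell 20 (var 17)))
    (FSeq (FN 21 (var 15) Z (var 16)) (fsum 18 0 25 (closest_seed 18 21) (rvar 22))).

Definition best_point_prog := fargmin 16 0 36 24 swap_cost_prog (rvar 25).

(** The scan over the seeds leaves in cell 36 the point found for the last seed tried;
    [best_point_prog] is therefore run again for the seed selected. *)
Definition local_search_prog :=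
  FFor 13 9 (FSeq (fargmin 15 3 35 23 best_point_prog (rvar 24))
    (FSeq (FN 15 Z Z (var 35)) (FSeq best_point_prog (FN 20 (var 35) Z (var 36))))).

Section Seeds.
Variables (R : realType) (r n k K : nat) (O : oracles R n k) (P : 'I_n -> 'rV[R]_r).
Implicit Types (s : state R n k) (B : 'I_K.+1 -> 'I_n).

Lemma fsem_seq c1 c2 s : fsem O (FSeq c1 c2) s = fsem O c2 (fsem O c1 s). Proof. by []. Qed.
Lemma fsem_nset a i j e s :
  fsem O (FN a i j e) s = nassign s a i j (neval s e). Proof. by []. Qed.
Lemma fsem_if b c1 c2 s :
  fsem O (FIf b c1 c2) s = if beval s b then fsem O c1 s else fsem O c2 s. Proof. by []. Qed.

Lemma dist_val s : nmem s 2 0 0 = n -> nmem s 2 2 0 = r ->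
  (forall (p : 'I_n) (c : 'I_r), rmem s 0 p c = P p 0 c) ->
  forall p q : 'I_n, rmem (fsem O dist_prog s) 2 p q = sqdist (P p) (P q).
Proof.
move=> hn hr hP.
apply: (@frtab2_val _ _ _ O 13 0 14 0 2 _ _ s n n (fun p q => sqdist (P p) (P q))) => //.
move=> p q s1 [f1 f2] hp hq /=.
apply: (@fsum_val _ _ _ O 15 2 20 FSkip _ s1 r) => //; first by rewrite f1.
move=> c s2 [g1 g2] hc; rewrite /= hc !g1 // hp hq g2 // f2 // !hP.
by rewrite expr2.
Qed.

Definition seed_data s := [/\ nmem s 2 0 0 = n, nmem s 2 3 0 = K.+1 &
  forall p q : 'I_n, rmem s 2 p q = sqdist (P p) (P q)].

Definition holds_seeds a s B := forall b : 'I_K.+1, nmem s a b 0 = B b.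

Lemma seed_data_frame wn wr s s' : 2 \notin wn -> 2 \notin wr ->
  frame wn wr s s' -> seed_data s -> seed_data s'.
Proof. by move=> h1 h2 [f1 f2] [d1 d2 d3]; split; rewrite ?f1 ?f2. Qed.

Lemma closest_seed_val vp a s B (p : 'I_n) :
  vp \notin [:: 17; 34] -> a \notin [:: 17; 34] ->
  seed_data s -> holds_seeds a s B -> nmem s vp 0 0 = p ->
  let s' := fsem O (closest_seed vp a) s in
  (exists b : 'I_K.+1, nmem s' 34 0 0 = b /\
     forall b', sqdist (P p) (P (B b)) <= sqdist (P p) (P (B b'))) /\
  rmem s' 22 0 0 = sqdist (P p) (P (B (nearest P B p))).
Proof.
rewrite !inE !negb_or => /andP[v1 v2] /andP[a1 a2] [d1 d2 d3] hB hp s'.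
have [|b [h1 h2 h3]] := @fargmin_val _ _ _ O 17 3 34 22 FSkip
  (RGet 2 (var vp) (cell a (var 17))) s K.+1 (fun b => sqdist (P p) (P (B b))) d2 isT isT isT isT isT.
  move=> b s1 [f1 f2] hb; rewrite /= hb f1 ?inE ?negb_or ?v1 ?v2 // hp.
  by rewrite f1 ?inE ?negb_or ?a1 ?a2 // hB f2 // d3.
split; first by exists b.
by rewrite /s' h2; apply/le_anti/andP; split; [exact: h3|exact: (nearest_le P B p b)].
Qed.

Lemma farthest_val s : (0 < n)%N -> seed_data s -> nmem s 2 8 0 = K ->
  (forall i, nmem s 20 i 0 = 0%N) ->
  exists B, holds_seeds 20 (fsem O farthest_prog s) B /\ farthest_first P B.
Proof.
move=> n0 ds hK h20; rewrite fsem_seq; set s0 := fsem O (FN 20 Z Z Z) s.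
have f0 : frame [:: 20] [::] s s0 by exact: (frame_fsem O (FN 20 Z Z Z) s).
have hs0 i : nmem s0 20 i 0 = 0%N.
  by rewrite /s0 fsem_nset /= /upd /= andbT; case: eqP.
have ds0 : seed_data s0 by apply: seed_data_frame f0 ds.
pose p0 := Ordinal n0; set c := FSeq _ _.
suff [B [h1 _ _ h2]] : exists B, [/\ holds_seeds 20 (fsem O (FFor 13 8 c) s0) B,
    B ord0 = p0, forall b : 'I_K.+1, (K < b)%N -> B b = p0 &
    forall (a b : 'I_K.+1) p, (a < b)%N -> (b <= K)%N ->
      exists d : 'I_K.+1, (d <= K)%N /\ sqdist (P p) (P (B d)) <= sqdist (P (B b)) (P (B a))].
  exists B; split=> // a b p ab; have [|d [_ hd]] := h2 a b p ab; last by exists d.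
  by rewrite -ltnS.
apply: (@for_ind _ _ _ O 13 8 c s0 K (fun t s' => exists B, [/\ holds_seeds 20 s' B, B ord0 = p0,
    (forall b : 'I_K.+1, (t < b)%N -> B b = p0) &
    forall (a b : 'I_K.+1) p, (a < b)%N -> (b <= t)%N ->
      exists d : 'I_K.+1, (d <= t)%N /\ sqdist (P p) (P (B d)) <= sqdist (P (B b)) (P (B a))])) => //.
  exists (fun=> p0); split=> // [b|a b p ab]; first by rewrite setv_neq // hs0.
  by rewrite leqn0 => /eqP b0; rewrite b0 in ab.
move=> t s1 f1 ht [B [hB hB0 hz hfar]].
have ds1 : seed_data s1 by apply: seed_data_frame f1 ds0.
have hn1 : nmem s1 2 0 0 = n by case: ds1.
pose fa := fargmin 14 0 33 21 (closest_seed 14 20) (RSub (RNat Z) (rvar 22)).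
have fr : frame (nwrites fa) (rwrites fa) s1 (fsem O fa s1) by exact: (frame_fsem O fa s1).
have [|i [h1 _ h3]] := @fargmin_val _ _ _ O 14 0 33 21 (closest_seed 14 20)
  (RSub (RNat Z) (rvar 22)) s1 n
  (fun p => 0 - sqdist (P p) (P (B (nearest P B p)))) hn1 n0 isT isT isT isT.
  move=> p s2 f2 hp /=.
  have ds2 : seed_data s2 by apply: seed_data_frame f2 ds1.
  have hB2 : holds_seeds 20 s2 B by case: f2 => f2 _ b; rewrite f2.
  by have [_ ->] := @closest_seed_val 14 20 _ _ _ isT isT ds2 hB2 hp.
have tK : (t.+1 < K.+1)%N by rewrite ltnS.
pose t1 := Ordinal tK.
exists (fun b => if b == t1 then i else B b); split.
- move=> b; rewrite setv_neq // /c fsem_seq -/fa fsem_nset /= /upd /= andbT h1.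
  case: fr => fr _; rewrite !fr // ht addn1 -(val_eqE b t1) /=.
  by case: eqP => // _; apply: hB.
- by [].
- move=> b tb; case: eqP => [e|_]; first by move: tb; rewrite e /= ltnn.
  by apply: hz; exact: ltnW.
- move=> a b p ab bt.
  have a1 : a != t1 by rewrite -val_eqE /= neq_ltn (leq_trans ab bt).
  have le_old (d : 'I_K.+1) : (d <= t)%N -> d != t1 by move=> h; rewrite -val_eqE /= neq_ltn ltnS h.
  rewrite (negPf a1).
  have [e|ne] := eqVneq b t1; last first.
    have bt' : (b <= t)%N by rewrite -ltnS ltn_neqAle ne bt.
    have [d [hd1 hd2]] := hfar a b p ab bt'.
    by exists d; rewrite (negPf (le_old _ hd1)) leqW.
  have hd : sqdist (P p) (P (B (nearest P B p))) <= sqdist (P i) (P (B a)).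
    by apply: le_trans (nearest_le P B i a); have := h3 p; lra.
  have [d1|d1] := leqP (nearest P B p) t.
    by exists (nearest P B p); rewrite (negPf (le_old _ d1)) leqW.
  (* The closest slot is not filled yet, hence holds a copy of the first seed. *)
  by exists ord0; split; rewrite //= hB0 -(hz _ d1).
Qed.

Lemma swap_cost_val s B (a : 'I_K.+1) (i : 'I_n) : seed_data s -> holds_seeds 20 s B ->
  nmem s 15 0 0 = a -> nmem s 16 0 0 = i ->
  rmem (fsem O swap_cost_prog s) 25 0 0 = seed_cost P (swap B a i).
Proof.
move=> ds hB ha hi; rewrite !fsem_seq; set c1 := fntab _ _ _ _ _.
set s1 := fsem O c1 s; have F1 : frame [:: 17; 21] [::] s s1 := frame_fsem O c1 s; have [f1 _] := F1.
have hB1 : holds_seeds 21 s1 B.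
  apply: (@fntab_val _ _ _ O 17 3 21 FSkip (cell 20 (var 17)) s K.+1 (fun b x => x = B b)) => //.
    by case: ds.
  by move=> b s2 [f2 _] hb; rewrite /= hb f2 // hB.
have ds1 : seed_data s1 by apply: seed_data_frame F1 ds.
set s2 := fsem O (FN _ _ _ _) s1.
have F2 : frame [:: 21] [::] s1 s2 := frame_fsem O (FN 21 (var 15) Z (var 16)) s1.
have ds2 : seed_data s2 by apply: seed_data_frame F2 ds1.
have hB2 : holds_seeds 21 s2 (swap B a i).
  move=> b; rewrite /s2 fsem_nset /= /upd /= andbT (f1 15) // (f1 16) // ha hi /swap -(val_eqE b a).
  by case: eqP => // _; apply: hB1.
apply: (@fsum_val _ _ _ O 18 0 25 (closest_seed 18 21)) => //; first by case: ds2.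
move=> p s3 F3 hp /=; have [f3 _] := F3.
have ds3 : seed_data s3 by apply: seed_data_frame F3 ds2.
have hB3 : holds_seeds 21 s3 (swap B a i) by move=> b; rewrite f3.
by have [_ ->] := @closest_seed_val 18 21 _ _ _ isT isT ds3 hB3 hp.
Qed.

Lemma best_point_val s B (a : 'I_K.+1) : (0 < n)%N -> seed_data s -> holds_seeds 20 s B ->
  nmem s 15 0 0 = a ->
  let s' := fsem O best_point_prog s in
  exists i : 'I_n, [/\ nmem s' 36 0 0 = i, rmem s' 24 0 0 = seed_cost P (swap B a i) &
    forall j, seed_cost P (swap B a i) <= seed_cost P (swap B a j)].
Proof.
move=> n0 ds hB ha.
apply: (@fargmin_val _ _ _ O 16 0 36 24 swap_cost_prog (rvar 25) s n
  (fun i => seed_cost P (swap B a i))) => //; first by case: ds.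
move=> i s1 F1 hi; have [f1 _] := F1; apply: swap_cost_val => //; last by rewrite f1.
  by apply: seed_data_frame F1 ds.
by move=> b; rewrite f1.
Qed.

Lemma local_search_val s B (X : R) T : (0 < n)%N -> (0 < k)%N -> 0 <= X ->
  seed_data s -> holds_seeds 20 s B -> nmem s 2 9 0 = T -> (2 * k * n <= T)%N ->
  (forall B, exists a i, 2 * k%:R * seed_cost P (swap B a i) <=
              (2 * k%:R - 1) * seed_cost P B + 120 * X) ->
  seed_cost P B <= 2 * n%:R * X ->
  exists B', holds_seeds 20 (fsem O local_search_prog s) B' /\ seed_cost P B' <= 122 * X.
Proof.
move=> n0 k0 X0 ds hB hT leT improve init.
suff [B' [h1 h2]] : exists B', holds_seeds 20 (fsem O local_search_prog s) B' /\
   (seed_cost P B' - 120 * X) * (2 * k%:R + T%:R) <= 4 * n%:R * k%:R * X.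
  by exists B'; split=> //; apply: local_search_bound h2.
rewrite /local_search_prog; set c := FSeq _ _.
apply: (@for_ind _ _ _ O 13 9 c s T (fun t s' => exists B', holds_seeds 20 s' B' /\
   (seed_cost P B' - 120 * X) * (2 * k%:R + t%:R) <= 4 * n%:R * k%:R * X)) => //.
  exists B; split=> //; rewrite addr0.
  have k1 : 0 <= 2 * k%:R :> R by rewrite mulr_ge0.
  have := ler_wpM2r k1 init; have := mulr_ge0 k1 X0; lra.
move=> t s1 f1 ht [B1 [hB1 hc]].
have ds1 : seed_data s1 by apply: seed_data_frame f1 ds.
have hK1 : nmem s1 2 3 0 = K.+1 by case: ds1.
rewrite /c !fsem_seq; set c1 := fargmin _ _ _ _ _ _; set s2 := fsem O c1 s1.
have f2 : frame (nwrites c1) (rwrites c1) s1 s2 := frame_fsem O c1 s1.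
have [|a [a1 _ a3]] := @fargmin_val _ _ _ O 15 3 35 23 best_point_prog (rvar 24) s1 K.+1
  (fun a => seed_cost P (swap B1 a
     [arg min_(i < Ordinal n0) seed_cost P (swap B1 a i)]%O)) hK1 isT isT isT isT isT.
  move=> a s3 f3 ha.
  have ds3 : seed_data s3 by apply: seed_data_frame f3 ds1.
  have hB3 : holds_seeds 20 s3 B1 by case: f3 => f3 _ b; rewrite f3.
  have [i [_ e h]] := best_point_val n0 ds3 hB3 ha; rewrite /= e.
  apply/le_anti/andP; split; first exact: h.
  by case: arg_minP => // j _; apply.
have ds2 : seed_data s2 by apply: seed_data_frame f2 ds1.
have hB2 : holds_seeds 20 s2 B1 by case: f2 => f2 _ b; rewrite f2.
set s3 := fsem O (FN 15 Z Z (var 35)) s2.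
have f3 : frame [:: 15] [::] s2 s3 := frame_fsem O (FN 15 Z Z (var 35)) s2.
have ds3 : seed_data s3 by apply: seed_data_frame f3 ds2.
have hB3 : holds_seeds 20 s3 B1 by case: f3 => f3 _ b; rewrite f3.
have ha3 : nmem s3 15 0 0 = a by rewrite /s3 fsem_nset.
have [i [i1 _ i3]] := best_point_val n0 ds3 hB3 ha3.
set s4 := fsem O best_point_prog s3 in i1 i3 *.
have f4 : frame (nwrites best_point_prog) (rwrites best_point_prog) s3 s4.
  exact: (frame_fsem O best_point_prog s3).
exists (swap B1 a i); split.
  move=> b; rewrite setv_neq // fsem_nset /= /upd /= andbT i1.
  case: f4 => f4 _; case: f3 => f3 _; rewrite !f4 // !f3 // a1 /swap -(val_eqE b a).
  by case: eqP => // _; apply: hB2.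
have best : forall a' i', seed_cost P (swap B1 a i) <= seed_cost P (swap B1 a' i').
  move=> a' i'; apply: le_trans (i3 _) (le_trans (a3 a') _).
  by case: arg_minP => // j _; apply.
have [a' [i' h]] := improve B1.
apply: local_search_decay hc => //; apply: le_trans h.
by apply: ler_wpM2l => //; rewrite mulr_ge0.
Qed.

End Seeds.

(** * Sampling weights of the points *)

Section SeedWeights.
Variables (R : realFieldType) (n k K : nat) (y : 'I_n -> R) (slot : 'I_n -> 'I_K).

Definition cell_card b : R := \sum_p (slot p == b)%:R.

(** Over all points the first terms add up to at most 1 and the second ones to the number of
    nonempty cells, so normalizing costs a factor of at most 3k. When the total cost is 0 the first
    term is 0, as division by 0 yields 0. *)
Definition raw_weight p := y p / (\sum_p y p) + 1 / cell_card (slot p).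

Definition seed_weight p := raw_weight p / \sum_p raw_weight p.

Hypotheses (n0 : (0 < n)%N) (y_ge0 : forall p, 0 <= y p) (K_le : (K < 3 * k)%N).

Lemma cell_cardE b : cell_card b = #|[set p | slot p == b]|%:R.
Proof. by rewrite /cell_card -natr_sum -big_mkcond /= sum1dep_card. Qed.

Let cell_gt0 p : 0 < cell_card (slot p).
Proof. by rewrite cell_cardE ltr0n card_gt0; apply/finset.set0Pn; exists p; rewrite inE. Qed.

Let Y_ge0 : 0 <= \sum_p y p. Proof. exact: sumr_ge0. Qed.

Let raw_gt0 p : 0 < raw_weight p.
Proof. by rewrite ltr_wpDl ?divr_gt0 // divr_ge0. Qed.

Let tot_gt0 : 0 < \sum_p raw_weight p.
Proof. by rewrite (bigD1 (Ordinal n0)) //= ltr_wpDr // sumr_ge0 // => p _; exact: ltW. Qed.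

Let tot_le : \sum_p raw_weight p <= 3 * k%:R.
Proof.
rewrite big_split /=; apply: (@le_trans _ _ (1 + K%:R)); last first.
  by move: K_le; rewrite -(ler_nat R) natrM -natr1 addrC.
apply: lerD.
  rewrite -mulr_suml; have [->|ne] := eqVneq (\sum_p y p) 0; first by rewrite mul0r.
  by rewrite divff.
rewrite (partition_big slot predT) //= -[leRHS]mulr1 -sum_const_ord.
apply: ler_sum => b _; have [b0|b0] := eqVneq (cell_card b) 0.
  rewrite big_pred0 // => p; apply/negbTE/eqP => e.
  by have := cell_gt0 p; rewrite e b0 ltxx.
rewrite (eq_bigr (fun=> 1 / cell_card b)) => [|p /eqP -> //].
rewrite -mulr_suml ler_pdivrMr; last by rewrite lt_def b0 cell_cardE ler0n.
by rewrite mul1r /cell_card big_mkcond /=; apply: ler_sum => p _; case: ifP.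
Qed.

Lemma distr_seed_weight : distr seed_weight.
Proof.
split=> [p|]; first by rewrite divr_ge0 // ltW.
by rewrite -mulr_suml divff // gt_eqF.
Qed.

Let weight_ge p : raw_weight p <= 3 * k%:R * seed_weight p.
Proof.
rewrite /seed_weight mulrA ler_pdivlMr // mulrC; apply: ler_wpM2r => //; exact: ltW.
Qed.

Lemma seed_weight_cost p : y p <= 3 * k%:R * (\sum_p y p) * seed_weight p.
Proof.
have [Y0|ne] := eqVneq (\sum_p y p) 0.
  have := Y0 => /eqP; rewrite psumr_eq0 // => /allP /(_ p (mem_index_enum _)) /= /eqP ->.
  by rewrite Y0 mulr0 mul0r.
have Y0 : 0 < \sum_p y p by rewrite lt_def ne.
rewrite mulrAC -ler_pdivrMr //; apply: le_trans (weight_ge p).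
by rewrite lerDl divr_ge0 // ltW.
Qed.

Lemma seed_weight_cell p :
  1 <= 3 * k%:R * #|[set p' | slot p' == slot p]|%:R * seed_weight p.
Proof.
rewrite -cell_cardE mulrAC -ler_pdivrMr //; apply: le_trans (weight_ge p).
by rewrite lerDr divr_ge0.
Qed.

End SeedWeights.

Notation NEq x y := (BAnd (BNot (BNlt x y)) (BNot (BNlt y x))).
Notation rone := (RNat (NConst 1)).

Definition slot_prog := fntab 13 0 22 (closest_seed 13 20) (var 34).

Definition gap_prog := frtab 13 0 3 FSkip (RGet 2 (var 13) (cell 20 (cell 22 (var 13)))).

Definition gap_sum_prog := fsum 13 0 26 FSkip (RGet 3 (var 13) Z).

Definition cell_prog :=
  frtab 13 3 12
    (fsum 14 0 27 (FIf (NEq (cell 22 (var 14)) (var 13)) (FR 28 Z Z rone) (FR 28 Z Z (RNat Z)))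
       (rvar 28))
    (rvar 27).

Definition raw_prog :=
  frtab 13 0 5 FSkip
    (RAdd (RDiv (RGet 3 (var 13) Z) (rvar 26)) (RDiv rone (RGet 12 (cell 22 (var 13)) Z))).

Definition raw_sum_prog := fsum 13 0 29 FSkip (RGet 5 (var 13) Z).

Definition weight_prog := frtab 13 0 13 FSkip (RDiv (RGet 5 (var 13) Z) (rvar 29)).

Definition rows_prog :=
  frtab2 13 6 14 0 6
    (FIf (BNlt (var 13) (cell 2 (NConst 1)))
      (FIf (BNlt (var 14) (NAdd (var 13) (NConst 1)))
         (FR 28 Z Z (RDiv rone (RNat (NAdd (var 13) (NConst 1)))))
         (FR 28 Z Z (RNat Z)))
      (FIf (BNlt (var 13) (NAdd (cell 2 (NConst 1)) (cell 2 (NConst 4))))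
         (FR 28 Z Z (RGet 13 (var 14) Z))
         (FR 28 Z Z (RDiv rone (RNat (cell 2 Z))))))
    (rvar 28).

Definition weights_prog :=
  FSeq slot_prog (FSeq gap_prog (FSeq gap_sum_prog (FSeq cell_prog
    (FSeq raw_prog (FSeq raw_sum_prog (FSeq weight_prog rows_prog)))))).

Section Weights.
Variables (R : realType) (r n k K : nat) (O : oracles R n k) (P : 'I_n -> 'rV[R]_r).
Implicit Types (s : state R n k) (B : 'I_K.+1 -> 'I_n).

Lemma NEqP s x y : beval s (NEq x y) = (neval s x == neval s y).
Proof. by rewrite /= -!leqNgt eqn_leq andbC. Qed.

(** The three blocks serve the shuffle, the centers, and finally learning and validation
    together. *)
Definition draw_weights (q : 'I_n -> R) N T : seq ('I_n -> R) :=
  mkseq (@row_upto R n) k ++ nseq N q ++ nseq T (@uniform R n).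

(** [slot] is the closest seed retained by the program; on ties it may differ from [nearest], but
    not in distance. *)
Lemma weights_val s B N T : seed_data K P s -> holds_seeds 20 s B ->
  nmem s 2 1 0 = k -> nmem s 2 4 0 = N -> nmem s 2 6 0 = (k + (N + T))%N ->
  let s' := fsem O weights_prog s in
  exists slot : 'I_n -> 'I_K.+1,
    let y p := sqdist (P p) (P (B (slot p))) in
    [/\ forall p, y p = sqdist (P p) (P (B (nearest P B p))),
        forall p : 'I_n, rmem s' 13 p 0 = seed_weight y slot p &
        forall i (p : 'I_n), (i < k + (N + T))%N ->
          rmem s' 6 i p = nth (fun=> 0) (draw_weights (seed_weight y slot) N T) i p].
Proof.
move=> ds hB hk hN hT; have [hn hK hD] := ds; rewrite /weights_prog 7!fsem_seq.
set s1 := fsem O slot_prog s; have F1 := frame_fsem O slot_prog s; rewrite -/s1 in F1.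
have [f1 g1] := F1.
have /boolp.choice[slot hslot] : forall p : 'I_n, exists b : 'I_K.+1, nmem s1 22 p 0 = b /\
     forall b', sqdist (P p) (P (B b)) <= sqdist (P p) (P (B b')).
  apply: (@fntab_val _ _ _ O 13 0 22 (closest_seed 13 20) (var 34) s n
    (fun p x => exists b : 'I_K.+1, x = b /\
       forall b', sqdist (P p) (P (B b)) <= sqdist (P p) (P (B b')))) => //.
  move=> p s' F' hp; have [f' _] := F'.
  have ds' : seed_data K P s' by apply: seed_data_frame F' ds.
  have hB' : holds_seeds 20 s' B by move=> b; rewrite f'.
  by have [] := @closest_seed_val _ _ _ _ _ O P 13 20 s' B p isT isT ds' hB' hp.
exists slot; pose y p := sqdist (P p) (P (B (slot p))).
have yE p : y p = sqdist (P p) (P (B (nearest P B p))).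
  by apply/le_anti/andP; split; [case: (hslot p) => _|exact: (nearest_le P B p (slot p))].
have hs1 p : nmem s1 22 (val p) 0 = slot p by case: (hslot p).
set s2 := fsem O gap_prog s1; have [f2 g2] := frame_fsem O gap_prog s1; rewrite -/s2 in f2 g2.
have hy p : rmem s2 3 (val p) 0 = y p.
  apply: (@frtab_val _ _ _ O 13 0 3) => //; first by rewrite f1.
  by move=> i s' [f' g'] hi; rewrite /= hi (f' 22) // hs1 (f' 20) // (f1 20) // hB g' // g1 // hD.
set s3 := fsem O gap_sum_prog s2; have [f3 g3] := frame_fsem O gap_sum_prog s2.
rewrite -/s3 in f3 g3.
have hY : rmem s3 26 0 0 = \sum_p y p.
  apply: (@fsum_val _ _ _ O 13 0 26) => //; first by rewrite f2 // f1.
  by move=> i s' [f' g'] hi; rewrite /= hi g' // hy.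
set s4 := fsem O cell_prog s3; have [f4 g4] := frame_fsem O cell_prog s3; rewrite -/s4 in f4 g4.
have hc b : rmem s4 12 (val b) 0 = cell_card R slot b.
  apply: (@frtab_val _ _ _ O 13 3 12) => //; first by rewrite f3 // f2 // f1.
  move=> i s' [f' g'] hi; apply: (@fsum_val _ _ _ O 14 0 27) => //.
    by rewrite f' // f3 // f2 // f1.
  move=> p s'' [f'' g''] hp; rewrite fsem_if NEqP /= hp f'' // f' // f3 // f2 // hs1.
  rewrite f'' // hi -(val_eqE (slot p) i); case: eqP => _; by rewrite /fsem /= /upd.
set s5 := fsem O raw_prog s4; have [f5 g5] := frame_fsem O raw_prog s4; rewrite -/s5 in f5 g5.
have hu p : rmem s5 5 (val p) 0 = raw_weight y slot p.
  apply: (@frtab_val _ _ _ O 13 0 5) => //; first by rewrite f4 // f3 // f2 // f1.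
  move=> i s' [f' g'] hi; rewrite /= hi (f' 22) // (f4 22) // (f3 22) // (f2 22) // hs1.
  by rewrite (g' 12) // hc (g' 3) // (g4 3) // (g3 3) // hy (g' 26) // (g4 26) // hY.
set s6 := fsem O raw_sum_prog s5; have [f6 g6] := frame_fsem O raw_sum_prog s5.
rewrite -/s6 in f6 g6.
have ht : rmem s6 29 0 0 = \sum_p raw_weight y slot p.
  apply: (@fsum_val _ _ _ O 13 0 29) => //; first by rewrite f5 // f4 // f3 // f2 // f1.
  by move=> i s' [f' g'] hi; rewrite /= hi g' // hu.
set s7 := fsem O weight_prog s6; have [f7 g7] := frame_fsem O weight_prog s6.
rewrite -/s7 in f7 g7.
have hq p : rmem s7 13 (val p) 0 = seed_weight y slot p.
  apply: (@frtab_val _ _ _ O 13 0 13) => //; first by rewrite f6 // f5 // f4 // f3 // f2 // f1.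
  by move=> i s' [f' g'] hi; rewrite /= hi (g' 5) // (g6 5) // hu (g' 29) // ht.
set s8 := fsem O rows_prog s7; have [f8 g8] := frame_fsem O rows_prog s7.
rewrite -/s8 in f8 g8.
have h2 : nmem s7 2 = nmem s 2 by rewrite f7 // f6 // f5 // f4 // f3 // f2 // f1.
split=> // [p|i p iT]; first by rewrite g8 // hq.
apply: (@frtab2_val _ _ _ O 13 6 14 0 6 _ _ s7 (k + (N + T)) n
  (fun i p => nth (fun=> 0) (draw_weights (seed_weight y slot) N T) i p)
  _ _ _ _ _ _ _ _ _ _ (Ordinal iT) p); rewrite ?h2 //.
move=> {iT}i' {}p s' [f' g'] hi hp; rewrite !fsem_if /= hi hp f' // h2 hk hN {i}.
move: i' hi => i hi.
rewrite /draw_weights nth_cat size_mkseq; case: ltnP => ik.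
  rewrite nth_mkseq // /row_upto addn1; case: ifP => _; rewrite /fsem /= /upd /= ?hi ?mul1r ?addn1 //.
rewrite nth_cat size_nseq ltn_subLR //; case: ifP => iN.
  by rewrite nth_nseq ltn_subLR // iN /fsem /= /upd /= hp g' // hq.
rewrite nth_nseq ltn_subLR; last by rewrite leq_subRL // leqNgt iN.
rewrite ltn_subLR // ltn_ord /fsem /= /upd /= f' // h2 hn mul1r //.
Qed.

End Weights.

(** * Labels from same-cluster queries *)

Section Discovery.
Variable k : nat.
Implicit Types (u : seq 'I_k).

Fixpoint discovered (c : nat -> 'I_k) t : seq 'I_k :=
  if t is t'.+1 then
    let u := discovered c t' in if c t' \in u then u else rcons u (c t')
  else [::].

Lemma discovered_uniq (c : nat -> 'I_k) t : uniq (discovered c t).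
Proof. by elim: t => //= t IH; case: ifP => // h; rewrite rcons_uniq h. Qed.

Lemma mem_discovered (c : nat -> 'I_k) t i : (i < t)%N -> c i \in discovered c t.
Proof.
elim: t => //= t IH; rewrite ltnS leq_eqVlt => /orP[/eqP ->|/IH h].
  by case: ifP => // _; rewrite mem_rcons mem_head.
by case: ifP => // _; rewrite mem_rcons inE h orbT.
Qed.

Lemma index_discovered (c : nat -> 'I_k) t i : (i < t)%N ->
  index (c i) (discovered c t.+1) = index (c i) (discovered c t).
Proof.
move=> /mem_discovered h /=; case: ifP => // _.
by rewrite -cats1 index_cat h.
Qed.

Lemma size_uniq_ord u : uniq u -> (size u <= k)%N.
Proof. by move=> /card_uniqP <-; rewrite -[leqRHS]card_ord max_card. Qed.

Lemma extend_rank u : uniq u -> exists s : 'S_k, forall c, c \in u -> s c = index c u :> nat.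
Proof.
move=> uu; pose v := u ++ [seq c <- enum 'I_k | c \notin u].
have mv c : c \in v by rewrite mem_cat mem_filter mem_enum andbT orbN.
have uv : uniq v.
  rewrite cat_uniq uu filter_uniq ?enum_uniq // andbT.
  by apply/hasPn => c; rewrite mem_filter => /andP[].
have lt c : (index c v < k)%N by apply: leq_trans (size_uniq_ord uv); rewrite index_mem.
have inj : injective (fun c => Ordinal (lt c)).
  by move=> c d [] /(congr1 (nth c v)); rewrite !nth_index.
by exists (perm inj) => c cu; rewrite permE /= /v index_cat cu.
Qed.

(** Clusters never drawn have no rank of discovery, hence the choice of any permutation that extends
    the ranks. *)
Definition rank_perm u : 'S_k :=
  odflt 1%g [pick s : 'S_k | [forall c, (c \in u) ==> (s c == index c u :> nat)]].

Lemma rank_permP u c : uniq u -> c \in u -> rank_perm u c = index c u :> nat.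
Proof.
move=> uu cu; rewrite /rank_perm; case: pickP => [s /forallP /(_ c)|].
  by rewrite cu => /eqP.
have [s hs] := extend_rank uu; move=> /(_ s) /negbT; rewrite negb_forall.
by case/existsP => d; rewrite negb_imply => /andP[/hs ->]; rewrite eqxx.
Qed.

End Discovery.

(** Cell 31 is set beforehand to the number of known clusters and keeps that value when no
    representative matches, which signals a new cluster. At most [k] queries are spent per point. *)
Definition find_prog x :=
  FFor 14 1 (FIf (BNlt (var 14) (var 28))
    (FSeq (FQuery 32 Z Z x (cell 27 (var 14)))
          (FIf (BNlt Z (var 32)) (FN 31 Z Z (var 14)) FSkip))
    FSkip).

(* The cluster of the point [x] is identified by querying [x] against one
   representative (array 27) of each cluster found so far; clusters are numbered
   in order of discovery, and array 25 turns these numbers into labels. *)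
Definition label_prog b x dst :=
  FFor 13 b
    (FSeq (FN 31 Z Z (var 28))
    (FSeq (find_prog x)
    (FSeq (FIf (BNlt (var 31) (var 28)) FSkip
             (FSeq (FN 27 (var 28) Z x) (FN 28 Z Z (NAdd (var 28) (NConst 1)))))
          (FN dst (var 13) Z (cell 25 (var 31)))))).

Definition shuffle_prog :=
  FFor 13 1 (FSeq (FN 37 Z Z (cell 25 (var 13)))
    (FSeq (FN 25 (var 13) Z (cell 25 (cell 24 (var 13))))
          (FN 25 (cell 24 (var 13)) Z (var 37)))).

Section Labels.
Variables (R : realType) (n k : nat) (O : oracles R n k) (f : 'I_n -> 'I_k).
Hypothesis OP : forall p q, same_cluster O p q = (f p == f q).
Implicit Types (s : state R n k) (u : seq 'I_k).

Definition reps_ok s u := [/\ nmem s 28 0 0 = size u, uniq u &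
  forall i, (i < size u)%N -> exists p : 'I_n, nmem s 27 i 0 = p /\ forall c, f p = nth c u i].

Lemma find_val x s u (p : 'I_n) :
  nmem s 2 1 0 = k -> reps_ok s u ->
  (forall s', frame [:: 14; 32; 31] [::] s s' -> neval s' x = p) ->
  nmem s 31 0 0 = size u ->
  let s' := fsem O (find_prog x) s in
  [/\ nmem s' 31 0 0 = index (f p) u, (queries s' <= queries s + k)%N & sample s' = sample s].
Proof.
move=> hk [h28 uu hr] hx h31 s'; rewrite {}/s' /find_prog; set c := FIf _ _ _.
set id := index (f p) u.
suff [h1 h2 h3] : [/\ nmem (fsem O (FFor 14 1 c) s) 31 0 0 = (if (id < k)%N then id else size u),
    (queries (fsem O (FFor 14 1 c) s) <= queries s + k)%N &
    sample (fsem O (FFor 14 1 c) s) = sample s].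
  split=> //; rewrite h1; case: ltnP => // ki.
  apply/eqP; rewrite eqn_leq (leq_trans (size_uniq_ord uu) ki) /=.
  exact: index_size.
apply: (@for_ind _ _ _ O 14 1 c s k (fun i s' =>
  [/\ nmem s' 31 0 0 = (if (id < i)%N then id else size u),
    (queries s' <= queries s + i)%N & sample s' = sample s])) => //.
  by split=> //=; rewrite addn0.
move=> i s1 F1 hi [h1 h2 h3]; have [f1 _] := F1.
have n28 : nmem s1 28 0 0 = size u by rewrite f1.
rewrite /c fsem_if /= hi n28; case: ltnP => iu; last first.
  split=> //; last by rewrite addnS leqW.
  rewrite /upd /= h1; have ids : (id <= size u)%N by exact: index_size.
  case: (ltnP id i) => idi; first by rewrite ltnS (ltnW idi).
  rewrite ltnS; case: leqP => // idi'; apply/eqP.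
  by rewrite eqn_leq ids (leq_trans iu idi) .
have [q [hq1 hq2]] := hr i iu.
have hxq : neval s1 x = p.
  by apply: hx; apply: frame_sub F1 => a //; rewrite /c /= !inE => /or3P[] ->; rewrite ?orbT.
have hqv : neval s1 (cell 27 (var 14)) = q by rewrite /= hi f1.
rewrite fsem_seq fsem_if.
have -> : fsem O (FQuery 32 Z Z x (cell 27 (var 14))) s1 =
   State (upd (nmem s1) 32 0 0 (f p == f q)) (rmem s1) (sample s1) (queries s1).+1.
  by rewrite /fsem /do_query hxq hqv !valK OP.
have eqid : (f p == f q) = (id == i).
  rewrite (hq2 (f p)); apply/eqP/eqP => [e|e].
    by rewrite /id e index_uniq.
  by rewrite -e nth_index // -index_mem -/id e.
rewrite eqid /=; set s2 := if _ then _ else _.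
have e2 : s2 = State (if id == i then upd (upd (nmem s1) 32 0 0 (id == i)) 31 0 0 i
    else upd (nmem s1) 32 0 0 (id == i)) (rmem s1) (sample s1) (queries s1).+1.
  rewrite /s2; case: eqP => _ //=; rewrite fsem_nset /nassign /set_nmem /=.
  by rewrite /upd /= hi.
rewrite e2 /= ; split; [|by rewrite addnS ltnS|by []].
rewrite ltnS leq_eqVlt; case: eqP => [e|ne] /=; first by rewrite /upd /= e.
by rewrite /upd /= h1.
Qed.

(** A number once given is not affected by later discoveries ([index_discovered]), so one
    permutation, that of the complete list, describes all the labels. *)
Lemma label_val b x dst (xs : nat -> 'I_n) T s :
  nmem s 2 1 0 = k -> nmem s 2 b 0 = T -> nmem s 28 0 0 = 0%N ->
  dst \notin [:: 2; 13; 14; 25; 27; 28; 31; 32] ->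
  (forall (t : 'I_T) s', frame [:: 13; 14; 27; 28; 31; 32; dst] [::] s s' ->
     nmem s' 13 0 0 = t -> neval s' x = xs t) ->
  let s' := fsem O (label_prog b x dst) s in
  [/\ forall t, (t < T)%N ->
        nmem s' dst t 0 = nmem s 25 (rank_perm (discovered (f \o xs) T) (f (xs t))) 0,
      (queries s' <= queries s + T * k)%N & sample s' = sample s].
Proof.
move=> hk hb h28 hdst hx s'; rewrite {}/s' /label_prog; set c := FSeq _ _.
have dneq a : a \in [:: 2; 13; 14; 25; 27; 28; 31; 32] -> dst != a.
  by move=> h; apply: contraNneq hdst => ->.
have dneq' a : a \in [:: 2; 13; 14; 25; 27; 28; 31; 32] -> a != dst.
  by move=> h; rewrite eq_sym dneq.
have d2 := dneq 2 isT; have d13 := dneq 13 isT; have d14 := dneq 14 isT.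
have d25 := dneq 25 isT; have d27 := dneq 27 isT; have d28 := dneq 28 isT.
have d31 := dneq 31 isT; have d32 := dneq 32 isT.
pose U := discovered (f \o xs).
suff [h1 h2 h3 h4] : [/\ reps_ok (fsem O (FFor 13 b c) s) (U T),
    forall t, (t < T)%N -> nmem (fsem O (FFor 13 b c) s) dst t 0 =
                           nmem s 25 (index (f (xs t)) (U T)) 0,
    (queries (fsem O (FFor 13 b c) s) <= queries s + T * k)%N &
    sample (fsem O (FFor 13 b c) s) = sample s].
  split=> // t tT; rewrite h2 // rank_permP //; first exact: discovered_uniq.
  exact: (@mem_discovered _ (f \o xs)).
apply: (@for_ind _ _ _ O 13 b c s T (fun t s' =>
  [/\ reps_ok s' (U t),
    forall t', (t' < t)%N -> nmem s' dst t' 0 = nmem s 25 (index (f (xs t')) (U t)) 0,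
    (queries s' <= queries s + t * k)%N & sample s' = sample s])) => //.
- by rewrite /= !inE !negb_or /= dneq'.
- by split=> //=; rewrite mul0n addn0.
move=> t s1 F1 ht [hr hl hq hs]; have [f1 _] := F1.
have fr_of s2 : frame [:: 13; 14; 27; 28; 31; 32; dst] [::] s1 s2 ->
    nmem s2 13 0 0 = t -> neval s2 x = xs t.
  move=> F2; apply: hx; apply: frame_trans F2; apply: frame_sub F1 => a //=.
  by rewrite !inE; do ?[case/orP]; move=> ->; rewrite ?orbT.
have [r28 ruu rr] := hr.
rewrite /c !fsem_seq; set s2 := fsem O (FN 31 Z Z (var 28)) s1.
have F2 : frame [:: 31] [::] s1 s2 := frame_fsem O (FN 31 Z Z (var 28)) s1.
have [f2 _] := F2.
have sub2 : {subset [:: 31] <= [:: 13; 14; 27; 28; 31; 32; dst]}.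
  by move=> a; rewrite !inE => ->; rewrite ?orbT.
have hk2 : nmem s2 2 1 0 = k by rewrite f2 // f1 //= !inE !negb_or /= dneq'.
have hr2 : reps_ok s2 (U t) by split; rewrite ?f2.
have hx2 s3 : frame [:: 14; 32; 31] [::] s2 s3 -> neval s3 x = xs t.
  move=> F3; apply: fr_of.
    apply: frame_trans (frame_sub sub2 _ F2) _ => //; apply: frame_sub F3 => a //.
    by rewrite !inE => /or3P[] ->; rewrite ?orbT.
  by case: F3 => f3 _; rewrite f3 // f2.
have h31 : nmem s2 31 0 0 = size (U t) by rewrite /s2 fsem_nset /= /upd /= r28.
have [i1 i2 i3] := find_val hk2 hr2 hx2 h31.
set s3 := fsem O (find_prog x) s2 in i1 i2 i3 *.
have F3 : frame [:: 14; 32; 31] [::] s2 s3 := frame_fsem O (find_prog x) s2.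
have [f3 _] := F3.
have hxs3 : neval s3 x = xs t by exact: hx2.
have e28 : nmem s3 28 0 0 = size (U t) by rewrite f3 // f2.
rewrite fsem_if /= i1 e28; set cond := (_ < _)%N.
have condE : cond = (f (xs t) \in U t) by rewrite /cond index_mem.
set s4 := if cond then _ else _.
have q4 : queries s4 = queries s3 /\ sample s4 = sample s3 by rewrite /s4; case: (cond).
have e4 : nmem s4 13 0 0 = t /\ nmem s4 31 0 0 = index (f (xs t)) (U t) /\
    nmem s4 25 = nmem s 25 /\ nmem s4 dst = nmem s1 dst.
  have : frame [:: 27; 28] [::] s3 s4.
    rewrite /s4; case: (cond); first exact: frame_refl.
    exact: (frame_fsem O (FSeq (FN 27 (var 28) Z x) (FN 28 Z Z (NAdd (var 28) (NConst 1)))) s3).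
  move=> [f4 _]; split; first by rewrite f4 // f3 // f2.
  split; first by rewrite f4 // i1.
  split; first by rewrite f4 // f3 // f2 // f1 //= !inE !negb_or /= dneq'.
  by rewrite f4 ?f3 ?f2 // !inE ?negb_or ?d27 ?d28 ?d14 ?d32 ?d31.
have r4 : reps_ok s4 (U t.+1).
  rewrite /s4 /U /= -/U condE; case: ifP => mem.
    by split; rewrite ?f3 ?f2.
  rewrite fsem_seq !fsem_nset; split; first by rewrite size_rcons /= /upd /= e28 addn1.
    by rewrite rcons_uniq mem ruu.
  move=> i; rewrite size_rcons ltnS leq_eqVlt => /orP[/eqP ->|lt].
    exists (xs t); split; first by rewrite /= /upd /= e28 eqxx hxs3.
    by move=> d; rewrite nth_rcons ltnn eqxx.
  have [p [hp1 hp2]] := rr i lt; exists p; split.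
    rewrite /= /upd /= e28; case: eqP => [e|_]; first by rewrite e ltnn in lt.
    by rewrite f3 // f2.
  by move=> d; rewrite nth_rcons lt.
have [e13 [e31 [e25 edst]]] := e4.
rewrite fsem_nset /setv /nassign; split.
- have [r1 r2 r3] := r4; split=> //=; first by rewrite upd_neq // upd_neq // eq_sym.
  move=> i hi; have [p [hp1 hp2]] := r3 i hi; exists p; split=> //.
  by rewrite upd_neq // upd_neq // eq_sym.
- move=> t'; rewrite ltnS leq_eqVlt /= upd_neq // /upd eqxx /= e13 andbT.
  case: eqP => [-> _|ne] /=.
    rewrite e25 e31 /U /= -/U; congr (nmem s 25 _ 0); case: ifP => // h.
    by rewrite -cats1 index_cat h /= eqxx addn0 memNindex // h.
  move=> lt; rewrite edst hl //.
  by rewrite (@index_discovered _ (f \o xs)).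
- rewrite /= q4.1 mulSn addnCA addnC; apply: leq_trans i2 _; rewrite leq_add2r.
  exact: hq.
- by rewrite /= q4.2 i3.
Qed.

(** Exchanging two entries of the array precomposes it with a transposition, as [fisher_yates]
    does. *)
Lemma shuffle_val (i0 : 'I_k) (x : seq nat) s :
  nmem s 2 1 0 = k -> (forall i : 'I_k, nmem s 25 i 0 = i) ->
  (forall t : 'I_k, nmem s 24 t 0 = nth 0%N x t) -> (forall t : 'I_k, (nth 0%N x t < k)%N) ->
  forall i : 'I_k, nmem (fsem O shuffle_prog s) 25 i 0 = fisher_yates i0 x k i.
Proof.
move=> hk hi hX hlt; rewrite /shuffle_prog; set c := FSeq _ _.
apply: (@for_ind _ _ _ O 13 1 c s k (fun t s' => forall i : 'I_k,
  nmem s' 25 i 0 = fisher_yates i0 x t i)) => //.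
  by move=> i; rewrite setv_neq // hi perm1.
move=> t s1 [f1 _] ht hp i; rewrite /c !fsem_seq !fsem_nset setv_neq //=.
have ot : ord_at i0 t = t by apply: val_inj; rewrite val_insubd ltn_ord.
have vx : val (ord_at i0 (nth 0%N x t)) = nth 0%N x t by rewrite val_insubd hlt.
set j := ord_at i0 (nth 0%N x t) in vx *.
rewrite permM ot -hp /upd /= ht (f1 24) // hX -vx !andbT.
case: tpermP => [->|->|/eqP h1 /eqP h2].
- by rewrite eqxx; case: eqP => [e|_] //; rewrite -e.
- by rewrite eqxx.
- by rewrite !val_eqE (negPf h1) (negPf h2).
Qed.

End Labels.

(** * From labeled draws to the output *)

Notation draw_at e := (cell 24 (NAdd (cell 2 (NConst 1)) e)).

Definition if_label x := FIf (NEq (cell 26 (var 14)) (var 13)) (FR 28 Z Z x) (FR 28 Z Z (RNat Z)).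

Definition label_weight_prog :=
  frtab 13 1 7 (fsum 14 4 20 (if_label (RDiv rone (RGet 13 (draw_at (var 14)) Z))) (rvar 28)) (rvar 20).

Definition center_prog :=
  frtab2 13 1 15 2 9
    (fsum 14 4 20 (if_label (RDiv (RGet 0 (draw_at (var 14)) (var 15))
                                  (RGet 13 (draw_at (var 14)) Z))) (rvar 28))
    (RDiv (rvar 20) (RGet 7 (var 13) Z)).

Definition center_dist_prog :=
  frtab2 13 0 14 1 10
    (fsum 15 2 20 FSkip (rsqr (RSub (RGet 0 (var 13) (var 15)) (RGet 9 (var 14) (var 15)))))
    (rvar 20).

Definition near_prog :=
  fntab 13 0 23 (fargmin 17 1 34 22 FSkip (RGet 10 (var 13) (var 17))) (var 34).

Definition phi_prog := frtab 13 0 11 FSkip (RGet 10 (var 13) (cell 23 (var 13))).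

Definition phi_sum_prog := fsum 13 0 30 FSkip (RGet 11 (var 13) Z).

Notation off1 := (cell 2 (NConst 4)).
Notation off2 := (NAdd off1 (cell 2 (NConst 5))).
Notation off3 := (NAdd off2 (cell 2 (NConst 5))).

Definition learn_prog off a :=
  FSeq FClear (FSeq
    (FFor 13 5 (FLabel (draw_at (NAdd off (var 13))) (cell 26 (NAdd off (var 13)))))
    (FLearn a)).

Definition mistakes_prog h acc :=
  fsum 13 4 acc (FIf (NEq (cell h (draw_at (NAdd off3 (var 13)))) (cell 26 (NAdd off3 (var 13))))
                  (FR 28 Z Z (RNat Z)) (FR 28 Z Z rone)) (rvar 28).

Definition output_prog :=
  fntab 13 0 1
    (FSeq (FIf (BRlt (rvar 32) (rvar 31)) (FN 38 Z Z (cell 30 (var 13))) (FN 38 Z Z (cell 29 (var 13))))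
      (FIf (BRlt (RAdd (RGet 11 (var 13) Z)
                       (RDiv (RMul (rvar 1) (rvar 30)) (RMul (RNat (NConst 4)) (RNat (cell 2 Z)))))
                 (RGet 10 (var 13) (var 38)))
        (FN 39 Z Z (cell 23 (var 13))) (FN 39 Z Z (var 38))))
    (var 39).

Definition finish_prog :=
  FSeq label_weight_prog (FSeq center_prog (FSeq center_dist_prog (FSeq near_prog
  (FSeq phi_prog (FSeq phi_sum_prog (FSeq (learn_prog off1 29) (FSeq (learn_prog off2 30)
  (FSeq (mistakes_prog 29 31) (FSeq (mistakes_prog 30 32) output_prog))))))))).

Section Finish.
Variables (R : realType) (r n k : nat) (O : oracles R n k) (P : 'I_n -> 'rV[R]_r).
Variables (q : 'I_n -> R) (g : kclustering n k) (eps : R) (N M : nat) (x : nat -> 'I_n).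
Implicit Types (s : state R n k).

Definition sample_part a b := [seq x t | t <- iota a b].

Lemma sum_sample_part a b (Q : pred 'I_n) (F : 'I_n -> R) :
  \sum_(p <- sample_part a b | Q p) F p = \sum_(t < b | Q (x (a + t)%N)) F (x (a + t)%N).
Proof.
rewrite /sample_part big_map -[a in iota a _]addn0 iotaDl big_map.
by have -> : iota 0 b = index_iota 0 b by [rewrite /index_iota subn0]; rewrite big_mkord.
Qed.

(** [g] is the relabeled optimum behind the recorded labels, known to the program on the drawn
    points only. The offset [k] skips the draws spent on the shuffle. *)
Definition ready s := [/\ [/\ nmem s 2 0 0 = n, nmem s 2 1 0 = k, nmem s 2 2 0 = r,
      nmem s 2 4 0 = N & nmem s 2 5 0 = M],
    forall (p : 'I_n) (c : 'I_r), rmem s 0 p c = P p 0 c, rmem s 1 0 0 = eps,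
    forall p : 'I_n, rmem s 13 p 0 = q p &
    forall t, (t < N + M + M + N)%N ->
      nmem s 24 (k + t)%N 0 = x t /\ nmem s 26 t 0 = g (x t)].

Lemma ready_frame wn wr s s' : all (fun a => a \notin wn) [:: 2; 24; 26] ->
  all (fun a => a \notin wr) [:: 0; 1; 13] -> frame wn wr s s' -> ready s -> ready s'.
Proof.
move=> /and4P[h1 h2 h3 _] /and4P[h4 h5 h6 _] [f1 f2] [[a1 a2 a3 a4 a5] b1 b2 b3 b4].
by split; [split|..]; rewrite ?f1 ?f2.
Qed.

Lemma label_weight_val s : ready s -> forall j : 'I_k,
  rmem (fsem O label_weight_prog s) 7 j 0 = sample_weight g q (sample_part 0 N) j.
Proof.
move=> rs; have [[hn hk hr hN hM] hP heps hq hx] := rs.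
apply: (@frtab_val _ _ _ O 13 1 7) => // j s1 F1 hj.
have rs1 : ready s1 by apply: ready_frame F1 rs.
have [[_ hk1 _ hN1 _] _ _ hq1 hx1] := rs1.
rewrite /sample_weight sum_sample_part [RHS]big_mkcond /=.
apply: (@fsum_val _ _ _ O 14 4 20) => // t s2 F2 ht.
have rs2 : ready s2 by apply: ready_frame F2 rs1.
have [[_ hk2 _ _ _] _ _ hq2 hx2] := rs2.
have [hX hl] : nmem s2 24 (k + t)%N 0 = x t /\ nmem s2 26 t 0 = g (x t).
  by apply: hx2; have := ltn_ord t; lia.
have [f2 _] := F2.
rewrite fsem_if NEqP /= ht hl f2 // hj add0n -(val_eqE (g (x t)) j) /=.
by case: eqP => _; rewrite /fsem /= /upd //= ht hk2 hX hq2 mul1r.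
Qed.

Lemma center_val s : ready s ->
  (forall j : 'I_k, rmem s 7 j 0 = sample_weight g q (sample_part 0 N) j) ->
  forall (j : 'I_k) (c : 'I_r),
  rmem (fsem O center_prog s) 9 j c = sample_center P g q (sample_part 0 N) j 0 c.
Proof.
move=> rs hW; have [[hn hk hr hN hM] hP heps hq hx] := rs.
apply: (@frtab2_val _ _ _ O 13 1 15 2 9 _ _ s k r
  (fun j c => sample_center P g q (sample_part 0 N) j 0 c)) => // j c s1 F1 hj hc.
have rs1 : ready s1 by apply: ready_frame F1 rs.
have [[_ hk1 _ hN1 _] hP1 _ hq1 hx1] := rs1.
rewrite mxE summxE sum_sample_part mulrC.
set F := fsum _ _ _ _ _.
have [f g'] := frame_fsem O F s1; have [f1 g1] := F1.
rewrite /= (f 13) // hj (g' 7) // (g1 7) // hW; congr (_ / _); rewrite [RHS]big_mkcond /=.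
apply: (@fsum_val _ _ _ O 14 4 20) => // t s2 F2 ht.
have rs2 : ready s2 by apply: ready_frame F2 rs1.
have [[_ hk2 _ _ _] hP2 _ hq2 hx2] := rs2.
have [hX hl] : nmem s2 24 (k + t)%N 0 = x t /\ nmem s2 26 t 0 = g (x t).
  by apply: hx2; have := ltn_ord t; lia.
have [f2 _] := F2.
rewrite fsem_if NEqP /= ht hl (f2 13) // hj add0n -(val_eqE (g (x t)) j) /=.
case: eqP => _; rewrite /fsem /= /upd //= ht hk2 hX (f2 15) // hc hq2 hP2 mxE mulrC //.
Qed.

Lemma center_dist_val s (cen : 'I_k -> 'rV[R]_r) : ready s ->
  (forall (j : 'I_k) (c : 'I_r), rmem s 9 j c = cen j 0 c) ->
  forall (p : 'I_n) (j : 'I_k), rmem (fsem O center_dist_prog s) 10 p j = sqdist (P p) (cen j).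
Proof.
move=> rs hC; have [[hn hk hr hN hM] hP heps hq hx] := rs.
apply: (@frtab2_val _ _ _ O 13 0 14 1 10 _ _ s n k (fun p j => sqdist (P p) (cen j))) => //.
move=> p j s1 [f1 g1] hp hj.
apply: (@fsum_val _ _ _ O 15 2 20) => //; first by rewrite f1.
move=> c s2 [f2 g2] hc; rewrite /= hc !f2 // hp hj !g2 // !g1 // hP hC.
by rewrite expr2.
Qed.

Lemma learn_val s off (o : nat) a : ready s ->
  (forall s', ready s' -> neval s' off = o) -> (o + M <= N + M + M + N)%N ->
  a \notin [:: 2; 24; 26] ->
  forall p : 'I_n, nmem (fsem O (learn_prog off a) s) a p 0 =
    learned O [seq (p, g p) | p <- sample_part o M] p.
Proof.
move=> rs hoff oM an p; rewrite !fsem_seq; set s1 := fsem O FClear s.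
set c := FLabel _ _.
suff hs : sample (fsem O (FFor 13 5 c) s1) = [seq (p, g p) | p <- sample_part o M].
  by rewrite {1}/fsem /= eqxx /= valK -hs.
have rs1 : ready s1 by [].
apply: (@for_ind _ _ _ O 13 5 c s1 M (fun i s' =>
  sample s' = [seq (p, g p) | p <- sample_part o i])) => //.
  by case: rs => [[]].
move=> i s2 F2 hi hs.
have rs2 : ready s2 by apply: ready_frame F2 rs1.
have [[_ hk2 _ _ _] hP2 _ hq2 hx2] := rs2.
have [hX hl] : nmem s2 24 (k + (o + i))%N 0 = x (o + i)%N /\ nmem s2 26 (o + i)%N 0 = g (x (o + i)%N).
  by apply: hx2; have := ltn_ord i; lia.
have -> : sample_part o i.+1 = rcons (sample_part o i) (x (o + i)%N).
  by rewrite /sample_part -[i.+1]addn1 iotaD map_cat cats1.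
rewrite map_rcons -hs.
by rewrite /c /fsem /do_label /= hi (hoff _ rs2) hk2 hX hl !valK.
Qed.

Lemma mistakes_val s (h : 'I_n -> 'I_k) a acc : ready s ->
  (forall p : 'I_n, nmem s a p 0 = h p) -> a != 13 -> acc \notin [:: 0; 1; 13; 28] ->
  rmem (fsem O (mistakes_prog a acc) s) acc 0 0 = mistakes R g h (sample_part (N + M + M) N).
Proof.
move=> rs ha a13; rewrite !inE !negb_or => /and4P[acc0 acc1 acc13 acc28].
have [[hn hk hr hN hM] hP heps hq hx] := rs.
rewrite /mistakes sum_sample_part.
apply: (@fsum_val _ _ _ O 13 4 acc) => //=.
  by rewrite !inE negb_or acc28.
move=> t s1 F1 ht; have rs1 : ready s1.
  apply: ready_frame F1 rs => //=.
  by rewrite !inE !negb_or ![_ == acc]eq_sym acc0 acc1 acc13.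
have [[_ hk1 _ hN1 hM1] _ _ hq1 hx1] := rs1; have [f1 _] := F1.
have [hX hl] : nmem s1 24 (k + (N + M + M + t))%N 0 = x (N + M + M + t)%N /\
    nmem s1 26 (N + M + M + t)%N 0 = g (x (N + M + M + t)%N).
  by apply: hx1; have := ltn_ord t; lia.
rewrite fsem_if NEqP /= ht hk1 hN1 hM1 hX hl f1 ?inE // ha.
by rewrite -(val_eqE (h _)) /=; case: eqP => _; rewrite /fsem /= /upd.
Qed.

Let c := sample_center P g q (sample_part 0 N).
Let h1 p := learned O [seq (p, g p) | p <- sample_part N M] p.
Let h2 p := learned O [seq (p, g p) | p <- sample_part (N + M) M] p.
Let h := select R g h1 h2 (sample_part (N + M + M) N).

(** Provides, whatever the draws, the premises of [combine] about [phi] and the output; the quality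
    of the centers and of the hypothesis is left to the probabilistic part. *)
Lemma finish_val s : ready s -> (0 < k)%N -> 0 <= eps ->
  exists g' : kclustering n k, exists phi : 'I_n -> R,
  let tau := eps * (\sum_p phi p) / (4 * n%:R) in
  [/\ outputs (fsem O finish_prog s) g',
      (forall p j, phi p <= sqdist (P p) (c j)) /\
      (forall p, exists j, phi p = sqdist (P p) (c j)),
      forall p, sqdist (P p) (c (g' p)) <= phi p + tau &
      forall p, sqdist (P p) (c (h p)) <= phi p + tau -> g' p = h p].
Proof.
move=> rs k0 eps0; rewrite /finish_prog 10!fsem_seq.
set s1 := fsem O label_weight_prog s.
have F1 := frame_fsem O label_weight_prog s; rewrite -/s1 in F1.
have rs1 : ready s1 by apply: ready_frame F1 rs.
have hW : forall j : 'I_k, rmem s1 7 j 0 = sample_weight g q (sample_part 0 N) j.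
  exact: label_weight_val.
set s2 := fsem O center_prog s1.
have F2 := frame_fsem O center_prog s1; rewrite -/s2 in F2.
have rs2 : ready s2 by apply: ready_frame F2 rs1.
have hC : forall (j : 'I_k) (d : 'I_r), rmem s2 9 j d = c j 0 d by exact: center_val.
set s3 := fsem O center_dist_prog s2.
have F3 := frame_fsem O center_dist_prog s2; rewrite -/s3 in F3.
have rs3 : ready s3 by apply: ready_frame F3 rs2.
have hE : forall (p : 'I_n) (j : 'I_k), rmem s3 10 p j = sqdist (P p) (c j).
  exact: center_dist_val.
set s4 := fsem O near_prog s3.
have F4 := frame_fsem O near_prog s3; rewrite -/s4 in F4; have [f4 g4] := F4.
have rs4 : ready s4 by apply: ready_frame F4 rs3.
have /boolp.choice[near hnear] : forall p : 'I_n, exists j : 'I_k, nmem s4 23 p 0 = j /\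
     forall j', sqdist (P p) (c j) <= sqdist (P p) (c j').
  have [[hn hk _ _ _] _ _ _ _] := rs3.
  apply: (@fntab_val _ _ _ O 13 0 23 (fargmin 17 1 34 22 FSkip (RGet 10 (var 13) (var 17)))
    (var 34) s3 n (fun p x => exists j : 'I_k, x = j /\
       forall j', sqdist (P p) (c j) <= sqdist (P p) (c j'))) => //.
  move=> p s' [f' g'] hp.
  have [||j [j1 _ j3]] := @fargmin_val _ _ _ O 17 1 34 22 FSkip (RGet 10 (var 13) (var 17)) s' k
    (fun j => sqdist (P p) (c j)) _ k0 isT isT isT isT.
  - by rewrite f'.
  - by move=> j s'' [f'' g''] hj; rewrite /= hj f'' // hp g'' // g' // hE.
  by exists j.
pose phi p := sqdist (P p) (c (near p)).
set s5 := fsem O phi_prog s4.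
have F5 := frame_fsem O phi_prog s4; rewrite -/s5 in F5; have [f5 g5] := F5.
have rs5 : ready s5 by apply: ready_frame F5 rs4.
have hphi p : rmem s5 11 (val p) 0 = phi p.
  apply: (@frtab_val _ _ _ O 13 0 11) => //; first by case: rs4 => [[]].
  move=> i s' [f' g'] hi; rewrite /= hi (f' 23) // (hnear i).1 (g' 10) // g4 // hE //.
set s6 := fsem O phi_sum_prog s5.
have F6 := frame_fsem O phi_sum_prog s5; rewrite -/s6 in F6; have [f6 g6] := F6.
have rs6 : ready s6 by apply: ready_frame F6 rs5.
have hPhi : rmem s6 30 0 0 = \sum_p phi p.
  apply: (@fsum_val _ _ _ O 13 0 30) => //; first by case: rs5 => [[]].
  by move=> i s' [f' g'] hi; rewrite /= hi g' // hphi.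
set s7 := fsem O (learn_prog off1 29) s6.
have F7 := frame_fsem O (learn_prog off1 29) s6; rewrite -/s7 in F7; have [f7 g7] := F7.
have rs7 : ready s7 by apply: ready_frame F7 rs6.
have hh1 : forall p : 'I_n, nmem s7 29 p 0 = h1 p.
  by apply: (learn_val (o := N)) => // [s' [[]]|]; rewrite -?addnA ?leq_add2l ?leq_addr.
set s8 := fsem O (learn_prog off2 30) s7.
have F8 := frame_fsem O (learn_prog off2 30) s7; rewrite -/s8 in F8; have [f8 g8] := F8.
have rs8 : ready s8 by apply: ready_frame F8 rs7.
have hh2 : forall p : 'I_n, nmem s8 30 p 0 = h2 p.
  apply: (learn_val (o := N + M)) => // [s' [[_ _ _ a1 a2] _ _ _ _]|]; first by rewrite /= a1 a2.
  by rewrite leq_addr.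
set s9 := fsem O (mistakes_prog 29 31) s8.
have F9 := frame_fsem O (mistakes_prog 29 31) s8; rewrite -/s9 in F9; have [f9 g9] := F9.
have rs9 : ready s9 by apply: ready_frame F9 rs8.
have hm1 : rmem s9 31 0 0 = mistakes R g h1 (sample_part (N + M + M) N).
  by apply: mistakes_val => // p; rewrite f8 // hh1.
set s10 := fsem O (mistakes_prog 30 32) s9.
have F10 := frame_fsem O (mistakes_prog 30 32) s9; rewrite -/s10 in F10; have [f10 g10] := F10.
have rs10 : ready s10 by apply: ready_frame F10 rs9.
have hm2 : rmem s10 32 0 0 = mistakes R g h2 (sample_part (N + M + M) N).
  by apply: mistakes_val => // p; rewrite f9 // hh2.
set tau := eps * (\sum_p phi p) / (4 * n%:R).
have /boolp.choice[g' hg'] : forall p : 'I_n, exists j : 'I_k,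
    [/\ nmem (fsem O output_prog s10) 1 p 0 = j, sqdist (P p) (c j) <= phi p + tau &
      sqdist (P p) (c (h p)) <= phi p + tau -> j = h p].
  have [[hn hk _ _ _] _ heps _ _] := rs10.
  apply: (@fntab_val _ _ _ O 13 0 1 _ (var 39) s10 n (fun p x => exists j : 'I_k,
    [/\ x = j, sqdist (P p) (c j) <= phi p + tau &
      sqdist (P p) (c (h p)) <= phi p + tau -> j = h p])) => //.
  move=> p s' [f' g''] hp; rewrite fsem_seq; set t1 := fsem O (FIf _ _ _) s'.
  have [u1 v1] : frame [:: 38; 38] [::] s' t1.
    exact: (frame_fsem O (FIf (BRlt (rvar 32) (rvar 31)) (FN 38 Z Z (cell 30 (var 13)))
              (FN 38 Z Z (cell 29 (var 13)))) s').
  have h38 : nmem t1 38 0 0 = h p.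
    rewrite /t1 fsem_if /= g'' // hm2 g'' // g10 // hm1 /h /select; case: ifP => _.
      by rewrite fsem_nset /= /upd /= hp f' // f10 // f9 // hh2.
    by rewrite fsem_nset /= /upd /= hp f' // f10 // f9 // f8 // hh1.
  have h11 : rmem t1 11 p 0 = phi p.
    by rewrite v1 // g'' // g10 // g9 // g8 // g7 // g6 // hphi.
  have h30 : rmem t1 30 0 0 = \sum_p phi p.
    by rewrite v1 // g'' // g10 // g9 // g8 // g7 // hPhi.
  have h10 (j : 'I_k) : rmem t1 10 p j = sqdist (P p) (c j).
    by rewrite v1 // g'' // g10 // g9 // g8 // g7 // g6 // g5 // g4 // hE.
  have h1' : rmem t1 1 0 0 = eps by rewrite v1 // g'' // heps.
  have h2' : nmem t1 2 0 0 = n by rewrite u1 // f' // hn.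
  have h13 : nmem t1 13 0 0 = p by rewrite u1 // hp.
  have h23 : nmem t1 23 p 0 = near p.
    by rewrite u1 // f' // f10 // f9 // f8 // f7 // f6 // f5 // (hnear p).1.
  have Phi0 : 0 <= \sum_p phi p by apply: sumr_ge0 => i _; exact: sqdist_ge0.
  rewrite fsem_if /= h13 h11 h1' h30 h2' h38 h10 -/tau; case: ltP => hlt.
    exists (near p); split; first by rewrite fsem_nset /= /upd /= h13 h23.
      by rewrite -/(phi p) lerDl divr_ge0 // mulr_ge0.
    by [].
  by exists (h p); split=> //; rewrite fsem_nset /= /upd /= h38.
exists [ffun p => g' p], phi; split.
- move=> p; have [e _ _] := hg' p. apply: (etrans e).
  by congr (val _); rewrite ffunE.
- split=> [p j|p]; [have [_ e] := hnear p; exact: e|by exists (near p)].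
- by move=> p; rewrite ffunE; have [_ e _] := hg' p; exact: e.
- by move=> p; rewrite ffunE; have [_ _ e] := hg' p; exact: e.
Qed.

End Finish.

(** * Parameters, loop bounds and the complete program *)

Fixpoint loop_free (c : fcom) : bool :=
  match c with
  | FSeq c1 c2 | FIf _ c1 c2 => loop_free c1 && loop_free c2
  | FFor _ _ _ => false
  | _ => true
  end.

(** For the programs that write array 2, which [compileP] excludes: without loops no bound is
    read. *)
Lemma compile_loop_free (R : realType) n k (O : oracles R n k) c s K :
  loop_free c -> reach O (steps c 0) (compile c :: K) s K (fsem O c s).
Proof.
elim: c s K => //=; try by move=> *; apply: reach_step.
- move=> c1 IH1 c2 IH2 s K /andP[l1 l2]; rewrite -add1n.
  apply: reach_trans; first by apply: reach_step.
  by apply: reach_trans; [exact: IH1|exact: IH2].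
- move=> b c1 IH1 c2 IH2 s K /andP[l1 l2]; rewrite -add1n.
  apply: reach_trans; first by apply: reach_step.
  rewrite fsem_if; case: ifP => _.
    by apply: reach_leq (IH1 _ _ l1); rewrite leq_addr.
  by apply: reach_leq (IH2 _ _ l2); rewrite leq_addl.
Qed.

Fixpoint rpow (x : rexp) (i : nat) : rexp := if i is i'.+1 then RMul x (rpow x i') else rone.

Lemma reval_rpow (R : realType) n k (s : state R n k) x i : reval s (rpow x i) = reval s x ^+ i.
Proof. by elim: i => //= i ->; rewrite exprS. Qed.

Notation set_bound i e := (FN 2 (NConst i) Z e).

Definition sizes_prog :=
  FSeq (set_bound 0 (cell 0 Z))
  (FSeq (set_bound 1 (cell 0 (NConst 2)))
  (FSeq (set_bound 2 (cell 0 (NConst 1)))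
  (FSeq (set_bound 8 (NAdd (cell 0 (NConst 2)) (cell 0 (NConst 2))))
        (set_bound 3 (NAdd (NAdd (cell 0 (NConst 2)) (cell 0 (NConst 2))) (NConst 1)))))).

Notation eps_exp := (rvar 1).
Notation delta_exp := (RGet 1 (NConst 1) Z).
Notation k_exp := (RNat (cell 2 (NConst 1))).

(** The factor 10^9 exceeds the 4 * 10^8 that brings the bound of [good_centers_Pr] below delta / 4,
    and the 64 of [select_Pr]. *)
Definition sample_bound_exp :=
  RDiv (RMul (rpow (RNat (NConst 10)) 9) (rpow k_exp 3)) (RMul (rpow eps_exp 2) delta_exp).

(** Rounds up by counting, as the machine cannot convert reals to naturals. Stopping at [n] is
    harmless: sampling is then replaced by exhaustive labeling. *)
Definition count_prog :=
  FFor 13 0 (FIf (BRlt (RNat (var 3)) sample_bound_exp) (FN 3 Z Z (NAdd (var 3) (NConst 1))) FSkip).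

(** The product n (2k + 1) by repeated addition, at least the 2kn swaps of [local_search_bound]. *)
Definition swaps_prog := FFor 13 0 (FN 5 Z Z (NAdd (var 5) (cell 2 (NConst 3)))).

(** Truncation at [n] keeps the loop bounds polynomial whatever the sample complexity. *)
Definition learner_size_prog :=
  FSeq (FSize 4 Z Z (RDiv (rpow eps_exp 4) k_exp) delta_exp)
       (FIf (BNlt (var 4) (cell 2 Z)) FSkip (FN 4 Z Z (cell 2 Z))).

Definition parameters_prog := FSeq count_prog (FSeq swaps_prog learner_size_prog).

Definition bounds_prog :=
  FSeq (set_bound 4 (var 3))
  (FSeq (set_bound 5 (var 4))
  (FSeq (set_bound 9 (var 5))
  (FSeq (set_bound 7 (NAdd (NAdd (NAdd (var 3) (var 4)) (var 4)) (var 3)))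
        (set_bound 6 (NAdd (cell 2 (NConst 1))
                           (NAdd (NAdd (NAdd (var 3) (var 4)) (var 4)) (var 3))))))).

Definition identity_prog := fntab 13 1 25 FSkip (var 13).

Definition exhaustive_prog := FSeq identity_prog (label_prog 0 (var 13) 1).

Definition sampling_prog :=
  FSeq dist_prog (FSeq farthest_prog (FSeq local_search_prog weights_prog)).

Definition labeling_prog :=
  FSeq identity_prog (FSeq shuffle_prog (FSeq (label_prog 7 (draw_at (var 13)) 26) finish_prog)).

(* Sampling is pointless when it would cost as many queries as labeling all the
   points; this also bounds the running time independently of the precision. *)
Definition main_cond : bexp :=
  BAnd (BNlt (cell 2 (NConst 4)) (cell 2 Z)) (BNlt (cell 2 (NConst 5)) (cell 2 Z)).

Definition main_com : com :=
  If main_cond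
    (Seq (compile sampling_prog) (Seq (draws 6 0) (compile labeling_prog)))
    (compile exhaustive_prog).

(** With a single cluster, the zeros of the initial memory already form the output. *)
Definition algorithm : com :=
  If (BNlt (cell 0 (NConst 2)) (NConst 2)) Skip
    (Seq (compile sizes_prog) (Seq (compile parameters_prog) (Seq (compile bounds_prog) main_com))).

Definition run_time (L : nat) : nat :=
  10 + steps sizes_prog 0 + steps parameters_prog L + steps bounds_prog 0 + steps exhaustive_prog L +
  steps sampling_prog L + (L * (8 * L + 7) + 3) + steps labeling_prog L.

Lemma run_time_poly : exists S D : nat, forall L, (run_time L <= S * L.+1 ^ D)%N.
Proof.
have const (a : nat) : exists S D : nat, forall L, (a <= S * L.+1 ^ D)%N.
  by exists a, 0%N => L; rewrite expn0 muln1.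
have prog c : exists S D : nat, forall L, (steps c L <= S * L.+1 ^ D)%N.
  by exists (fsize c), (fdepth c) => L; exact: steps_poly.
have add (f g : nat -> nat) : (exists S D : nat, forall L, (f L <= S * L.+1 ^ D)%N) ->
    (exists S D : nat, forall L, (g L <= S * L.+1 ^ D)%N) ->
    exists S D : nat, forall L, (f L + g L <= S * L.+1 ^ D)%N.
  move=> [S1 [D1 h1]] [S2 [D2 h2]]; exists (S1 + S2)%N, (maxn D1 D2) => L.
  rewrite mulnDl; apply: leq_add.
    apply: leq_trans (h1 L) _; rewrite leq_mul2l leq_pexp2l ?orbT //; exact: leq_maxl.
  apply: leq_trans (h2 L) _; rewrite leq_mul2l leq_pexp2l ?orbT //; exact: leq_maxr.
have quad : exists S D : nat, forall L, (L * (8 * L + 7) + 3 <= S * L.+1 ^ D)%N.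
  by exists 8, 2 => L; rewrite !expnS expn0 muln1; nia.
exact: (add _ _ (add _ _ (add _ _ (add _ _ (add _ _ (add _ _ (add _ _ (const 10)
  (const (steps sizes_prog 0))) (prog parameters_prog)) (const (steps bounds_prog 0)))
  (prog exhaustive_prog)) (prog sampling_prog)) quad) (prog labeling_prog)).
Qed.

Section Prologue.
Variables (R : realType) (r n k : nat) (P : 'I_n -> 'rV[R]_r) (m : R -> R -> nat).
Variables (AL : learner R r k) (f : kclustering n k) (eps delta : R).
Hypotheses (eps01 : 0 < eps < 1) (delta01 : 0 < delta < 1) (k0 : (0 < k)%N).

Let O := kmeans_oracles P f m AL.
Let s0 := init_state k P eps delta.

Definition sample_bound : R := 10 ^+ 9 * k%:R ^+ 3 / (eps ^+ 2 * delta).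

Lemma sample_bound_gt0 : 0 < sample_bound.
Proof.
have /andP[e0 _] := eps01; have /andP[d0 _] := delta01.
by rewrite divr_gt0 // mulr_gt0 // ?exprn_gt0 // ltr0n.
Qed.

Lemma prologue_val : let s1 := fsem O bounds_prog (fsem O parameters_prog (fsem O sizes_prog s0)) in
  exists N M : nat, [/\
   [/\ (N <= n)%N, (N < n)%N -> sample_bound <= N%:R, N%:R < sample_bound + 1 &
       M = minn (m (eps ^+ 4 / k%:R) delta) n],
   [/\ nmem s1 2 0 0 = n, nmem s1 2 1 0 = k, nmem s1 2 2 0 = r, nmem s1 2 3 0 = (k + k).+1 &
       nmem s1 2 8 0 = (k + k)%N],
   [/\ nmem s1 2 4 0 = N, nmem s1 2 5 0 = M, nmem s1 2 9 0 = (n * (k + k).+1)%N,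
       nmem s1 2 7 0 = (N + M + M + N)%N & nmem s1 2 6 0 = (k + (N + M + M + N))%N],
   frame [:: 2; 3; 4; 5; 13] [::] s0 s1 /\ (forall b, (9 < b)%N -> nmem s1 2 b 0 = 0%N) &
   sample s1 = [::] /\ queries s1 = 0%N] /\
  (forall b, (nmem (fsem O sizes_prog s0) 2 b 0 <= 2 * (n + r + k).+1)%N).
Proof.
set sa := fsem O sizes_prog s0; set sb := fsem O parameters_prog sa.
have fa : frame [:: 2] [::] s0 sa.
  by have := frame_fsem O sizes_prog s0; apply: frame_sub => a //=; rewrite !inE; do ?[case/orP].
have [fa1 fa2] := fa.
have a2 b : nmem sa 2 b 0 = nth 0%N [:: n; k; r; (k + k).+1; 0; 0; 0; 0; (k + k)]%N b.
  rewrite /sa /sizes_prog !fsem_seq !fsem_nset /= /upd /= addn1.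
  by case: b => [|[|[|[|[|[|[|[|[|b]]]]]]]]] //=; rewrite nth_nil.
have reps : rmem sa 1 0 0 = eps /\ rmem sa 1 1 0 = delta by rewrite fa2.
have [reps1 rdelta] := reps.
have /andP[e0 _] := eps01; have /andP[d0 _] := delta01.
have k0' : 0 < k%:R :> R by rewrite ltr0n.
pose s11 := fsem O count_prog sa; pose s12 := fsem O swaps_prog s11.
have [F11 G11] := frame_fsem O count_prog sa; rewrite -/s11 in F11 G11.
have [F12 G12] := frame_fsem O swaps_prog s11; rewrite -/s12 in F12 G12.
have [N [hN1 hN2 hN3 hN4]] : exists N, [/\ nmem s11 3 0 0 = N, (N <= n)%N,
    (N < n)%N -> sample_bound <= N%:R & N%:R < sample_bound + 1].
  rewrite /s11 /count_prog; set c := FIf _ _ _.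
  apply: (@for_ind _ _ _ O 13 0 c sa n (fun i s => exists N, [/\ nmem s 3 0 0 = N, (N <= i)%N,
    (N < i)%N -> sample_bound <= N%:R & N%:R < sample_bound + 1])) => [|||]; [by rewrite a2|by []| |].
    exists 0%N; split=> //; last by have := sample_bound_gt0; lra.
  move=> i s [f1 g1] hi [N [h1 h2 h3 h4]].
  have hX : reval s sample_bound_exp = sample_bound.
    have ek : reval s k_exp = k%:R by rewrite /= (f1 2) ?a2.
    have ee : reval s eps_exp = eps by rewrite /= g1.
    have ed : reval s delta_exp = delta by rewrite /= g1.
    rewrite -[LHS]/(reval s (rpow (RNat (NConst 10)) 9) * reval s (rpow k_exp 3) /
      (reval s (rpow eps_exp 2) * reval s delta_exp)).
    by rewrite !reval_rpow ek ee ed.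
  rewrite /c fsem_if -[beval _ _]/(reval s (RNat (var 3)) < reval s sample_bound_exp) hX [reval s (RNat _)]/= h1.
  case: ltP => lt.
    exists N.+1; split; first by rewrite fsem_nset /= /upd /= h1 addn1.
    - by rewrite ltnS.
    - by rewrite ltnS => /h3; rewrite leNgt lt.
    - by rewrite -[_.+1%:R]natr1; lra.
  by exists N; split=> //; exact: leqW.
have hKn : nmem s12 5 0 0 = (n * (k + k).+1)%N.
  rewrite /s12 /swaps_prog; set c := FN 5 _ _ _.
  apply: (@for_ind _ _ _ O 13 0 c s11 n (fun i s => nmem s 5 0 0 = (i * (k + k).+1)%N)) => //.
  - by rewrite F11 // a2.
  - by rewrite /= /upd /= F11 // fa1.
  move=> i s [f1 g1] hi h; rewrite /c fsem_nset /= /upd /= h f1 // F11 // a2 /= mulSn addnC //.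
pose M := minn (m (eps ^+ 4 / k%:R) delta) n.
have hsb : sb = fsem O learner_size_prog s12 by [].
have hM : nmem sb 4 0 0 = M.
  have e4 : reval s12 (RDiv (rpow eps_exp 4) k_exp) = eps ^+ 4 / k%:R.
    have ek : reval s12 k_exp = k%:R by rewrite /= (F12 2) // (F11 2) // a2.
    have ee : reval s12 eps_exp = eps by rewrite /= G12 // G11.
    by rewrite -[LHS]/(reval s12 (rpow eps_exp 4) / reval s12 k_exp) reval_rpow ee ek.
  have ed : reval s12 delta_exp = delta by rewrite [LHS]/= G12 // G11 // rdelta.
  rewrite hsb /learner_size_prog fsem_seq; set s13 := fsem O (FSize _ _ _ _ _) s12.
  have e13 : nmem s13 4 0 0 = m (eps ^+ 4 / k%:R) delta.
    by rewrite /s13 /fsem e4 ed /= /upd.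
  have f13 : nmem s13 2 = nmem sa 2.
    have [h _] := frame_fsem O (FSize 4 Z Z (RDiv (rpow eps_exp 4) k_exp) delta_exp) s12.
    by rewrite h // F12 // F11.
  clearbody s13.
  rewrite fsem_if /= e13 f13 a2 /=; case: ltnP => h.
    by rewrite /M (minn_idPl (ltnW h)) -e13.
  by rewrite fsem_nset /= /upd /= f13 a2 /M (minn_idPr h).
have F13 : frame [:: 4; 4] [::] s12 sb by rewrite hsb; exact: (frame_fsem O learner_size_prog s12).
have [f13 g13] := F13.
have b2 : nmem sb 2 = nmem sa 2 by rewrite f13 // F12 // F11.
have b3 : nmem sb 3 0 0 = N by rewrite f13 // F12.
have b5 : nmem sb 5 0 0 = (n * (k + k).+1)%N by rewrite f13.
set sc := fsem O bounds_prog sb.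
have c2 b : nmem sc 2 b 0 = nth 0%N [:: n; k; r; (k + k).+1; N; M; (k + (N + M + M + N));
    N + M + M + N; k + k; (n * (k + k).+1)]%N b.
  rewrite /sc; move: b2 b3 hM b5; move: (sb) => s b2 b3 hM b5.
  rewrite /bounds_prog 4!fsem_seq 5!fsem_nset /= /upd /= b2 b3 hM b5 !a2 /=.
  by case: b => [|[|[|[|[|[|[|[|[|[|b]]]]]]]]]] //=; rewrite !nth_nil.
move=> s1; rewrite {}/s1 -/sc.
exists N, M; split; last first.
  move=> b; rewrite a2; clear; case: b => [|[|[|[|[|[|[|[|[|b]]]]]]]]] /=; rewrite ?nth_nil; lia.
split.
- by [].
- by rewrite !c2.
- by rewrite !c2.
- split; last by move=> b hb; rewrite c2 nth_default.
  split=> a ha.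
    have : a \notin [:: 2] by apply: contra ha; rewrite !inE => ->.
    have h := ha; move: h; rewrite !inE !negb_or => /and5P[n2 n3 n4 n5 n13] _.
    have [hfr _] := frame_fsem O bounds_prog sb.
    by rewrite hfr ?f13 ?F12 ?F11 ?fa1 //= !inE ?negb_or ?n2 ?n3 ?n4 ?n5 ?n13.
  have [_ g] := frame_fsem O bounds_prog sb.
  by rewrite g // g13 // G12 // G11 // fa2.
- have hs : sample sc = sample sb /\ queries sc = queries sb by [].
  have q : queries sc = 0%N.
    by rewrite /sc !query_freeP.
  split=> //.
  have loops c s (T : nat) b v : (forall s', sample (fsem O c s') = sample s') ->
      sample (fsem O (FFor v b c) s) = sample s.
    move=> hc; rewrite /fsem -/fsem; elim: (nmem s 2 b 0) => //= i <-.
    exact: hc.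
  rewrite hs.1 hsb /learner_size_prog fsem_seq fsem_if.
  rewrite (_ : sample _ = sample s12); last by case: ifP.
  rewrite /s12 loops ?(loops _ _ 0%N) //.
  by move=> s'; rewrite fsem_if; case: ifP.
Qed.

End Prologue.

(** * The phases combined *)

Section Labeling.
Variables (R : realType) (r n k : nat) (O : oracles R n k) (P : 'I_n -> 'rV[R]_r).
Variables (f : kclustering n k) (q : 'I_n -> R) (eps : R) (N M : nat) (p0 : 'I_n) (i0 : 'I_k).
Hypothesis OP : forall p q, same_cluster O p q = (f p == f q).

(** The ranks of discovery followed by the shuffle. This relabeling depends on the very draws that
    it labels, the obstacle removed by [labeling_Pr]. *)
Definition drawn_labeling T (x : seq 'I_n) : kclustering n k :=
  relabel (rank_perm (discovered (f \o nth p0 (drop k x)) T) *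
           fisher_yates i0 [seq val p | p <- x] k)%g f.

Lemma identity_val s : nmem s 2 1 0 = k ->
  forall i : 'I_k, nmem (fsem O identity_prog s) 25 i 0 = i.
Proof.
by move=> h1; apply: (@fntab_val R n k O 13 1 25 FSkip (var 13) s k (fun i v => v = i)).
Qed.

Lemma labeling_val s (x : seq 'I_n) : let T := (N + M + M + N)%N in
  [/\ nmem s 2 0 0 = n, nmem s 2 1 0 = k, nmem s 2 2 0 = r, nmem s 2 4 0 = N &
      nmem s 2 5 0 = M] ->
  nmem s 2 7 0 = T -> nmem s 28 0 0 = 0%N -> (0 < k)%N -> 0 <= eps ->
  (forall (p : 'I_n) (c : 'I_r), rmem s 0 p c = P p 0 c) -> rmem s 1 0 0 = eps ->
  (forall p : 'I_n, rmem s 13 p 0 = q p) -> size x = (k + T)%N ->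
  (forall t, (t < size x)%N -> nmem s 24 t 0 = nth 0%N [seq val p | p <- x] t) ->
  (forall t, (t < k)%N -> (nth 0 [seq val p | p <- x] t <= t)%N) ->
  let s' := fsem O labeling_prog s in
  let g := drawn_labeling T x in let w := nth p0 (drop k x) in
  let c := sample_center P g q (sample_part w 0 N) in
  let hyp a p := learned O [seq (p, g p) | p <- sample_part w a M] p in
  let h := select R g (hyp N) (hyp (N + M)%N) (sample_part w (N + M + M) N) in
  (queries s' <= queries s + T * k)%N /\
  exists g' : kclustering n k, exists phi : 'I_n -> R,
  let tau := eps * (\sum_p phi p) / (4 * n%:R) in
  [/\ outputs s' g',
      (forall p j, phi p <= sqdist (P p) (c j)) /\
      (forall p, exists j, phi p = sqdist (P p) (c j)),
      forall p, sqdist (P p) (c (g' p)) <= phi p + tau &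
      forall p, sqdist (P p) (c (h p)) <= phi p + tau -> g' p = h p].
Proof.
move=> T [h0 h1 h2 h4 h5] h7 h28 k0 eps0 hP heps hq hx h24 hle s' g w c hyp h.
pose sa := fsem O identity_prog s.
have [fa ga] := frame_fsem O identity_prog s; rewrite -/sa in fa ga.
pose sb := fsem O shuffle_prog sa.
have [fb gb] := frame_fsem O shuffle_prog sa; rewrite -/sb in fb gb.
pose sc := fsem O (label_prog 7 (draw_at (var 13)) 26) sb.
have [fc gc] := frame_fsem O (label_prog 7 (draw_at (var 13)) 26) sb; rewrite -/sc in fc gc.
have s'E : s' = fsem O finish_prog sc by rewrite /s' /labeling_prog 3!fsem_seq.
have b25 i : nmem sb 25 (nat_of_ord i) 0 = fisher_yates i0 [seq val p | p <- x] k i.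
  apply: shuffle_val.
  - by rewrite fa.
  - exact: identity_val.
  - by move=> t; rewrite fa // h24 // hx; apply: leq_trans (ltn_ord t) (leq_addr _ _).
  - by move=> t; apply: leq_ltn_trans (hle _ _) _.
have b24 t : (t < T)%N -> nmem sb 24 (k + t)%N 0 = w t.
  move=> ht; rewrite fb // fa // h24; last by rewrite hx ltn_add2l.
  by rewrite (nth_map p0) ?hx ?ltn_add2l // /w nth_drop.
have [l1 l2 _] : let s' := sc in
  [/\ forall t, (t < T)%N ->
        nmem s' 26 t 0 = nmem sb 25 (rank_perm (discovered (f \o w) T) (f (w t))) 0,
      (queries s' <= queries sb + T * k)%N & sample s' = sample sb].
  apply: label_val => //; rewrite ?fb ?fa //.
  move=> t s1 [f1 _] h13 /=; rewrite (f1 24) // (f1 2) // h13 -b24 //.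
  by rewrite (fb 2) // (fa 2) // h1.
split.
  have qb : queries sb = queries s by rewrite !query_freeP.
  by rewrite s'E query_freeP // -qb.
rewrite s'E; apply: (@finish_val _ _ _ _ O P q g eps N M w sc) => //.
split.
- by rewrite !fc // !fb // !fa.
- by move=> p j; rewrite gc // gb // ga.
- by rewrite gc // gb // ga.
- by move=> p; rewrite gc // gb // ga.
- move=> t ht; rewrite fc // b24 //; split=> //.
  by rewrite l1 // b25 /g ffunE permM.
Qed.

End Labeling.

Section Sampling.
Variables (R : realType) (r n k : nat) (O : oracles R n k) (P : 'I_n -> 'rV[R]_r).
Variables (f : kclustering n k) (eps : R) (N M : nat).
Hypotheses (k2 : (1 < k)%N) (n0 : (0 < n)%N) (nbP : no_boundary P k) (optf : is_optimal P f).

(** Required for all optimal clusterings at once, because the labels come from a random relabeling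
    of [f]. *)
Definition good_sampling (q : 'I_n -> R) := distr q /\
  forall g : kclustering n k, is_optimal P g ->
    Ex (nseq N q) (fun S => (~~ `[< good_centers P g eps (sample_center P g q S) >])%:R) <=
    10 ^+ 8 * k%:R ^+ 3 / (eps ^+ 2 * N%:R).

Lemma sampling_val s : 0 < eps < 1 -> 0 < cost P f -> (0 < N)%N ->
  [/\ nmem s 2 0 0 = n, nmem s 2 1 0 = k, nmem s 2 2 0 = r & nmem s 2 3 0 = (k + k).+1] ->
  [/\ nmem s 2 4 0 = N, nmem s 2 8 0 = (k + k)%N, nmem s 2 9 0 = (n * (k + k).+1)%N &
      nmem s 2 6 0 = (k + (N + M + M + N))%N] ->
  (forall (p : 'I_n) (c : 'I_r), rmem s 0 p c = P p 0 c) ->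
  (forall i, nmem s 20 i 0 = 0%N) ->
  let s' := fsem O sampling_prog s in
  exists q, [/\ good_sampling q, forall p : 'I_n, rmem s' 13 p 0 = q p &
    forall i (p : 'I_n), (i < k + (N + M + M + N))%N ->
      rmem s' 6 i p = nth (fun=> 0) (draw_weights k q N (M + M + N)) i p].
Proof.
have k0 := ltnW k2; move=> eps01 X0 N0 [h0 h1 h2 h3] [h4 h8 h9 h6] hP h20.
pose o j := centroid P (kcluster f j).
have XE : cost P f = \sum_p sqdist (P p) (o (f p)) by rewrite cost_sqdist.
pose sa := fsem O dist_prog s.
have [fa ga] := frame_fsem O dist_prog s; rewrite -/sa in fa ga.
pose sb := fsem O farthest_prog sa.
have [fb gb] := frame_fsem O farthest_prog sa; rewrite -/sb in fb gb.
pose sc := fsem O local_search_prog sb.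
have [fc gc] := frame_fsem O local_search_prog sb; rewrite -/sc in fc gc.
have da : seed_data (k + k) P sa by split; rewrite ?fa //; exact: dist_val.
have [B [hB ffB]] : exists B : 'I_(k + k).+1 -> 'I_n, holds_seeds 20 sb B /\ farthest_first P B.
  have hz i : nmem sa 20 i 0 = 0%N by rewrite fa.
  by apply: (farthest_val (P := P) O n0 da _ hz); rewrite fa.
have db : seed_data (k + k) P sb.
  by apply: seed_data_frame (frame_fsem O farthest_prog sa) da.
have [C [hC costC]] : exists C : 'I_(k + k).+1 -> 'I_n, holds_seeds 20 sc C /\ seed_cost P C <= 122 * cost P f.
  apply: (local_search_val O (k := k) n0 k0 (ltW X0) db hB (T := n * (k + k).+1)).
  - by rewrite fb // fa.
  - by rewrite mulnC leq_mul2l mul2n addnn leqnSn orbT.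
  - by move=> B'; rewrite XE; apply: swap_improves; rewrite // mul2n addnn.
  - by rewrite XE; apply: farthest_first_cost => //; exact: leq_addr.
have dc : seed_data (k + k) P sc.
  by apply: seed_data_frame (frame_fsem O local_search_prog sb) db.
move=> s'; have s'E : s' = fsem O weights_prog sc by rewrite /s' /sampling_prog 3!fsem_seq.
have [|||slot [hy h13 h6']] :=
  weights_val O (k := k) (N := N) (T := M + M + N) dc hC; rewrite ?fc ?fb ?fa //.
  by rewrite h6 !addnA.
set y := fun p => _ in hy h13 h6'.
have y0 p : 0 <= y p by exact: sqdist_ge0.
have YE : \sum_p y p = seed_cost P C by apply: eq_bigr => p _; exact: hy.
have Kle : ((k + k).+1 < 3 * k)%N by lia.
rewrite s'E; exists (seed_weight y slot); split; last 1 first.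
- have -> : (N + M + M + N = N + (M + M + N))%N by rewrite !addnA.
  exact: h6'.
- split; first exact: (distr_seed_weight slot n0 y0).
  (* All optimal clusterings have the same cost, and the bound on the seeds involves nothing
     else. *)
  move=> g optg; have Xg : cost P g = cost P f by apply/eqP; rewrite eq_le optg optf.
  apply: (@good_centers_Pr R r n k _ P g (fun b => P (C b)) slot _ eps) => //.
  + by rewrite -cost_sqdist Xg.
  + exact: optimal_closest.
  + by rewrite -cost_sqdist Xg YE.
  + by move=> p; apply: seed_weight_cost.
  + by move=> p; apply: seed_weight_cell.
  + exact: (distr_seed_weight slot n0 y0).
- by [].
Qed.

End Sampling.

Lemma sample_part_cat n (p0 : 'I_n) (u v w : seq 'I_n) :
  sample_part (nth p0 (u ++ v ++ w)) (size u) (size v) = v.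
Proof.
rewrite /sample_part map_nth_iota; last by rewrite !size_cat addKn leq_addr.
by rewrite drop_size_cat // take_size_cat.
Qed.

Lemma distr_row_upto (R : realType) n t : (t < n)%N -> distr (@row_upto R n t).
Proof.
move=> tn; split=> [p|]; first by rewrite /row_upto; case: ifP.
rewrite /row_upto -big_mkcond -(big_ord_widen _ (fun=> t.+1%:R^-1)) //= sumr_const card_ord.
by rewrite -[LHS]mulr_natr mulVf // pnatr_eq0.
Qed.

Lemma possible_nth (R : realFieldType) (T : finType) (ws : seq (T -> R)) x w0 p0 i :
  possible ws x -> (i < size x)%N -> 0 < nth w0 ws i (nth p0 x i).
Proof.
elim: ws x i => [|w ws IH] [|p x] [|i] //= /andP[h1 h2] // hi.
exact: IH.
Qed.

Lemma size_possible (R : realFieldType) (T : finType) (ws : seq (T -> R)) x :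
  possible ws x -> size x = size ws.
Proof. by elim: ws x => [|w ws IH] [|p x] //= /andP[_ /IH ->]. Qed.

Section DrawWeights.
Variables (R : realType) (r n k : nat) (P : 'I_n -> 'rV[R]_r) (q : 'I_n -> R) (N T : nat).

Lemma size_draw_weights : size (draw_weights k q N T) = (k + (N + T))%N.
Proof. by rewrite !size_cat size_mkseq !size_nseq. Qed.

Lemma distr_draw_weights : (k <= n)%N -> (0 < n)%N -> distr q ->
  forall w, List.In w (draw_weights k q N T) -> distr w.
Proof.
move=> kn n0 dq; suff h (ws : seq ('I_n -> R)) : (forall i, (i < size ws)%N -> distr (nth (fun=> 0) ws i)) ->
    forall w, List.In w ws -> distr w.
  apply: h => i; rewrite size_draw_weights => hi; rewrite /draw_weights nth_cat size_mkseq.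
  case: ltnP => ik; first by rewrite nth_mkseq //; apply: distr_row_upto; exact: leq_trans kn.
  rewrite nth_cat size_nseq; case: ltnP => h; rewrite nth_nseq ?h //.
  by rewrite ifT; [apply: distr_uniform | lia].
elim: ws => //= a ws IH h w [<-|]; first exact: (h 0%N).
by apply: IH => i hi; exact: (h i.+1).
Qed.

Lemma possible_draw_weights x : possible (draw_weights k q N T) x -> (k <= size x)%N ->
  forall t, (t < k)%N -> (nth 0 [seq val p | p <- x] t <= t)%N.
Proof.
move=> hx kx t tk; have tx := leq_trans tk kx.
have p0 : 'I_n by case: x {hx kx} tx => // p.
have := possible_nth (fun=> 0) p0 hx tx; rewrite (nth_map p0) //.
rewrite /draw_weights nth_cat size_mkseq tk nth_mkseq // /row_upto ltnS.
by case: leqP => //; rewrite ltxx.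
Qed.

End DrawWeights.

Section LabelingSuccess.
Variables (R : realType) (r n k : nat) (P : 'I_n -> 'rV[R]_r).
Variables (AL : learner R r k) (m : R -> R -> nat) (eps delta : R).
Hypotheses (eps01 : 0 < eps < 1) (delta01 : 0 < delta < 1) (k2 : (1 < k)%N) (kn : (k <= n)%N).
Hypotheses (learnsAL : learns AL m) (injP : injective P) (nbP : no_boundary P k).
Variables (f : kclustering n k) (q : 'I_n -> R) (N : nat) (p0 : 'I_n) (i0 : 'I_k).
Hypothesis optf : is_optimal P f.
Let M := m (eps ^+ 4 / k%:R) delta.
Let T := (N + M + M + N)%N.

Definition draw_success (g : kclustering n k) (w : seq 'I_n) : bool :=
  success P AL eps q g (sample_part (nth p0 w) 0 N) (sample_part (nth p0 w) N M)
    (sample_part (nth p0 w) (N + M) M) (sample_part (nth p0 w) (N + M + M) N).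

(* The random permutation makes the labeling uniform among the relabelings of
   [f] whatever the points drawn, hence independent of them: the labels may be
   fixed beforehand in the analysis of the sample. *)
Lemma labeling_Pr : good_sampling k P eps N q ->
  4 * (10 ^+ 8 * k%:R ^+ 3) <= N%:R * (eps ^+ 2 * delta) ->
  1 - delta <= Ex (draw_weights k q N (M + M + N)) (fun x =>
    (draw_success (drawn_labeling f p0 i0 T x) (drop k x))%:R).
Proof.
move=> [dq hgood] hN.
have n0 : (0 < n)%N by apply: leq_trans kn; exact: ltnW.
have /andP[e0 _] := eps01; have /andP[d0 _] := delta01.
have ed : 0 < eps ^+ 2 * delta by rewrite mulr_gt0 // exprn_gt0.
have k3 : 1 <= k%:R ^+ 3 :> R by rewrite exprn_ege1 // ler1n ltnW.
have Npos : 0 < N%:R :> R.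
  rewrite -(pmulr_lgt0 _ ed); apply: lt_le_trans hN; lra.
have succ s : 1 - delta <= Ex (nseq N q ++ nseq (M + M + N) (@uniform R n)) (fun w =>
    (draw_success (relabel s f) w)%:R).
  have opts := optimal_relabel s optf.
  have h := @success_Pr R r n k P AL m eps delta eps01 delta01 n0 k2 learnsAL injP nbP q N
    (relabel s f) dq opts.
  apply: le_trans (h _ _) _.
  - apply: le_trans (hgood _ opts) _.
    rewrite ler_pdivrMr; last by rewrite mulr_gt0 // exprn_gt0.
    have -> : delta / 4 * (eps ^+ 2 * N%:R) = N%:R * (eps ^+ 2 * delta) / 4 by ring.
    by rewrite ler_pdivlMr //; apply: le_trans hN; rewrite mulrC.
  - rewrite ler_pdivrMr //; apply: le_trans hN; lra.
  rewrite Ex_cat le_eqVlt; apply/orP; left; apply/eqP.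
  apply: Ex_ext => S0 h0; rewrite nseqD Ex_cat nseqD Ex_cat.
  apply: Ex_ext => S1 h1; apply: Ex_ext => S2 h2; apply: Ex_ext => S3 h3.
  rewrite !size_nseq in h0 h1 h2 h3; rewrite /draw_success -!catA.
  have := sample_part_cat p0 [::] S0 (S1 ++ S2 ++ S3); rewrite /= h0 => ->.
  have := sample_part_cat p0 S0 S1 (S2 ++ S3); rewrite h0 h1 => ->.
  have := sample_part_cat p0 (S0 ++ S1) S2 S3; rewrite size_cat h0 h1 h2 -catA => ->.
  have := sample_part_cat p0 (S0 ++ S1 ++ S2) S3 [::].
  by rewrite !size_cat h0 h1 h2 h3 cats0 -!catA addnA => ->.
(* The first [k] draws, which determine the shuffle alone, are separated from the others. *)
set W := nseq N q ++ _ in succ; rewrite [draw_weights _ _ _ _]/(_ ++ W) Ex_cat.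
pose G w s := (draw_success (relabel (rank_perm (discovered (f \o nth p0 w) T) * s)%g f) w)%:R : R.
have -> : Ex (mkseq (@row_upto R n) k) (fun x => Ex W (fun y =>
    (draw_success (drawn_labeling f p0 i0 T (x ++ y)) (drop k (x ++ y)))%:R)) =
  Ex (mkseq (@row_upto R n) k) (fun x => Ex W (fun y => G y (fisher_yates i0 [seq val p | p <- x] k))).
  apply: Ex_ext => x; rewrite size_mkseq => sx; apply: Ex_ext => y _.
  by rewrite /G /drawn_labeling drop_size_cat // fisher_yates_cat ?sx.
(* With the other draws fixed, the rank permutation is fixed, and its product with a uniform
   permutation is uniform. *)
rewrite Ex_exchange.
have -> : Ex W (fun y => Ex (mkseq (@row_upto R n) k) (fun x =>
    G y (fisher_yates i0 [seq val p | p <- x] k))) =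
  (k`!)%:R^-1 * \sum_s Ex W (fun y => (draw_success (relabel s f) y)%:R).
  rewrite -Ex_sum -ExZ; apply: Ex_ext => y _.
  rewrite (fisher_yates_uniform i0 (G y) kn); congr (_ * _).
  by rewrite [RHS](reindex_inj (mulgI (rank_perm (discovered (f \o nth p0 y) T)))).
have -> : 1 - delta = (k`!)%:R^-1 * \sum_(s : 'S_k) (1 - delta).
  by rewrite sumr_const card_Sn -(mulr_natl (1 - delta)) mulKf // pnatr_eq0 -lt0n fact_gt0.
by rewrite ler_wpM2l // ler_sum.
Qed.

End LabelingSuccess.

(** At cost 0 every point would equal the center of its cluster, which makes [f] injective. The
    estimates of [good_centers_Pr] are relative to a positive cost. *)
Lemma cost_gt0 (R : realType) r n k (P : 'I_n -> 'rV[R]_r) (f : kclustering n k) :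
  injective P -> (k < n)%N -> 0 < cost P f.
Proof.
move=> injP kn; rewrite lt_neqAle cost_ge0 andbT eq_sym cost_sqdist.
apply/negP; rewrite psumr_eq0 => [/allP c0|p _]; last exact: sqdist_ge0.
have Pf p : P p = centroid P (kcluster f (f p)).
  have := c0 p (mem_index_enum p); rewrite psumr_eq0 => [/allP h|j _]; last exact: sqr_ge0.
  by apply/rowP => j; have := h j (mem_index_enum j); rewrite sqrf_eq0 subr_eq0 => /eqP.
suff injf : injective f by have := leq_card f injf; rewrite !card_ord leqNgt kn.
by move=> p p' fpp'; apply: injP; rewrite Pf [in RHS]Pf fpp'.
Qed.

Lemma reach_if (R : realType) n k (O : oracles R n k) b c1 c2 K s :
  reach O 1 (If b c1 c2 :: K) s ((if beval s b then c1 else c2) :: K) s.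
Proof. exact: reach_step. Qed.

Section Algorithm.
Variables (R : realType) (r n k : nat) (P : 'I_n -> 'rV[R]_r) (m : R -> R -> nat).
Variables (AL : learner R r k) (f : kclustering n k) (eps delta : R).
Hypotheses (eps01 : 0 < eps < 1) (delta01 : 0 < delta < 1) (k2 : (1 < k)%N).
Hypotheses (injP : injective P) (nbP : no_boundary P k) (optf : is_optimal P f).

Let O := kmeans_oracles P f m AL.
Let s0 := init_state k P eps delta.
Let size_bound := (5 * (n + r + k).+1 ^ 2)%N.
Let X := sample_bound k eps delta.

Lemma exhaustive_val s : nmem s 2 0 0 = n -> nmem s 2 1 0 = k -> nmem s 28 0 0 = 0%N ->
  let s' := fsem O exhaustive_prog s in
  (queries s' <= queries s + n * k)%N /\ exists t : 'S_k, outputs s' (relabel t f).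
Proof.
move=> h0 h1 h28; rewrite /exhaustive_prog fsem_seq; set sa := fsem O identity_prog s.
have [fa _] := frame_fsem O identity_prog s; rewrite -/sa in fa.
have qa : queries sa = queries s by rewrite query_freeP.
case: (posnP n) => n0.
  split; last by exists 1%g => p; have := leq_ltn_trans (leq0n p) (ltn_ord p); rewrite {1}n0.
  have h : nmem sa 2 0 0 = 0%N by rewrite fa // h0 n0.
  by rewrite /label_prog /fsem -/fsem h /= qa leq_addr.
pose xs t : 'I_n := insubd (Ordinal n0) t.
have hx (t : 'I_n) (s' : state R n k) : nmem s' 13 0 0 = t -> neval s' (var 13) = xs t.
  by move=> h13 /=; rewrite h13 /xs insubdK // -topredE /= ltn_ord.
have a1 : nmem sa 2 1 0 = k by rewrite fa.
have a0 : nmem sa 2 0 0 = n by rewrite fa.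
have a28 : nmem sa 28 0 0 = 0%N by rewrite fa.
have [l1 l2 _] := @label_val R n k O f (fun _ _ => erefl) 0 (var 13) 1 xs n sa a1 a0 a28 isT
  (fun t s' _ => hx t s').
split; first by rewrite -qa.
exists (rank_perm (discovered (f \o xs) n)) => p.
rewrite l1 // (_ : xs p = p); last by apply: val_inj; rewrite insubdK // -topredE /= ltn_ord.
by rewrite ffunE; apply: identity_val.
Qed.

(** Ensures [k < n] whenever the program samples: the cost is then positive and there are enough
    points for the shuffle. *)
Lemma sample_bound_ge : k%:R <= X.
Proof.
have /andP[e0 e1] := eps01; have /andP[d0 d1] := delta01.
have k1 : 1 <= k%:R :> R by rewrite ler1n ltnW.
rewrite /X /sample_bound ler_pdivlMr; last by rewrite mulr_gt0 // exprn_gt0.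
have ed : eps ^+ 2 * delta <= 1 by rewrite mulr_ile1 // ?exprn_ile1 // ltW // exprn_gt0.
apply: (@le_trans _ _ k%:R); first by rewrite ler_piMr // ler0n.
have : k%:R <= k%:R ^+ 3 :> R by rewrite ler_eXnr.
by have : 0 <= k%:R ^+ 3 :> R by []; lra.
Qed.


Definition sampling_outcome q p0 i0 N M (x : seq 'I_n) (s : state R n k) :=
  let g := drawn_labeling f p0 i0 (N + M + M + N) x in
  (queries s <= (N + M + M + N) * k)%N /\
  exists g' : kclustering n k, outputs s g' /\
    (draw_success P AL m eps delta q N p0 g (drop k x) ->
     (mismatch g g')%:R <= eps * n%:R /\ cost P g' <= (1 + eps) * cost P g).

Lemma labeling_outcome q p0 i0 N M s (x : seq 'I_n) : M = m (eps ^+ 4 / k%:R) delta ->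
  let T := (N + M + M + N)%N in
  [/\ nmem s 2 0 0 = n, nmem s 2 1 0 = k, nmem s 2 2 0 = r, nmem s 2 4 0 = N &
      nmem s 2 5 0 = M] ->
  nmem s 2 7 0 = T -> nmem s 28 0 0 = 0%N -> queries s = 0%N ->
  (forall (p : 'I_n) (c : 'I_r), rmem s 0 p c = P p 0 c) -> rmem s 1 0 0 = eps ->
  (forall p : 'I_n, rmem s 13 p 0 = q p) -> size x = (k + T)%N ->
  (forall t, (t < size x)%N -> nmem s 24 t 0 = nth 0%N [seq val p | p <- x] t) ->
  (forall t, (t < k)%N -> (nth 0 [seq val p | p <- x] t <= t)%N) ->
  sampling_outcome q p0 i0 N M x (fsem O labeling_prog s).
Proof.
move=> hM T hs h7 h28 hq hP heps hq' hx h24 hle.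
have /andP[e0 e1] := eps01; have k0 := ltnW k2.
have [l1 [g' [phi hh]]] := @labeling_val R r n k O P f q eps N M p0 i0
  (fun _ _ => erefl) s x hs h7 h28 k0 (ltW e0) hP heps hq' hx h24 hle.
split; first by rewrite hq in l1.
case: hh => out [near1 near2] near3 near4; exists g'; split=> //.
rewrite /draw_success /success => /andP[/asboolP good mis].
rewrite -hM in mis; apply: combine near1 near2 near3 near4 => //; exact: optimal_relabel.
Qed.

(** One case per branch of [main_cond]. In the first, [n] is bounded by a sample size, which pays
    for the exhaustive queries. In the second, the transfer from expectations over draws to [Pr]
    holds for any event, and serves both the query bound and the success probability. *)
Lemma algorithm_cases (i0 : 'I_k) : let t := run_time size_bound in
  let M := m (eps ^+ 4 / k%:R) delta in
  ((n%:R < X + 1 \/ (n <= M)%N) /\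
   exists u : 'S_k, forall E : state R n k -> Prop,
     (forall s, outputs s (relabel u f) -> (queries s <= n * k)%N -> E s) ->
     1 <= Pr t O [:: algorithm] s0 E) \/
  (exists p0 q N, [/\ X <= N%:R, N%:R < X + 1, (N < n)%N, good_sampling k P eps N q &
     forall E F, (forall x s, sampling_outcome q p0 i0 N M x s -> F x <= `[< E s >]%:R) ->
       Ex (draw_weights k q N (M + M + N)) F <= Pr t O [:: algorithm] s0 E]).
Proof.
move=> t M.
have [N [M' [[[Nn hX1 hX2 hM'] [c0 c1 c2 c3 c8] [c4 c5 c9 c7 c6] [[fr1 fr2] c10] [_ hq]] hsz]]] :=
  @prologue_val R r n k P m AL f eps delta eps01 delta01 (ltnW k2).
rewrite -/O -/s0 in c0 c1 c2 c3 c8 c4 c5 c9 c7 c6 fr1 fr2 c10 hq hsz.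
set s1 := fsem O bounds_prog _ in c0 c1 c2 c3 c8 c4 c5 c9 c7 c6 fr1 fr2 c10 hq.
have M'n : (M' <= n)%N by rewrite hM' geq_minr.
have lin c : (c <= 5 * (n + r + k).+1)%N -> (c <= size_bound)%N.
  by move/leq_trans; apply; rewrite leq_mul2l leq_pmulr.
have hL b : (nmem s1 2 b 0 <= size_bound)%N.
  case: b => [|[|[|[|[|[|[|[|[|[|b]]]]]]]]]]; rewrite ?(c0, c1, c2, c3, c4, c5, c6, c7, c8, c9) ?c10 //.
  1-9: by apply: lin; move: Nn M'n; clear; lia.
  rewrite /size_bound (@leq_trans ((n + r + k).+1 * (2 * (n + r + k).+1))) //.
    by apply: leq_mul; lia.
  by rewrite mulnCA expnS expn1 leq_mul2r orbT.
have prologue : reach O (4 + (steps sizes_prog 0 + (steps parameters_prog size_bound +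
    steps bounds_prog 0))) [:: algorithm] s0 [:: main_com] s1.
  have -> : (4 + (steps sizes_prog 0 + (steps parameters_prog size_bound + steps bounds_prog 0)) =
    1 + (1 + (steps sizes_prog 0 + (1 + (steps parameters_prog size_bound +
    (1 + steps bounds_prog 0))))))%N.
    by move: (steps _ _) (steps _ _) (steps _ _) => x y z; lia.
  apply: reach_trans; first by apply: reach_step; rewrite /= ltnNge k2.
  apply: reach_trans; first by apply: reach_step.
  apply: reach_trans; first by apply: compile_loop_free.
  apply: reach_trans; first by apply: reach_step.
  apply: reach_trans.
    apply: compileP => // b; apply: leq_trans (hsz b) _; apply: lin.
    by rewrite leq_mul2r orbT.
  apply: reach_trans; first by apply: reach_step.
  by apply: compile_loop_free.
have cond : beval s1 main_cond = (N < n)%N && (M' < n)%N.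
  by rewrite -[LHS]/((nmem s1 2 4 0 < nmem s1 2 0 0) && (nmem s1 2 5 0 < nmem s1 2 0 0))%N c4 c5 c0.
have n28 : nmem s1 28 0 0 = 0%N by rewrite fr1.
case: (boolP ((N < n)%N && (M' < n)%N)) => lt; last first.
  left; split.
    move: lt; rewrite negb_and -!leqNgt => /orP[le|le].
      by left; apply: le_lt_trans hX2; rewrite ler_nat.
    by right; rewrite -/M in hM'; move: le; rewrite hM' leq_min => /andP[].
  have [e1 [u e2]] := exhaustive_val c0 c1 n28.
  exists u => E hE; apply: le_trans (_ : _ <= Pr 0 O [::] (fsem O exhaustive_prog s1) E) _.
    by rewrite /= asboolT //; apply: hE => //; rewrite hq in e1.
  have exh : reach O (1 + steps exhaustive_prog size_bound) [:: main_com] s1 [::]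
      (fsem O exhaustive_prog s1).
    apply: reach_trans; last by apply: compileP.
    have := reach_if O main_cond (Seq (compile sampling_prog) (Seq (draws 6 0) (compile labeling_prog))) (compile exhaustive_prog) [::] s1.
    by rewrite cond (negbTE lt).
  apply: le_trans (exh E 0%N) _.
  apply: le_trans (prologue _ _) _; apply: Pr_leq.
  rewrite /t /run_time; lia.
right; have /andP[Nlt M'lt] := lt.
(* In this branch the truncation at [n] had no effect, so the learner gets its full sample. *)
have MM : M' = M by move: M'lt; rewrite hM' -/M /minn; case: (ltnP M n) => //; rewrite ltnn.
have n0 : (0 < n)%N := leq_ltn_trans (leq0n N) Nlt.
have XN := hX1 Nlt.
have kn : (k < n)%N.
  by rewrite -(ltr_nat R); apply: le_lt_trans sample_bound_ge _; apply: le_lt_trans XN _; rewrite ltr_nat.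
have N0 : (0 < N)%N.
  by rewrite -(ltr_nat R); apply: lt_le_trans XN; exact: sample_bound_gt0 eps01 delta01 (ltnW k2).
pose p0 := Ordinal n0.
have P1 (p : 'I_n) (c : 'I_r) : rmem s1 0 p c = P p 0 c.
  by rewrite fr2 //= !insubT //= => lp lc; congr (P _ _ _); apply: val_inj.
have z20 i : nmem s1 20 i 0 = 0%N by rewrite fr1.
have [q [good h13 h6]] := sampling_val O k2 n0 nbP optf eps01 (cost_gt0 f injP kn) N0
  (And4 c0 c1 c2 c3) (And4 c4 c8 c9 c6) P1 z20.
set s2 := fsem O sampling_prog s1 in h13 h6.
have [f2 g2] := frame_fsem O sampling_prog s1; rewrite -/s2 in f2 g2.
exists p0, q, N; split=> // E F hEF.
apply: le_trans (_ : _ <= Pr (size (draw_weights k q N (M + M + N)) * (8 * n + 7) + 3 +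
   (steps labeling_prog size_bound + 0)) O [:: draws 6 0; compile labeling_prog] s2 E) _.
  apply: draws_Pr.
  - by rewrite f2.
  - by rewrite f2 // c6 size_draw_weights MM !addnA.
  - by move=> i p; rewrite size_draw_weights => hi; rewrite h6 MM //; move: hi; rewrite !addnA.
  - by apply: distr_draw_weights => //; [exact: ltnW | case: good].
  move=> x s3 hx [f3 g3] h24 [e1 e2].
  have L3 b : (nmem s3 2 b 0 <= size_bound)%N by rewrite f3 // f2.
  have run := compileP O [::] (isT : wf labeling_prog) isT L3.
  apply: le_trans (run E 0%N) => /=; apply: hEF.
  have sx : size x = (k + (N + M + M + N))%N.
    by rewrite (size_possible hx) size_draw_weights !addnA.
  apply: labeling_outcome => //.
  - by rewrite !f3 // !f2 // -MM.
  - by rewrite f3 // f2 // -MM.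
  - by rewrite f3 // f2.
  - by rewrite e2 query_freeP.
  - by move=> p c; rewrite g3 // g2.
  - by rewrite g3 // g2 // fr2.
  - by move=> p; rewrite g3.
  - by apply: possible_draw_weights hx _; rewrite sx leq_addr.
have smp : reach O (1 + (1 + (steps sampling_prog size_bound + 1))) [:: main_com] s1
    [:: draws 6 0; compile labeling_prog] s2.
  apply: reach_trans.
    have := reach_if O main_cond (Seq (compile sampling_prog) (Seq (draws 6 0) (compile labeling_prog)))
      (compile exhaustive_prog) [::] s1.
    by rewrite cond lt; apply.
  apply: reach_trans; first by apply: reach_step.
  apply: reach_trans; first by apply: compileP.
  by apply: reach_step.
apply: le_trans (smp E _) _.
apply: le_trans (prologue _ _) _; apply: Pr_leq.
have : (size (draw_weights k q N (M + M + N)) * (8 * n + 7) <= size_bound * (8 * size_bound + 7))%N.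
  apply: leq_mul; first by rewrite size_draw_weights; apply: leq_trans (hL 6); rewrite c6 MM !addnA.
  by have := hL 0%N; rewrite c0; clear; lia.
rewrite /t /run_time; move: (size _ * _)%N (size_bound * _)%N.
move: (steps _ _) (steps _ _) (steps _ _) (steps _ _) (steps _ _) (steps _ _); clear; lia.
Qed.

End Algorithm.

(** * Query count and conclusion *)

Section QueryBound.
Variables (R : realType) (k M : nat) (eps delta C : R).
Hypotheses (eps01 : 0 < eps < 1) (delta01 : 0 < delta < 1) (k0 : (0 < k)%N).
Hypothesis C_ge : 4 * 10 ^+ 9 <= C.

Definition query_bound := C * (k%:R ^+ 4 / (eps ^+ 2 * delta)
  + k%:R ^+ 9 / eps ^+ 4 * ln (1 / delta) + k%:R * M%:R).

(** The 2N + 2M labeled draws cost at most [k] queries each, and N < X + 1 <= 2X for the sample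
    bound X, whence the factor 4. *)
Lemma query_bound_ge : (4 * sample_bound k eps delta + 2 * M%:R) * k%:R <= query_bound.
Proof.
have /andP[e0 _] := eps01; have /andP[d0 d1] := delta01.
have a0 : 0 <= k%:R ^+ 4 / (eps ^+ 2 * delta).
  by rewrite divr_ge0 ?exprn_ge0 ?mulr_ge0 ?exprn_ge0 // ltW.
have b0 : 0 <= k%:R ^+ 9 / eps ^+ 4 * ln (1 / delta).
  rewrite mulr_ge0 //; first by rewrite divr_ge0 ?exprn_ge0 // ltW.
  by rewrite ln_ge0 // div1r invf_ge1 // ltW.
have c0 : 0 <= k%:R * M%:R :> R by rewrite mulr_ge0.
have -> : (4 * sample_bound k eps delta + 2 * M%:R) * k%:R =
    4 * 10 ^+ 9 * (k%:R ^+ 4 / (eps ^+ 2 * delta)) + 2 * (k%:R * M%:R).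
  by rewrite /sample_bound; move: (10 ^+ 9) => c; move: (eps ^+ 2 * delta)^-1 => d; ring.
have C2 : 2 <= C by have := C_ge; lra.
have C0 : 0 <= C by lra.
rewrite /query_bound !mulrDl !mulrDr.
have h1 := ler_wpM2r a0 C_ge; have h2 := ler_wpM2r c0 C2; have h3 := mulr_ge0 C0 b0.
lra.
Qed.

End QueryBound.

Theorem theorem2 (R : realType) :
  exists (A : com) (C c e : nat),
  forall (k r : nat) (m : R -> R -> nat) (AL : learner R r k),
  (0 < k)%N -> learns AL m ->
  forall (n : nat) (P : 'I_n -> 'rV[R]_r), injective P -> no_boundary P k ->
  forall f : kclustering n k, is_optimal P f ->
  forall eps delta : R, 0 < eps < 1 -> 0 < delta < 1 ->
  let O := kmeans_oracles P f m AL in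
  let s0 := init_state k P eps delta in
  let time := (c * (n + r + k).+1 ^ e)%N in
  surely time O [:: A] s0 (fun s =>
    (exists g : kclustering n k, outputs s g) /\
    (queries s)%:R <=
      C%:R * (k%:R ^+ 4 / (eps ^+ 2 * delta)
              + k%:R ^+ 9 / eps ^+ 4 * ln (1 / delta)
              + k%:R * (m (eps ^+ 4 / k%:R) delta)%:R)) /\
  1 - delta <= Pr time O [:: A] s0 (fun s =>
    exists g : kclustering n k,
      [/\ outputs s g,
          (error g f)%:R <= eps * n%:R &
          cost P g <= (1 + eps) * OPT P k]).
Proof.
have [S [D time_le]] := run_time_poly.
have [C hC] : exists C : nat, 4 * 10 ^+ 9 <= C%:R :> R.
  by exists (4 * 10 ^ 9)%N; rewrite natrM natrX.
exists algorithm, C, (S * 6 ^ D)%N, (2 * D)%N.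
move=> k r m AL k0 learnsAL n P injP nbP f optf eps delta eps01 delta01 O s0 time.
have /andP[e0 e1] := eps01; have /andP[d0 d1] := delta01.
(* With L = n + r + k + 1, 5 L^2 + 1 <= 6 L^2, whence the constant 6 ^ D and the exponent 2D. *)
have htime : (run_time (5 * (n + r + k).+1 ^ 2) <= time)%N.
  apply: leq_trans (time_le _) _; rewrite /time -mulnA leq_mul2l; apply/orP; right.
  rewrite expnM -expnMn; case: (D) => [|d]; rewrite // leq_exp2r //.
  by rewrite expnS expn1; lia.
have opt1 (g : kclustering n k) : is_optimal P g -> cost P g <= (1 + eps) * OPT P k.
  move=> optg; rewrite -(is_optimal_OPT optg) ler_peMl ?cost_ge0 //; lra.
set M := m (eps ^+ 4 / k%:R) delta.
have hq := @query_bound_ge R k M eps delta C%:R eps01 delta01 hC.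
have [k1|k2] : (k = 1 \/ 1 < k)%N by case: (k) k0 => [|[|]]; auto.
  have start E : E s0 -> 1 <= Pr time O [:: algorithm] s0 E.
    have lt2 : (k < 2)%N by rewrite k1.
    move=> Es0; apply: le_trans (Pr_leq _ _ _ _ (_ : 2 <= time)%N).
      by rewrite /= lt2 /= asboolT.
    by apply: leq_trans htime; rewrite /run_time; lia.
  have out : outputs s0 f by move=> p; have := ltn_ord (f p); rewrite /=; clear -k1; lia.
  split.
    apply: Pr1_surely; apply: start; split; first by exists f.
    apply: le_trans hq; rewrite mulr_ge0 // addr_ge0 // mulr_ge0 // ltW //.
    exact: sample_bound_gt0.
  apply: le_trans (start _ _); first by rewrite gerBl ltW.
  exists f; split=> //; last exact: opt1.
  apply: le_trans (_ : 0 <= _); last by rewrite mulr_ge0 // ltW.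
  rewrite lern0 -leqn0; apply: leq_trans (error_le _ _ 1%g) _.
  by rewrite leqn0 cards_eq0; apply/eqP/setP => p; rewrite !inE perm1 eqxx.
have X1 : 1 <= sample_bound k eps delta.
  by apply: le_trans (sample_bound_ge eps01 delta01 k2); rewrite ler1n.
have [[hn [u hu]]|[p0 [q [N [XN NX Nn good hPr]]]]] :=
  algorithm_cases m AL eps01 delta01 k2 injP nbP optf (Ordinal k0).

- have run E : (forall s, outputs s (relabel u f) -> (queries s <= n * k)%N -> E s) ->
      1 <= Pr time O [:: algorithm] s0 E.
    by move=> hE; apply: le_trans (hu _ hE) _; exact: Pr_leq.
  split.
    apply: Pr1_surely; apply: run => s out hs; split; first by exists (relabel u f).
    apply: le_trans hq; apply: (@le_trans _ _ (n%:R * k%:R)); first by rewrite -natrM ler_nat.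
    rewrite ler_wpM2r //; have M0 : 0 <= M%:R :> R by [].
    case: hn => [lt|le]; first lra.
    have : n%:R <= M%:R :> R by rewrite ler_nat.
    lra.
  apply: le_trans (run _ _); first by rewrite gerBl ltW.
  move=> s out _; exists (relabel u f); split=> //; last by apply: opt1; exact: optimal_relabel.
  apply: (@le_trans _ _ 0); last by rewrite mulr_ge0 // ltW.
  rewrite lern0 -leqn0; apply: leq_trans (error_relabel _ _ u) _.
  by rewrite leqn0 cards_eq0; apply/eqP/setP => p; rewrite !inE eqxx.
have kn : (k < n)%N.
  rewrite -(ltr_nat R); apply: le_lt_trans (sample_bound_ge eps01 delta01 k2) _.
  by apply: le_lt_trans XN _; rewrite ltr_nat.
have run E F : (forall x s, sampling_outcome P m AL f eps delta q p0 (Ordinal k0) N M x s ->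
    F x <= `[< E s >]%:R) ->
    Ex (draw_weights k q N (M + M + N)) F <= Pr time O [:: algorithm] s0 E.
  by move=> hE; apply: le_trans (hPr _ _ hE) _; exact: Pr_leq.
split.
  (* Every outcome of the draws meets the query bound: the constant 1 is a lower bound of its
     indicator, so its probability is 1. *)
  have const : Ex (draw_weights k q N (M + M + N)) (fun=> 1) = 1 :> R.
    by apply/Ex_const/distr_draw_weights; [exact: ltnW | exact: leq_ltn_trans kn | case: good].
  apply: Pr1_surely; rewrite -[leLHS]const; apply: run => x s [hs [g' [out _]]]; rewrite asboolT //; split; first by exists g'.
  apply: le_trans hq; apply: (@le_trans _ _ ((N + M + M + N)%:R * k%:R)).
    by rewrite -natrM ler_nat.
  rewrite ler_wpM2r // !natrD; lra.
have hN : 4 * (10 ^+ 8 * k%:R ^+ 3) <= N%:R * (eps ^+ 2 * delta).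
  have ed : 0 < eps ^+ 2 * delta by rewrite mulr_gt0 // exprn_gt0.
  have k3 : 0 <= k%:R ^+ 3 :> R by rewrite exprn_ge0.
  move: XN; rewrite /sample_bound ler_pdivrMr //; apply: le_trans; lra.
apply: le_trans (run _ _ _).
  by apply: (labeling_Pr eps01 delta01 k2 (ltnW kn) learnsAL injP nbP p0 (Ordinal k0) optf good).
(* On draws that fail the indicator is 0 and nothing is required. *)
move=> x s [_ [g' [out hg']]]; case: (boolP (draw_success _ _ _ _ _ _ _ _ _ _)) => [ok|//].
rewrite asboolT //; exists g'; have [h1 h2] := hg' ok; split=> //.
  by apply: le_trans h1; rewrite ler_nat; apply: error_relabel.
by rewrite cost_relabel (is_optimal_OPT optf) in h2.
Qed.
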